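(* Let $d\geq 3$. Every primitive stable representation $F_2\to\mathrm{Isom}(\mathbb{H}^d)$ satisfies the bounded intersection property. Moreover, every discrete and faithful representation $F_2\to\mathrm{Isom}(\mathbb{H}^d)$ that has the bounded intersection property satisfies the $Q_\lambda$-conditions for all $\lambda>0$.
   Context: $\mathbb{H}^d$ is real hyperbolic $d$-space and $F_2=\langle a,b\rangle$ is the free group of rank two. An element of $F_2$ is primitive if it belongs to a generating pair (a basis) of $F_2$. Translation length: $\ell(\gamma)=\inf\{d(o,\gamma o): o\in\mathbb{H}^d\}$; $\gamma\in\mathrm{Isom}(\mathbb{H}^d)$ is hyperbolic if $\ell(\gamma)>0$, and then $\mathrm{Axis}(\gamma)$ is the unique oriented geodesic line preserved by $\gamma$. $Q_\lambda$-conditions (for $\lambda>0$): (1) $\rho(w)$ is hyperbolic for all primitive $w\in F_2$; (2) the set of conjugacy classes of primitive $w\in F_2$ with $\ell(\rho(w))\leq\lambda$ is finite. Primitive stable: there are $o\in\mathbb{H}^d$ and constants $K,c>0$ such that for every primitive $w\in F_2$, the orbit map $u\mapsto\rho(u)o$ sends the axis of $w$ (the unique $w$-invariant biinfinite geodesic in the Cayley graph of $F_2$ with respect to $\{a,b\}$) to a $(K,c)$-quasi-geodesic. Irreducible: $\rho(F_2)$ has no global fixed point in $\partial\mathbb{H}^d$. Palindromic elements: put $c=(ab)^{-1}$. An element of $F_2$ is palindromic in a basis $(x,y)$ if its reduced word in $x^{\pm1},y^{\pm1}$ reads the same forwards and backwards. A primitive $w\in F_2$ is $L$-palindromic if it is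 palindromic in $(a,b)$, $A$-palindromic if it is palindromic in $(c,a)$, and $B$-palindromic if it is palindromic in $(b,c)$. Base points: let $\rho$ be irreducible and send primitive elements to hyperbolic isometries, and write $A=\rho(a)$, $B=\rho(b)$. Let $H_A$, $H_B$, $H_L$ be common perpendicular lines to the pairs of lines $(\mathrm{Axis}(A),\mathrm{Axis}(AB))$, $(\mathrm{Axis}(B),\mathrm{Axis}(AB))$, $(\mathrm{Axis}(A),\mathrm{Axis}(B))$ respectively (if two axes intersect in $\mathbb{H}^d$, one chooses a common perpendicular through the intersection point). Put $o_L=H_L\cap\mathrm{Axis}(A)$, $o_A=H_A\cap\mathrm{Axis}(AB)$, $o_B=H_B\cap\mathrm{Axis}(B)$. Bounded intersection property of $\rho:F_2\to\mathrm{Isom}(\mathbb{H}^d)$: (1) $\rho$ is irreducible; (2) the images of primitive elements are hyperbolic; (3) there exists $M$ such that for all $X\in\{A,L,B\}$ and all $X$-palindromic primitive elements $w$, $d(o_X,\mathrm{Axis}(\rho(w)))\leq M$. *)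

(* Defs.v *)
From HB Require Import structures.
From mathcomp Require Import all_boot all_order all_algebra.
From mathcomp Require Import all_classical all_reals all_analysis.

Set Implicit Arguments.
Unset Strict Implicit.
Unset Printing Implicit Defensive.

Import Order.TTheory GRing.Theory Num.Theory.
Import numFieldNormedType.Exports.

Local Open Scope classical_set_scope.
Local Open Scope ring_scope.

(** * The free group of rank two *)

(* Letters x, x^-1, y, y^-1: the first component selects the generator
   ([false] for x, [true] for y), the second one tells whether it is inverted. *)
Definition letter : Type := (bool * bool)%type.

Definition linv (l : letter) : letter := (l.1, ~~ l.2).

Definition reduced (s : seq letter) : bool :=
  sorted (fun l m => m != linv l) s.

Record F2 := MkF2 { F2word : seq letter; _ : reduced F2word }.

HB.instance Definition _ := [isSub for F2word].
HB.instance Definition _ := [Choice of F2 by <:].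

Definition push (l : letter) (s : seq letter) : seq letter :=
  if s is m :: s' then (if m == linv l then s' else l :: s) else [:: l].

Definition reduce (s : seq letter) : seq letter := foldr push [::] s.

Lemma linvK : involutive linv.
Proof. by case=> i e; rewrite /linv /= negbK. Qed.

Lemma reduced_push l s : reduced s -> reduced (push l s).
Proof.
case: s => [|m s] //= rs; case: ifPn => [_|ml]; first exact: path_sorted rs.
by rewrite /reduced /= ml.
Qed.

Lemma reduced_foldr s t : reduced s -> reduced (foldr push s t).
Proof. by move=> rs; elim: t => [|l t IH] //=; apply: reduced_push. Qed.

Lemma reduced_reduce s : reduced (reduce s).
Proof. exact: reduced_foldr. Qed.

Lemma pushK l s : reduced s -> push l (push (linv l) s) = s.
Proof.
case: s => [|m s] /= rs; first by rewrite eqxx.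
rewrite linvK; case: eqP => [ml|_] /=; last by rewrite eqxx.
case: s rs => [|n s] /=; first by rewrite ml.
by rewrite -ml => /andP[/negPf-> _].
Qed.

Lemma foldr_push s t l : reduced s ->
  foldr push s (push l t) = push l (foldr push s t).
Proof.
case: t => [|m t] //= rs; case: eqP => [->|//].
by rewrite pushK // reduced_foldr.
Qed.

Lemma foldr_reduce s t : reduced s ->
  foldr push s (reduce t) = foldr push s t.
Proof. by move=> rs; elim: t => [|l t IH] //=; rewrite foldr_push // IH. Qed.

Lemma reduce_id s : reduced s -> reduce s = s.
Proof.
elim: s => [|l s IH] //= rs; rewrite IH; last exact: path_sorted rs.
by case: s rs {IH} => [|m s] //= /andP[/negPf-> _].
Qed.

Lemma reduce_catr s t : reduce (s ++ reduce t) = reduce (s ++ t).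
Proof.
by rewrite /reduce !foldr_cat -/(reduce t) -/(reduce _) reduce_id //
  reduced_reduce.
Qed.

Lemma reduce_catl s t : reduce (reduce s ++ t) = reduce (s ++ t).
Proof.
by rewrite {1 3}/reduce !foldr_cat foldr_reduce // reduced_reduce.
Qed.

Definition F2one : F2 := @MkF2 [::] isT.
Definition F2mul (u v : F2) : F2 :=
  MkF2 (reduced_reduce (F2word u ++ F2word v)).
Definition F2inv (u : F2) : F2 :=
  MkF2 (reduced_reduce (rev (map linv (F2word u)))).

Lemma F2mulA : associative F2mul.
Proof.
move=> u v w; apply: val_inj => /=.
by rewrite reduce_catr reduce_catl catA.
Qed.

Lemma F2mul1 : left_id F2one F2mul.
Proof. by case=> s rs; apply: val_inj; rewrite /= reduce_id. Qed.

Lemma F2mulr1 : right_id F2one F2mul.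
Proof. by case=> s rs; apply: val_inj; rewrite /= cats0 reduce_id. Qed.

Lemma F2mulV : left_inverse F2one F2inv F2mul.
Proof.
case=> s rs; apply: val_inj => /=.
rewrite reduce_catl {rs}.
elim: s => [|l s IH] //=; rewrite rev_cons cat_rcons -reduce_catr /=.
by rewrite -{2}(linvK l) pushK ?reduced_reduce // reduce_catr.
Qed.

Lemma F2mulrV : right_inverse F2one F2inv F2mul.
Proof.
move=> u; rewrite -[LHS]F2mul1 -{1}(F2mulV (F2inv u)) -F2mulA.
by rewrite (F2mulA (F2inv u)) F2mulV F2mul1 F2mulV.
Qed.

HB.instance Definition _ :=
  isGroup.Build F2 F2mulA F2mul1 F2mulr1 F2mulV F2mulrV.

Definition gen_a : F2 := @MkF2 [:: (false, false)] isT.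
Definition gen_b : F2 := @MkF2 [:: (true, false)] isT.
Definition gen_c : F2 := ((gen_a * gen_b)^-1)%g.

Definition letter_val (x y : F2) (l : letter) : F2 :=
  let z := if l.1 then y else x in if l.2 then (z^-1)%g else z.

Definition word_val (x y : F2) (s : seq letter) : F2 :=
  (\prod_(l <- s) letter_val x y l)%g.

(* Since F2 is Hopfian, a generating pair is the same thing as a basis. *)
Definition generating_pair (x y : F2) : Prop :=
  forall u : F2, exists s : seq letter, u = word_val x y s.

Definition primitive (w : F2) : Prop := exists v : F2, generating_pair w v.

Definition palindromic_in (x y w : F2) : Prop :=
  exists s : seq letter, [/\ reduced s, w = word_val x y s & rev s = s].

Inductive pal_type := PalA | PalL | PalB.

Definition palindromic (X : pal_type) (w : F2) : Prop :=
  match X with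
  | PalL => palindromic_in gen_a gen_b w
  | PalA => palindromic_in gen_c gen_a w
  | PalB => palindromic_in gen_b gen_c w
  end.

Definition conjugacy_class (w : F2) : set F2 := range (fun g : F2 => (w ^ g)%g).

(* The distance between two vertices of the Cayley graph with respect to
   {a, b}, on which F2 acts by left multiplication. *)
Definition word_dist (u v : F2) : nat := size (F2word (u^-1 * v)%g).

(* [p] runs through the successive vertices of a biinfinite geodesic of the
   Cayley graph that is invariant under [w]. *)
Definition cayley_axis (w : F2) (p : int -> F2) : Prop :=
  (forall i j : int, word_dist (p i) (p j) = `|i - j|%N) /\
  [set (w * u)%g | u in range p] = range p.

(** * Hyperbolic space, in the hyperboloid model *)

Definition lorentz (R : realType) (d : nat) (x y : 'rV[R]_d.+1) : R :=
  - (x ord0 ord0 * y ord0 ord0)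
  + \sum_(i < d) x ord0 (lift ord0 i) * y ord0 (lift ord0 i).

Definition hyp (R : realType) (d : nat) : Type :=
  {x : 'rV[R]_d.+1 | (lorentz x x == - 1) && (0 < x ord0 ord0)}.

Definition arcosh (R : realType) (t : R) : R := ln (t + Num.sqrt (t ^+ 2 - 1)).

Definition hdist (R : realType) (d : nat) (x y : hyp R d) : R :=
  arcosh (- lorentz (val x) (val y)).

Definition hdist_set (R : realType) (d : nat) (x : hyp R d)
    (S : set (hyp R d)) : R :=
  inf [set hdist x y | y in S].

(** ** The isometry group *)

Record Isom (R : realType) (d : nat) := MkIsom {
  isom_fun :> hyp R d -> hyp R d;
  isom_inv : hyp R d -> hyp R d;
  isom_funK : cancel isom_fun isom_inv;
  isom_invK : cancel isom_inv isom_fun;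
  isom_dist : forall x y, hdist (isom_fun x) (isom_fun y) = hdist x y }.

HB.instance Definition _ (R : realType) (d : nat) := gen_eqMixin (Isom R d).
HB.instance Definition _ (R : realType) (d : nat) := gen_choiceMixin (Isom R d).

Section IsomGroup.
Variables (R : realType) (d : nat).
Implicit Types f g h : Isom R d.

Lemma isom_ext f g : isom_fun f =1 isom_fun g -> f = g.
Proof.
case: f => f f' fK f'K fd; case: g => g g' gK g'K gd /= /funext fg.
rewrite {}fg in fK f'K fd *.
have f'g' : f' = g' by apply/funext => x; rewrite -{1}(g'K x) fK.
rewrite {}f'g' in fK f'K *.
by congr MkIsom; apply: Prop_irrelevance.
Qed.

Definition isom_one : Isom R d :=
  @MkIsom R d id id (fun=> erefl) (fun=> erefl) (fun _ _ => erefl).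

Lemma isom_mul_dist f g x y : hdist (f (g x)) (f (g y)) = hdist x y.
Proof. by rewrite !isom_dist. Qed.

Definition isom_mul f g : Isom R d :=
  @MkIsom R d (f \o g) (isom_inv g \o isom_inv f)
    (can_comp (@isom_funK _ _ f) (@isom_funK _ _ g))
    (can_comp (@isom_invK _ _ g) (@isom_invK _ _ f)) (isom_mul_dist f g).

Lemma isom_inv_dist f x y : hdist (isom_inv f x) (isom_inv f y) = hdist x y.
Proof. by rewrite -(isom_dist f) !isom_invK. Qed.

Definition isom_V f : Isom R d :=
  @MkIsom R d (isom_inv f) f (@isom_invK _ _ f) (@isom_funK _ _ f)
    (isom_inv_dist f).

Lemma isom_mulA : associative isom_mul.
Proof. by move=> f g h; apply: isom_ext. Qed.
Lemma isom_mul1 : left_id isom_one isom_mul.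
Proof. by move=> f; apply: isom_ext. Qed.
Lemma isom_mulr1 : right_id isom_one isom_mul.
Proof. by move=> f; apply: isom_ext. Qed.
Lemma isom_mulV : left_inverse isom_one isom_V isom_mul.
Proof. by move=> f; apply: isom_ext => x /=; rewrite isom_funK. Qed.
Lemma isom_mulrV : right_inverse isom_one isom_V isom_mul.
Proof. by move=> f; apply: isom_ext => x /=; rewrite isom_invK. Qed.

HB.instance Definition _ := isGroup.Build (Isom R d)
  isom_mulA isom_mul1 isom_mulr1 isom_mulV isom_mulrV.

End IsomGroup.

(** ** Lines, axes, common perpendiculars *)

Definition geodesic (R : realType) (d : nat) (g : R -> hyp R d) : Prop :=
  forall s t : R, hdist (g s) (g t) = `|s - t|.

Definition geodesic_ray (R : realType) (d : nat) (r : R -> hyp R d) : Prop :=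
  forall s t : R, 0 <= s -> 0 <= t -> hdist (r s) (r t) = `|s - t|.

Definition velocity (R : realType) (d : nat) (g : R -> hyp R d) (t : R) :
    'rV[R]_d.+1 :=
  derive1 (fun s : R => val (g s)) t.

Definition perpendicular (R : realType) (d : nat)
    (L L' : set (hyp R d)) : Prop :=
  exists g g' : R -> hyp R d,
    [/\ geodesic g, L = range g, geodesic g' & L' = range g'] /\
    (g 0 = g' 0 /\ lorentz (velocity g 0) (velocity g' 0) = 0).

Definition common_perpendicular (R : realType) (d : nat)
    (L1 L2 H : set (hyp R d)) : Prop :=
  [/\ perpendicular H L1, perpendicular H L2 & L1 `&` L2 `<=` H].

Definition translation_length (R : realType) (d : nat) (f : Isom R d) : R :=
  inf (range (fun o : hyp R d => hdist o (f o))).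

Definition hyperbolic (R : realType) (d : nat) (f : Isom R d) : Prop :=
  0 < translation_length f.

Definition preserved_line (R : realType) (d : nat) (f : Isom R d)
    (L : set (hyp R d)) : Prop :=
  exists2 g : R -> hyp R d, geodesic g /\ L = range g &
    exists2 tau : R, 0 < tau & forall t, f (g t) = g (t + tau).

(* For hyperbolic [f] there is exactly one such line; only its underlying set
   of points is recorded, the orientation being the direction of translation.
   For other [f] the value is a junk value. *)
Definition Axis (R : realType) (d : nat) (f : Isom R d) : set (hyp R d) :=
  xget set0 [set L | preserved_line f L].

(** * Representations *)

Definition representation (R : realType) (d : nat) : Type :=
  {multiplicative F2 -> Isom R d}.

(* A point of the boundary at infinity is a class of asymptotic geodesic
   rays. *)
Definition asymptotic (R : realType) (d : nat) (r r' : R -> hyp R d) : Prop :=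
  exists C : R, forall t : R, 0 <= t -> hdist (r t) (r' t) <= C.

Definition irreducible (R : realType) (d : nat)
    (rho : representation R d) : Prop :=
  ~ exists2 r : R -> hyp R d, geodesic_ray r &
      forall u : F2, asymptotic (fun t => rho u (r t)) r.

(* Every point of the image is isolated, for the compact-open topology on the
   isometry group: uniform convergence on closed balls, which are cofinal among
   the compact subsets of hyperbolic space. *)
Definition discrete_rep (R : realType) (d : nat)
    (rho : representation R d) : Prop :=
  forall u : F2, exists (o : hyp R d) (r eps : R), 0 < eps /\
    forall v : F2,
      (forall x, hdist o x <= r -> hdist (rho u x) (rho v x) < eps) ->
      rho v = rho u.

Definition faithful_rep (R : realType) (d : nat)
    (rho : representation R d) : Prop :=
  injective rho.

Definition primitive_hyperbolic (R : realType) (d : nat)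
    (rho : representation R d) : Prop :=
  forall w : F2, primitive w -> hyperbolic (rho w).

Definition Q_conditions (R : realType) (d : nat) (lambda : R)
    (rho : representation R d) : Prop :=
  primitive_hyperbolic rho /\
  finite_set [set conjugacy_class w |
    w in [set w | primitive w /\ translation_length (rho w) <= lambda]].

Definition quasi_geodesic (R : realType) (d : nat) (K c : R)
    (q : int -> hyp R d) : Prop :=
  forall i j : int,
    K^-1 * `|i - j|%:~R - c <= hdist (q i) (q j) <= K * `|i - j|%:~R + c.

Definition primitive_stable (R : realType) (d : nat)
    (rho : representation R d) : Prop :=
  exists (o : hyp R d) (K c : R), [/\ 0 < K, 0 < c &
    forall (w : F2) (p : int -> F2), primitive w -> cayley_axis w p ->
      quasi_geodesic K c (fun i => rho (p i) o)].

Definition foot_of_perpendicular (R : realType) (d : nat)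
    (L1 L2 L : set (hyp R d)) (o : hyp R d) : Prop :=
  exists2 H, common_perpendicular L1 L2 H & H `&` L = [set o].

Definition base_point (R : realType) (d : nat) (rho : representation R d)
    (X : pal_type) : hyp R d -> Prop :=
  let AxA := Axis (rho gen_a) in
  let AxB := Axis (rho gen_b) in
  let AxAB := Axis (rho gen_a * rho gen_b)%g in
  match X with
  | PalL => foot_of_perpendicular AxA AxB AxA
  | PalA => foot_of_perpendicular AxA AxAB AxAB
  | PalB => foot_of_perpendicular AxB AxAB AxB
  end.

Definition bounded_intersection (R : realType) (d : nat)
    (rho : representation R d) : Prop :=
  [/\ irreducible rho,
      primitive_hyperbolic rho &
      exists2 o : pal_type -> hyp R d, forall X, base_point rho X (o X) &
      exists M : R, forall (X : pal_type) (w : F2),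
        primitive w -> palindromic X w ->
        hdist_set (o X) (Axis (rho w)) <= M].

(* Main.v *)
(* A geodesic line is given by a point p and a unit tangent v; its ends are the
   null vectors p + v and p - v, and a point q at distance r from the line has
   <q, p>^2 - <q, v>^2 = cosh^2 r. Projection to a line contracts exponentially
   in the distance, so a quasi-geodesic segment stays at bounded distance from the
   line through its endpoints; by compactness a biinfinite quasi-geodesic follows
   a line, which is unique because two lines staying close in both directions
   have proportional null vectors. An isometry shifting the quasi-geodesic then
   has this line as its axis. An isometry of positive translation length l moves
   x by at least n l under its n-th power (compare midpoints), so its orbits are
   quasi-geodesics and it has an axis.

   Primitive stable implies bounded intersection. Axes of the images of primitive
   elements exist and follow the orbits of the Cayley axes. Reversal of words
   maps an X-palindrome to itself or to its conjugate by a letter; having the same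
   length, it is cyclically reduced in a, b, so its Cayley axis passes through 1
   and the axis of its image passes near the base point o. A global fixed point at
   infinity would give a homomorphism to the reals whose absolute value is the
   translation length on primitive elements, hence bounded below by 1/K, which
   Euclid's algorithm on bases contradicts. By irreducibility the axes of a, b, ab
   have no common ends, so the distance between points of two of them is of the
   form arcosh of a e^(s+t) + b e^(s-t) + c e^(t-s) + e e^(-s-t) with positive
   coefficients; its critical point gives the common perpendicular.

   Conversely, Nielsen reduction shows that for every basis (x, y) there is a
   palindrome g with rev x = g x g^-1 and rev y = g y g^-1. Writing g = t z (rev t)
   with z empty or a letter, every primitive element is conjugate to an
   X-palindrome. With bounded intersection, a palindrome of translation length at
   most lambda moves the base point a bounded distance, and a discrete faithful
   representation has only finitely many such elements. *)
Require Import Defs.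
From mathcomp Require Import all_boot all_order all_algebra.
From mathcomp Require Import all_classical all_reals all_analysis.
From mathcomp Require Import zify ring lra.
Import Order.TTheory GRing.Theory Num.Theory.
Import numFieldNormedType.Exports.

Set Implicit Arguments.
Unset Strict Implicit.
Unset Printing Implicit Defensive.

Local Open Scope ring_scope.

(** * The free group of rank two *)

Lemma linv_neq (l : letter) : (l == linv l) = false.
Proof. by case: l => [[] []]. Qed.

Lemma linv_sym (l m : letter) : (m == linv l) = (l == linv m).
Proof. by case: l m => [[] []] [[] []]. Qed.

Definition F2_of (s : seq letter) : F2 := MkF2 (reduced_reduce s).

Lemma F2_of_cat s t : F2_of (s ++ t) = (F2_of s * F2_of t)%g.
Proof. by apply: val_inj; rewrite /= reduce_catl reduce_catr. Qed.

Lemma F2_of_word u : F2_of (F2word u) = u.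
Proof. by case: u => s rs; apply: val_inj; rewrite /= reduce_id. Qed.

Lemma F2_of_nil : F2_of [::] = 1%g.
Proof. exact: val_inj. Qed.

Lemma F2word_reduced u : reduced (F2word u).
Proof. by case: u. Qed.

Lemma F2word_of s : reduced s -> F2word (F2_of s) = s.
Proof. exact: reduce_id. Qed.

Definition len (u : F2) : nat := size (F2word u).

Lemma len_eq0 u : (len u == 0%N) = (u == 1%g).
Proof.
apply/eqP/eqP => [/size0nil u0|->//].
by rewrite -(F2_of_word u) u0 F2_of_nil.
Qed.

Lemma size_reduce s : (size (reduce s) <= size s)%N.
Proof.
elim: s => //= l s IH; case: (reduce s) IH => [|m t] //= st.
by case: ifP => _ /=; lia.
Qed.

Lemma lenM u v : (len (u * v)%g <= len u + len v)%N.
Proof. by rewrite /len -size_cat; apply: size_reduce. Qed.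

Lemma reduced_rev s : reduced (rev s) = reduced s.
Proof.
rewrite /reduced rev_sorted; case: s => //= l s.
elim: s l => //= m s IH l; rewrite IH.
by rewrite linv_sym.
Qed.

Definition invw (s : seq letter) := rev (map linv s).

Lemma size_invw s : size (invw s) = size s.
Proof. by rewrite /invw size_rev size_map. Qed.

Lemma reduced_invw s : reduced (invw s) = reduced s.
Proof.
rewrite reduced_rev /reduced; case: s => //= l s.
elim: s l => //= m s IH l; rewrite IH (inj_eq (can_inj linvK)).
by congr andb.
Qed.

Lemma invwK : involutive invw.
Proof. by move=> s; rewrite /invw map_rev revK mapK //; apply: linvK. Qed.

Lemma F2wordV u : F2word u^-1%g = invw (F2word u).
Proof. by rewrite /= reduce_id // reduced_invw F2word_reduced. Qed.

Lemma lenV u : len u^-1%g = len u.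
Proof. by rewrite /len F2wordV size_invw. Qed.

Lemma F2_of_inv s : F2_of (invw s) = (F2_of s)^-1%g.
Proof.
apply/eqP; rewrite -mulg_eq1 -F2_of_cat; apply/eqP.
elim: s => [|l s IH]; first exact: F2_of_nil.
rewrite /invw /= rev_cons -/(invw s) cat_rcons F2_of_cat.
have -> : linv l :: l :: s = [:: linv l; l] ++ s by [].
rewrite F2_of_cat (_ : F2_of [:: linv l; l] = 1%g) ?mul1g -?F2_of_cat //.
by apply: val_inj; rewrite /= linvK eqxx.
Qed.

(** ** Reversal of words *)

Lemma reduce_rev s : reduce (rev s) = rev (reduce s).
Proof.
have H l t : reduced t -> reduce (rev t ++ [:: l]) = rev (push l t).
  case: t => [|m t] //= rt; case: ifP => [/eqP ml|ml].
    rewrite rev_cons cat_rcons -reduce_catr /= ml linvK eqxx cats0.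
    by rewrite reduce_id // reduced_rev; apply: path_sorted rt.
  by rewrite cats1 -rev_cons reduce_id // reduced_rev /reduced /= ml.
elim: s => [|l s IH] //=.
by rewrite rev_cons -cats1 -reduce_catl IH H // reduced_reduce.
Qed.

Definition F2rev (u : F2) : F2 := F2_of (rev (F2word u)).

Lemma F2word_rev u : F2word (F2rev u) = rev (F2word u).
Proof. by rewrite F2word_of // reduced_rev F2word_reduced. Qed.

Lemma F2revK : involutive F2rev.
Proof. by move=> u; rewrite {1}/F2rev F2word_rev revK F2_of_word. Qed.

Lemma F2revM u v : F2rev (u * v)%g = (F2rev v * F2rev u)%g.
Proof.
apply: val_inj.
by rewrite /= reduce_catl reduce_catr -rev_cat !reduce_rev (reduce_id (reduced_reduce _)).
Qed.

Lemma F2rev1 : F2rev 1%g = 1%g.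
Proof. exact: val_inj. Qed.

Lemma F2revV u : F2rev u^-1%g = (F2rev u)^-1%g.
Proof. by apply/eqP; rewrite -mulg_eq1 -F2revM mulgV F2rev1. Qed.

Lemma len_rev u : len (F2rev u) = len u.
Proof. by rewrite /len F2word_rev size_rev. Qed.

(** ** Words in two elements *)

Lemma letter_valV x y l : letter_val x y (linv l) = ((letter_val x y l)^-1)%g.
Proof. by case: l => [[] []] /=; rewrite /letter_val /= ?invgK. Qed.

Lemma word_val_cons x y l s :
  word_val x y (l :: s) = (letter_val x y l * word_val x y s)%g.
Proof. by rewrite /word_val big_cons. Qed.

Lemma word_val_cat x y s t :
  word_val x y (s ++ t) = (word_val x y s * word_val x y t)%g.
Proof. by rewrite /word_val big_cat. Qed.

Lemma word_val_reduce x y s : word_val x y (reduce s) = word_val x y s.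
Proof.
elim: s => //= l s IH; rewrite word_val_cons -IH.
case: (reduce s) => [|m t] /=; first by rewrite word_val_cons.
case: ifP => [/eqP ->|_]; last by rewrite word_val_cons.
by rewrite word_val_cons letter_valV mulVKg.
Qed.

Lemma word_val_inv x y s : word_val x y (invw s) = ((word_val x y s)^-1)%g.
Proof.
elim: s => [|l s IH]; first by rewrite /word_val !big_nil invg1.
rewrite /invw /= rev_cons -cats1 word_val_cat IH [in RHS]word_val_cons invgM; congr (_ * _)%g.
by rewrite word_val_cons letter_valV /word_val big_nil mulg1.
Qed.

Lemma word_val_ab s : word_val gen_a gen_b s = F2_of s.
Proof.
elim: s => [|l s IH]; first by rewrite /word_val big_nil F2_of_nil.
rewrite word_val_cons IH -cat1s F2_of_cat; congr (_ * _)%g.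
by apply: val_inj; case: l => [[] []].
Qed.

(** Replaces words by an induction principle: a property closed under products and inverses spreads
    from the two generators to the whole group. Comparing two pairs then amounts to expressing the
    generators of one by the other. *)
Lemma generating_pairP x y : generating_pair x y <->
  forall P : F2 -> Prop, P x -> P y -> P 1%g ->
    (forall u v, P u -> P v -> P (u * v)%g) -> (forall u, P u -> P u^-1%g) ->
    forall u, P u.
Proof.
split=> [gxy P Px Py P1 PM PV u | H u].
  have [s ->] := gxy u; elim: s => [|l s IH]; first by rewrite /word_val big_nil.
  rewrite word_val_cons; apply: PM => //.
  by case: l => [[] []]; rewrite /letter_val /=; try apply: PV.
apply: (H (fun u => exists s, u = word_val x y s)) => {u}.
- by exists [:: (false, false)]; rewrite word_val_cons /word_val big_nil mulg1.
- by exists [:: (true, false)]; rewrite word_val_cons /word_val big_nil mulg1.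
- by exists [::]; rewrite /word_val big_nil.
- by move=> u v [s ->] [t ->]; exists (s ++ t); rewrite word_val_cat.
- by move=> u [s ->]; exists (invw s); rewrite word_val_inv.
Qed.

Lemma generating_ab : generating_pair gen_a gen_b.
Proof. by move=> u; exists (F2word u); rewrite word_val_ab F2_of_word. Qed.

Definition F2_ind := (generating_pairP gen_a gen_b).1 generating_ab.

Lemma generating_swap x y : generating_pair x y -> generating_pair y x.
Proof. by rewrite !generating_pairP => H P Py Px; apply: H. Qed.

Lemma generating_inv x y : generating_pair x y -> generating_pair x^-1%g y.
Proof.
rewrite !generating_pairP => H P Px Py P1 PM PV; apply: H => //.
by rewrite -(invgK x); apply: PV.
Qed.

Lemma generating_mul x y : generating_pair x y -> generating_pair (x * y)%g y.
Proof.
rewrite !generating_pairP => H P Px Py P1 PM PV; apply: H => //.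
by rewrite -(mulgK y x); apply: PM => //; apply: PV.
Qed.

Lemma generating_conj h x y :
  generating_pair x y -> generating_pair (x ^ h)%g (y ^ h)%g.
Proof.
rewrite !generating_pairP => H P Px Py P1 PM PV u.
rewrite -(conjgKV h u); move: (u ^ h^-1)%g => {}u.
apply: (H (fun u => P (u ^ h)%g)) => //.
- by rewrite conj1g.
- by move=> v w Pv Pw; rewrite conjMg; apply: PM.
- by move=> v Pv; rewrite conjVg; apply: PV.
Qed.

(** If [x] were trivial, [y] alone would generate the group, which would be abelian; but [a] and [b]
    do not commute. *)
Lemma generating_neq1 x y : generating_pair x y -> x != 1%g.
Proof.
rewrite generating_pairP => H; apply/eqP => x1.
suff : commute gen_a gen_b by move/(congr1 F2word).
have comm u : commute u y.
  apply: (H (fun u => commute u y)).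
  - by rewrite x1; apply/commute_sym/commute1.
  - exact: commute_refl.
  - exact/commute_sym/commute1.
  - by move=> v w cv cw; apply/commute_sym/commuteM; apply/commute_sym.
  - by move=> v cv; apply/commute_sym/commuteV/commute_sym.
apply: (H (commute gen_a)).
- by rewrite x1; apply: commute1.
- exact: comm.
- exact: commute1.
- by move=> v w cv cw; apply: commuteM.
- by move=> v cv; apply: commuteV.
Qed.

Lemma primitive_neq1 w : primitive w -> w != 1%g.
Proof. by case=> v /generating_neq1. Qed.

Lemma primitive_conj w h : primitive w -> primitive (w ^ h)%g.
Proof. by case=> v gwv; exists (v ^ h)%g; apply: generating_conj. Qed.

Definition word_hom (x y u : F2) : F2 := word_val x y (F2word u).

Lemma word_homM x y u v : word_hom x y (u * v)%g = (word_hom x y u * word_hom x y v)%g.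
Proof. by rewrite /word_hom word_val_reduce word_val_cat. Qed.

Lemma word_hom1 x y : word_hom x y 1%g = 1%g.
Proof. by rewrite /word_hom /word_val big_nil. Qed.

Lemma word_homV x y u : word_hom x y u^-1%g = (word_hom x y u)^-1%g.
Proof. by rewrite /word_hom F2wordV word_val_inv. Qed.

Lemma word_hom_a x y : word_hom x y gen_a = x.
Proof. by rewrite /word_hom word_val_cons /word_val big_nil mulg1. Qed.

Lemma word_hom_b x y : word_hom x y gen_b = y.
Proof. by rewrite /word_hom word_val_cons /word_val big_nil mulg1. Qed.

Definition word_homE := (word_homM, word_homV, word_hom_a, word_hom_b, word_hom1).

Lemma gen_cE : gen_c = (gen_b^-1 * gen_a^-1)%g.
Proof. by rewrite /gen_c invgM. Qed.

(* The order three automorphism a -> c -> b -> a, whose square is its inverse,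
   carries the three kinds of palindromes to each other. *)
Definition rot : F2 -> F2 := word_hom gen_c gen_a.
Definition rotV : F2 -> F2 := word_hom gen_b gen_c.

Lemma rotK : cancel rot rotV.
Proof.
apply: F2_ind; rewrite /rot /rotV ?gen_cE ?word_homE ?gen_cE //.
- by rewrite invgM !invgK mulgK.
- by move=> u v Hu Hv; rewrite !word_homE Hu Hv.
- by move=> u Hu; rewrite !word_homE Hu.
Qed.

Lemma rotVK : cancel rotV rot.
Proof.
apply: F2_ind; rewrite /rot /rotV ?gen_cE ?word_homE ?gen_cE //.
- by rewrite invgM !invgK mulKg.
- by move=> u v Hu Hv; rewrite !word_homE Hu Hv.
- by move=> u Hu; rewrite !word_homE Hu.
Qed.

Lemma F2rev_a : F2rev gen_a = gen_a. Proof. exact: val_inj. Qed.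
Lemma F2rev_b : F2rev gen_b = gen_b. Proof. exact: val_inj. Qed.

(** The left side is the reversal of words in the basis (c, a). Both sides are anti-homomorphisms,
    so a check on the generators suffices. *)
Lemma rot_rev u : rot (F2rev (rotV u)) = (gen_a * F2rev u * gen_a^-1)%g.
Proof.
move: u; apply: F2_ind; rewrite /rot /rotV.
- by rewrite !word_homE F2rev_b F2rev_a word_homE mulgK.
- rewrite !word_homE gen_cE F2revM !F2revV F2rev_a F2rev_b !word_homE invgM.
  by rewrite !invgK.
- by rewrite !word_homE F2rev1 !word_homE mulg1 mulgV.
- move=> v w Hv Hw; rewrite word_homM F2revM word_homM Hv Hw.
  by rewrite F2revM !mulgA mulgVK.
- move=> v Hv; rewrite word_homV F2revV word_homV Hv.
  by rewrite F2revV !invgM invgK mulgA.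
Qed.

Lemma rotV_rev u : rotV (F2rev (rot u)) = (gen_b^-1 * F2rev u * gen_b)%g.
Proof.
move: u; apply: F2_ind; rewrite /rot /rotV.
- rewrite !word_homE gen_cE F2revM !F2revV F2rev_a F2rev_b !word_homE invgM.
  by rewrite !invgK mulgA.
- by rewrite !word_homE F2rev_a F2rev_b word_homE mulVg mul1g.
- by rewrite !word_homE F2rev1 !word_homE mulg1 mulVg.
- move=> v w Hv Hw; rewrite word_homM F2revM word_homM Hv Hw.
  by rewrite F2revM !mulgA mulgK.
- move=> v Hv; rewrite word_homV F2revV word_homV Hv.
  by rewrite F2revV !invgM invgK mulgA.
Qed.

Lemma palindromic_inP x y w : palindromic_in x y w <->
  exists2 u, F2rev u = u & w = word_hom x y u.
Proof.
split=> [[s [rs -> revs]]|[u ru ->]].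
  exists (F2_of s); first by rewrite /F2rev F2word_of // revs.
  by rewrite /word_hom F2word_of.
exists (F2word u); split=> //; first exact: F2word_reduced.
by rewrite -F2word_rev ru.
Qed.

(* The anti-automorphism fixing both elements of the basis in which [w] is
   palindromic is the reversal of words in a, b followed by a conjugation. *)
Lemma palindromicP X w : palindromic X w <->
  F2rev w = match X with
    | PalL => w
    | PalA => (w ^ gen_a)%g
    | PalB => (w ^ gen_b^-1)%g
    end.
Proof.
case: X => /=; rewrite palindromic_inP.
- split=> [[u ru ->]|rw].
    move: (rot_rev (rot u)); rewrite rotK ru -[word_hom _ _ _]/(rot u) => E.
    by rewrite {2}E conjgE !mulgA mulgVK mulVg mul1g.
  exists (rotV w); last by rewrite -[RHS]/(rot _) rotVK.
  by apply: (can_inj rotK); rewrite rot_rev rw rotVK conjgE !mulgA mulgV mul1g mulgK.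
- have E u : word_hom gen_a gen_b u = u by rewrite /word_hom word_val_ab F2_of_word.
  by split=> [[u ru ->]|rw]; [rewrite E | exists w].
- split=> [[u ru ->]|rw].
    move: (rotV_rev (rotV u)); rewrite rotVK ru -[word_hom _ _ _]/(rotV u) => E.
    by rewrite {2}E conjgE invgK !mulgA mulgK mulgV mul1g.
  exists (rot w); last by rewrite -[RHS]/(rotV _) rotK.
  apply: (can_inj rotVK); rewrite rotV_rev rw rotK conjgE invgK !mulgA mulVg mul1g.
  by rewrite mulgVK.
Qed.

Lemma rev_palindrome (s : seq letter) : rev s = s ->
  exists t z, s = t ++ z ++ rev t /\ (size z <= 1)%N.
Proof.
have [n] := ubnP (size s); elim: n s => // n IH s sn.
case: s sn => [|l s] sn; first by exists [::], [::].
case/lastP: s sn => [|s m] sn; first by exists [::], [:: l].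
rewrite rev_cons rev_rcons /= => -[ml /rcons_inj[rs _]].
have [||t [z [st sz]]] := IH s; [by move: sn; rewrite /= size_rcons; lia|by []|].
exists (l :: t), z; split=> //.
by rewrite {1}st ml rev_cons -!rcons_cat.
Qed.

(* If [rev g = g] then [g = t z (rev t)] with [z] of length at most one, so
   conjugating [w] by [rev t] replaces [g] by [z]. *)
Lemma conj_palindromic (w g : F2) : F2rev g = g ->
  F2rev w = (g * w * g^-1)%g -> exists X h, palindromic X (w ^ h)%g.
Proof.
move=> rg rw.
have := @rev_palindrome (F2word g); rewrite -F2word_rev rg => /(_ erefl).
move=> [t [z [gE sz]]].
pose h := F2_of t.
have rh : F2_of (rev t) = F2rev h.
  by rewrite /F2rev /h; apply: val_inj; rewrite /= !reduce_rev (reduce_id (reduced_reduce _)).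
have {}gE : g = (h * F2_of z * F2rev h)%g.
  by rewrite -rh /h -!F2_of_cat -catA -gE F2_of_word.
set w' := (w ^ (F2rev h)^-1)%g.
have rw' : F2rev w' = (w' ^ (F2_of z)^-1)%g.
  rewrite /w' !conjgE !invgK !F2revM F2revV F2revK rw gE !invgM.
  by rewrite !mulgA mulVg mul1g mulgVK.
suff [X [k pX]] : exists X k, palindromic X (w' ^ k)%g.
  by exists X, ((F2rev h)^-1 * k)%g; rewrite conjgM.
clearbody w'; case: z sz gE rw' => [|l [|//]] _ _ rw'.
  by exists PalL, 1%g; apply/palindromicP; rewrite conjg1 rw' F2_of_nil invg1 conjg1.
have lE : F2_of [:: l] = letter_val gen_a gen_b l.
  by rewrite -word_val_ab word_val_cons /word_val big_nil mulg1.
(* For [z] equal to b or a^-1 the relation is already that of a B- or A-palindrome; for b^-1 and a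
   one more conjugation by the letter inverts the exponent. *)
move: rw'; rewrite {}lE; case: l => [[] []]; rewrite /letter_val /= ?invgK => rw'.
- by exists PalB, gen_b; apply/palindromicP;
    rewrite -conjgM mulgV conjg1 conjgE !F2revM F2revV F2rev_b rw'
      conjgE !mulgA !mulgK mulgV mul1g.
- by exists PalB, 1%g; apply/palindromicP; rewrite !conjg1.
- by exists PalA, 1%g; apply/palindromicP; rewrite !conjg1.
- by exists PalA, gen_a^-1%g; apply/palindromicP;
    rewrite -conjgM mulVg conjg1 conjgE !F2revM invgK F2revV F2rev_a rw'
      conjgE invgK !mulgA !mulgVK mulVg mul1g.
Qed.

(** ** Nielsen reduction *)

Fixpoint lcp (s t : seq letter) : nat :=
  match s, t with
  | l :: s', m :: t' => if l == m then (lcp s' t').+1 else 0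
  | _, _ => 0
  end.

Lemma lcpC s t : lcp s t = lcp t s.
Proof. by elim: s t => [|l s IH] [|m t] //=; rewrite eq_sym IH. Qed.

Lemma lcp_ultra s t u : (minn (lcp s t) (lcp t u) <= lcp s u)%N.
Proof.
elim: s t u => [|l s IH] [|m t] [|n u] //=; rewrite ?min0n ?minn0 //.
case: eqP => [<-|_]; last by rewrite min0n.
by case: eqP => _; rewrite ?minn0 // minnSS ltnS.
Qed.

Lemma lcp_take k s t : (k <= lcp s t)%N -> take k s = take k t.
Proof.
elim: k s t => [|k IH] [|l s] [|m t] //=.
by case: eqP => // -> /IH ->.
Qed.

Lemma take_lcp k s t : (k <= size s)%N -> (k <= size t)%N ->
  take k s = take k t -> (k <= lcp s t)%N.
Proof.
elim: k s t => [|k IH] [|l s] [|m t] //=; rewrite !ltnS => ks kt [-> st].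
by rewrite eqxx ltnS; apply: IH.
Qed.

(** The Gromov product at 1 in the Cayley tree; it counts the letters lost from each of [u] and [v]
    in the product [u^-1 v]. *)
Definition gro (u v : F2) : nat := lcp (F2word u) (F2word v).

Lemma groC u v : gro u v = gro v u. Proof. exact: lcpC. Qed.

Lemma len_gro u v : (len (u^-1 * v)%g + 2 * gro u v = len u + len v)%N.
Proof.
rewrite /len /= reduce_catl -/(invw _) /gro.
case: u v => [s rs] [t rt] /=.
have -> : (size (reduce (invw s ++ t)) + 2 * lcp s t = size s + size t)%N; last by [].
elim: s t rs rt => [|l s IH] [|m t] rs rt.
- by [].
- by rewrite cat0s reduce_id //= muln0 addn0.
- by rewrite cats0 reduce_id ?size_invw ?reduced_invw //= muln0.
rewrite [lcp _ _]/=.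
case: eqP => [lm|/eqP lm].
  rewrite -lm /invw /= rev_cons cat_rcons -/(invw s).
  have -> : reduce (invw s ++ [:: linv l, l & t]) = reduce (invw s ++ t).
    rewrite -reduce_catr -[in RHS]reduce_catr; congr (reduce (_ ++ _)).
    have := F2_of_cat [:: linv l; l] t.
    rewrite (_ : F2_of [:: linv l; l] = 1%g); last first.
      by apply: val_inj; rewrite /= linvK eqxx.
    by rewrite mul1g => /(congr1 F2word).
  have := IH t (path_sorted rs) (path_sorted rt); lia.
rewrite reduce_id; first by rewrite size_cat size_invw /=; lia.
rewrite /reduced sorted_cat_cons; apply/andP; split; last exact: rt.
have -> : rcons (invw (l :: s)) m = rev (m :: map linv (l :: s)).
  by rewrite rev_cons.
rewrite -/(reduced _) reduced_rev /reduced /= (inj_eq (can_inj linvK)) lm /=.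
have : reduced (invw (l :: s)) by rewrite reduced_invw.
by rewrite reduced_rev.
Qed.

Lemma len_mul_gro u v : (len (u * v)%g + 2 * gro u^-1%g v = len u + len v)%N.
Proof. by have := len_gro u^-1%g v; rewrite invgK lenV. Qed.

Lemma gro_ultra u v w : (minn (gro u v) (gro v w) <= gro u w)%N.
Proof. exact: lcp_ultra. Qed.

Lemma nth_invw s i : (i < size s)%N ->
  nth (false, false) (invw s) i = linv (nth (false, false) s (size s - i.+1)).
Proof.
move=> si; rewrite /invw nth_rev ?size_map // (nth_map (false, false)) //.
by rewrite ltn_subrL /=; apply: leq_ltn_trans si.
Qed.

(** If half of [u] cancelled in [u u], letters placed symmetrically about the middle would be
    mutually inverse. In odd length the middle letter would be its own inverse, in even length the
    two middle letters would cancel. *)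
Lemma gro_self_inv u : u != 1%g -> (2 * gro u^-1%g u < len u)%N.
Proof.
rewrite -len_eq0 -lt0n; case: u => s rs; rewrite /gro F2wordV /len /= => s0.
rewrite ltnNge; apply/negP => le.
have key i : (i < lcp (invw s) s)%N -> (i < size s)%N ->
    linv (nth (false, false) s (size s - i.+1)) = nth (false, false) s i.
  move=> il si; rewrite -nth_invw // -(nth_take _ il) (lcp_take (leqnn _)).
  by rewrite nth_take.
have [sodd|seven] := boolP (odd (size s)).
  have := key (size s)./2; rewrite (_ : size s - _.+1 = (size s)./2)%N; last by lia.
  have H := odd_double_half (size s).
  by move=> /(_ ltac:(lia) ltac:(lia)) /esym/eqP; rewrite linv_neq.
have H := odd_double_half (size s).
have := key (size s)./2.-1.
rewrite (_ : size s - _.+1 = (size s)./2.-1.+1)%N; last by lia.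
move=> /(_ ltac:(lia) ltac:(lia)) /esym E.
have s1 : ((size s)./2.-1.+1 < size s)%N by lia.
have /(sortedP (false, false)) /(_ _ s1) := rs.
by rewrite E linvK eqxx.
Qed.

(** Simultaneous conjugation counts as a move, so that minimality of length also holds among
    conjugate pairs; [gr_lt] relies on it when exactly half cancels on both sides. *)
Inductive nielsen (x y : F2) : F2 -> F2 -> Prop :=
  | nielsen_refl : nielsen x y x y
  | nielsen_swap x' y' : nielsen x y x' y' -> nielsen x y y' x'
  | nielsen_inv x' y' : nielsen x y x' y' -> nielsen x y x'^-1%g y'
  | nielsen_mul x' y' : nielsen x y x' y' -> nielsen x y (x' * y')%g y'
  | nielsen_conj h x' y' : nielsen x y x' y' -> nielsen x y (x' ^ h)%g (y' ^ h)%g.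

Lemma nielsen_generating x y x' y' :
  nielsen x y x' y' -> generating_pair x y -> generating_pair x' y'.
Proof.
move=> H gxy; elim: H => // {x' y'} [x' y' _|x' y' _|x' y' _|h x' y' _].
- exact: generating_swap.
- exact: generating_inv.
- exact: generating_mul.
- exact: generating_conj.
Qed.

Lemma nielsen_inv2 x y x' y' : nielsen x y x' y' -> nielsen x y x' y'^-1%g.
Proof. by move=> /nielsen_swap/nielsen_inv/nielsen_swap. Qed.

(* Invariant under Nielsen moves; it holds trivially when [x] and [y] are
   letters. *)
Definition revs_by_conj (x y : F2) : Prop := exists g : F2,
  [/\ F2rev g = g, F2rev x = (g * x * g^-1)%g & F2rev y = (g * y * g^-1)%g].

Lemma revs_by_conj_nielsen x y x' y' :
  nielsen x y x' y' -> revs_by_conj x' y' -> revs_by_conj x y.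
Proof.
elim=> // {x' y'} [x' y' _ IH|x' y' _ IH|x' y' _ IH|h x' y' _ IH] [g [rg rx ry]].
- by apply: IH; exists g.
- apply: IH; exists g; split=> //.
  by apply: invg_inj; rewrite -F2revV rx !invgM !invgK mulgA.
(* Reversal swaps the factors of [x' y'], so the conjugator absorbs [y'^-1]; it remains a palindrome
   because reversal conjugates [y'] by [g]. *)
- apply: IH; exists (g * y'^-1)%g; split.
  + by rewrite F2revM F2revV ry rg !invgM !invgK !mulgA mulgVK.
  + have -> : F2rev x' = F2rev (x' * y' * y'^-1)%g by rewrite mulgK.
    by rewrite F2revM F2revV rx ry !invgM !invgK !mulgA !mulgVK.
  + by rewrite ry !invgM !invgK !mulgA mulgVK.
- pose k := ((F2rev h)^-1 * g * h^-1)%g.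
  have E u : F2rev (u ^ h)%g = (g * (u ^ h) * g^-1)%g -> F2rev u = (k * u * k^-1)%g.
    have -> : u = ((u ^ h) ^ h^-1)%g by rewrite conjgK.
    rewrite conjgKV; move: (u ^ h)%g => v rv.
    by rewrite /k !conjgE !invgK !F2revM F2revV rv !invgM !invgK !mulgA !mulgVK.
  apply: IH; exists k; split; [|exact: E|exact: E].
  by rewrite /k !F2revM !F2revV F2revK rg !mulgA.
Qed.

Section NielsenReduced.
Variables x y : F2.
Hypothesis gxy : generating_pair x y.
Hypothesis min_xy : forall x' y', nielsen x y x' y' ->
  (len x + len y <= len x' + len y')%N.

Let val_ (l : letter) : F2 := letter_val x y l.

Lemma nielsen_letters l m : l.1 != m.1 ->
  nielsen x y (val_ l) (val_ m) /\ (len (val_ l) + len (val_ m) = len x + len y)%N.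
Proof.
have B := nielsen_refl x y; have S := nielsen_swap B.
rewrite /val_; case: l m => [[] []] [[] []] // _; rewrite /letter_val /= ?lenV ?(addnC (len y)).
all: split=> //; by do ?[exact: B | exact: S | apply: nielsen_inv | apply: nielsen_inv2].
Qed.

Lemma letters_neq1 l : val_ l != 1%g.
Proof.
have nx := generating_neq1 gxy; have ny := generating_neq1 (generating_swap gxy).
by case: l => [[] []]; rewrite /val_ /letter_val /= ?invg_eq1.
Qed.

Let gr l m := gro (val_ l)^-1%g (val_ m).

(** If more than half of a factor cancelled, replacing the other entry by the product would be a
    Nielsen move to a shorter pair. *)
Lemma gr_diff l m : l.1 != m.1 ->
  (2 * gr l m <= len (val_ l))%N /\ (2 * gr l m <= len (val_ m))%N.
Proof.
move=> lm; have [nlm slm] := nielsen_letters lm.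
have := len_mul_gro (val_ l) (val_ m); rewrite -/(gr l m) => E.
have := min_xy (nielsen_mul nlm).
have H : nielsen x y (val_ l) (val_ l * val_ m)%g.
  have := nielsen_mul (nielsen_inv (nielsen_inv2 (nielsen_swap nlm))).
  by move=> /nielsen_inv/nielsen_inv2/nielsen_swap; rewrite invgM !invgK.
by have := min_xy H; lia.
Qed.

Lemma gr_same l m : m != linv l -> l.1 = m.1 ->
  (2 * gr l m < len (val_ l))%N /\ (2 * gr l m < len (val_ m))%N.
Proof.
move=> ml lm; have <- : l = m by case: l m ml lm => [[] []] [[] []].
by have := gro_self_inv (letters_neq1 l); rewrite /gr.
Qed.

Lemma gr_half l m : m != linv l ->
  (2 * gr l m <= len (val_ l))%N /\ (2 * gr l m <= len (val_ m))%N.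
Proof.
move=> ml; have [/(gr_same ml)[]|] := eqVneq l.1 m.1; last exact: gr_diff.
by move=> /ltnW ? /ltnW.
Qed.

Lemma take_invw k s : (k <= size s)%N -> take k (invw s) = invw (drop (size s - k) s).
Proof.
move=> ks; rewrite /invw map_drop take_rev size_map.
by congr (rev (drop _ _)).
Qed.

(* If both neighbours of [t = val m] cancel exactly half of it, then
   [t = p q^-1] with [u = q r p^-1], and conjugating [(u t, t)] by [q] gives the
   shorter pair [(r, q^-1 p)]. *)
Lemma gr_lt l m n : m != linv l -> n != linv m ->
  (gr l m + gr m n < len (val_ m))%N.
Proof.
move=> ml nm; have [_ h1] := gr_half ml; have [h2 h2'] := gr_half nm.
rewrite ltn_neqAle; apply/andP; split; last by lia.
apply/eqP => e.
have {}lm : l.1 != m.1.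
  by apply/eqP => /(gr_same ml)[_]; lia.
have {}mn : m.1 != n.1.
  by apply/eqP => /(gr_same nm)[]; lia.
have [k1 k2] : gr l m = gr m n /\ (2 * gr m n = len (val_ m))%N by lia.
set k := gr m n in k1 k2.
have tk s : (size (take k s) <= k)%N by rewrite size_take; case: ltnP; lia.
set p := take k (F2word (val_ m)).
have E1 : take k (F2word (val_ l)^-1%g) = p by apply: lcp_take; rewrite -k1.
have E2 : take k (F2word (val_ m)^-1%g) = take k (F2word (val_ n)) by exact: lcp_take.
have t0 : (0 < len (val_ m))%N by rewrite lt0n len_eq0 letters_neq1.
have [nl|nl] : n = l \/ n = linv l.
  have : l.1 = n.1 by case: l.1 m.1 n.1 lm mn => [] [] [].
  case: l n {lm mn ml nm h1 h2 h2' e k1 k2 k tk p E1 E2} => [i e] [j f] /= ->.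
  by case: e f => [] []; [left|right|right|left].
- have ks : (2 * k <= size (F2word (val_ l)))%N by have [] := gr_diff lm; rewrite k1.
  have [E1' E2'] : drop (len (val_ l) - k) (F2word (val_ l)) = invw p
      /\ drop k (F2word (val_ m)) = invw (take k (F2word (val_ l))).
    split; first by rewrite -E1 F2wordV take_invw ?invwK //; rewrite /len; lia.
    have szm : size (F2word (val_ m)) = (k + k)%N by rewrite -/(len _) -k2 mul2n addnn.
    by rewrite -nl -E2 F2wordV take_invw ?invwK szm ?addKn ?leq_addr.
  set q := take k (F2word (val_ l)) in E2'.
  set r := take (len (val_ l) - 2 * k) (drop k (F2word (val_ l))).
  have uE : val_ l = (F2_of q * F2_of r * (F2_of p)^-1)%g.
    rewrite -F2_of_inv -E1' -!F2_of_cat -[LHS]F2_of_word; congr F2_of.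
    rewrite -catA -[LHS](cat_take_drop k); congr (_ ++ _).
    rewrite -[LHS](cat_take_drop (len (val_ l) - 2 * k)); congr (_ ++ _).
    by rewrite drop_drop; congr drop; rewrite /len; lia.
  have tE : val_ m = (F2_of p * (F2_of q)^-1)%g.
    by rewrite -F2_of_inv -E2' -F2_of_cat cat_take_drop F2_of_word.
  have [nlm slm] := nielsen_letters lm.
  have := min_xy (nielsen_conj (F2_of q) (nielsen_mul nlm)).
  have ks' : (2 * k <= len (val_ l))%N by [].
  have k0 : (0 < k)%N by lia.
  rewrite -slm; suff [H1 H2] :
    (len (((val_ l * val_ m) ^ F2_of q)%g) <= len (val_ l) - 2 * k)%N /\
    (len ((val_ m ^ F2_of q)%g) <= len (val_ m))%N by lia.
  have lenF s : (len (F2_of s) <= size s)%N by exact: size_reduce.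
  split.
    have -> : ((val_ l * val_ m) ^ F2_of q = F2_of r)%g.
      by rewrite uE tE !conjgE !mulgA !mulgVK mulVg mul1g.
    by apply: leq_trans (lenF _) _; rewrite size_take_min geq_minl.
  rewrite tE conjgE !mulgA mulgVK -tE -k2.
  apply: leq_trans (lenM _ _) _; rewrite lenV.
  by have := leq_trans (lenF q) (tk _ _); have := leq_trans (lenF p) (tk _ _); lia.
(* When [n] is the inverse of [l], the element [val_ m] and its inverse share their first halves,
   against [gro_self_inv]. *)
- have E3 : take k (F2word (val_ m)^-1%g) = take k (F2word (val_ m)).
    by rewrite E2 nl /val_ letter_valV E1.
  have : (k <= gro (val_ m)^-1%g (val_ m))%N.
    by apply: take_lcp E3; rewrite -/(len _) ?lenV -k2; lia.
  have := gro_self_inv (letters_neq1 m).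
  by rewrite -k2 ltn_pmul2l // => lt le; have := leq_ltn_trans le lt; rewrite ltnn.
Qed.

(** By [gr_lt] the cancellations with its two neighbours never consume a whole factor, so every
    letter of [s] leaves at least one letter in the product. *)
Lemma len_word_val s : reduced s -> (size s <= len (word_val x y s))%N.
Proof.
(* Here [c] is the cancellation between the last two factors; the second claim says that exactly the
   rest of the last factor survives as a tail of the product. *)
suff H s' l : reduced (rcons s' l) -> let c := (if s' is m :: t then gr (last m t) l else 0%N) in
    (size s' + len (val_ l) - c <= len (word_val x y (rcons s' l)))%N /\
    (gro (word_val x y (rcons s' l))^-1%g (val_ l)^-1%g = len (val_ l) - c)%N.
  case/lastP: s => [//|s l] rs; have [le _] := H s l rs.
  rewrite size_rcons; apply: leq_trans le.
  have : (0 < len (val_ l))%N by rewrite lt0n len_eq0 letters_neq1.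
  case: s rs {H} => [|m t] rs; first by lia.
  have : l != linv (last m t).
    by move: rs; rewrite /reduced /= rcons_path => /andP[].
  by move=> /gr_half[]; lia.
elim/last_ind: s' l => [|s' m IH] l rs c.
  rewrite {}/c /= word_val_cons /word_val big_nil mulg1 -/(val_ l); split; first by lia.
  have := len_gro (val_ l)^-1%g (val_ l)^-1%g; rewrite mulVg lenV; have -> : len 1%g = 0%N by [].
  lia.
have {c} -> : c = gr m l.
  by rewrite /c; case: (s') => [|n t] //=; rewrite last_rcons.
have [rs' lm] : reduced (rcons s' m) /\ l != linv m.
  move: rs; rewrite /reduced; case: (s') => [|n t] /=; first by rewrite andbT.
  by rewrite rcons_path last_rcons => /andP[].
have [] := IH m rs'.
set c' := (if _ is _ :: _ then _ else _); set P := word_val x y (rcons s' m) => H1 H2.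
have E : word_val x y (rcons (rcons s' m) l) = (P * val_ l)%g.
  by rewrite -cats1 word_val_cat word_val_cons /word_val big_nil mulg1.
have c'g : (c' + gr m l < len (val_ m))%N.
  rewrite /c'; case: (s') rs' => [|n t] /= rs'.
    have := gr_half lm; have := letters_neq1 m; rewrite -len_eq0; lia.
  by apply: gr_lt => //; move: rs'; rewrite /reduced /= rcons_path => /andP[].
(* The common tail of [P] and [val_ m] is longer than [gr m l], so by the ultrametric inequality
   both cancel equally much against [val_ l]. *)
have G : gro P^-1%g (val_ l) = gr m l.
  have := gro_ultra P^-1%g (val_ m)^-1%g (val_ l).
  have := gro_ultra (val_ m)^-1%g P^-1%g (val_ l).
  rewrite (groC (val_ m)^-1%g P^-1%g) H2 -/(gr m l); lia.
have L1 := len_mul_gro P (val_ l).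
rewrite E; split; first by rewrite size_rcons; lia.
have := len_gro (P * val_ l)^-1%g (val_ l)^-1%g; rewrite invgK mulgK !lenV.
lia.
Qed.

(** The generators [a] and [b] have length one, so [len_word_val] makes each of them the value of a
    single letter; these letters involve both [x] and [y]. *)
Lemma nielsen_minimal_len : len x = 1%N /\ len y = 1%N.
Proof.
have red u : exists2 s, reduced s & u = word_val x y s.
  have [s ->] := gxy u; exists (reduce s); first exact: reduced_reduce.
  by rewrite word_val_reduce.
have letter_of u : len u = 1%N -> exists l, u = val_ l.
  move=> u1; have [s rs uE] := red u; have := len_word_val rs.
  rewrite -uE u1; case: s rs uE => [|l [|//]] rs uE _.
    by move: u1; rewrite uE /word_val big_nil.
  by exists l; rewrite uE word_val_cons /word_val big_nil mulg1.
have [l lE] := letter_of gen_a erefl; have [m mE] := letter_of gen_b erefl.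
have la : len (val_ l) = 1%N by rewrite -lE.
have mb : len (val_ m) = 1%N by rewrite -mE.
have lm : l.1 != m.1.
  apply/eqP => lm; have [ml|] := eqVneq m (linv l).
    by move/(congr1 F2word): mE; rewrite ml /val_ letter_valV -/(val_ l) -lE.
  move=> ml; have E : m = l by case: l m lm ml {lE mE la mb} => [[] []] [[] []].
  by move/(congr1 F2word): mE; rewrite E -lE.
rewrite /val_ in la mb.
by case: l m lm la mb {lE mE} => [[] []] [[] []] //= _; rewrite /letter_val /= ?lenV.
Qed.

End NielsenReduced.

(** A pair of least total length among those reached by Nielsen moves consists of letters, which
    reversal fixes; invariance carries the conjugator back to the given pair. *)
Lemma generating_revs_by_conj x y : generating_pair x y -> revs_by_conj x y.
Proof.
move=> gxy.
have ex : exists n, `[< exists x' y', nielsen x y x' y' /\ n = (len x' + len y')%N >].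
  by exists (len x + len y)%N; apply/asboolP; exists x, y; split=> //; apply: nielsen_refl.
have [n /asboolP[x' [y' [nxy ->]]] nmin] := find_ex_minn ex.
have trans x1 y1 x2 y2 : nielsen x1 y1 x2 y2 -> nielsen x y x1 y1 -> nielsen x y x2 y2.
  move=> H N; elim: H => // *; [exact: nielsen_swap|exact: nielsen_inv|
    exact: nielsen_mul|exact: nielsen_conj].
have [lx ly] : len x' = 1%N /\ len y' = 1%N.
  apply: nielsen_minimal_len; first exact: nielsen_generating nxy gxy.
  move=> x2 y2 n2; apply: nmin; apply/asboolP; exists x2, y2; split=> //.
  exact: trans n2 nxy.
apply: (revs_by_conj_nielsen nxy).
have rev1 u : len u = 1%N -> F2rev u = u.
  by case: u => [[|l [|//]] rs] // _; apply: val_inj.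
by exists 1%g; rewrite F2rev1 !mul1g invg1 !mulg1 !rev1.
Qed.

Lemma primitive_conj_palindromic w :
  primitive w -> exists X h, palindromic X (w ^ h)%g.
Proof.
by move=> [v /generating_revs_by_conj[g [rg rw _]]]; apply: conj_palindromic rg rw.
Qed.

(** ** Axes in the Cayley graph *)

Definition zexp (G : groupType) (x : G) (i : int) : G :=
  match i with Posz n => (x ^+ n)%g | Negz n => (x ^- n.+1)%g end.

Lemma zexpSr (G : groupType) (x : G) (i : int) : zexp x (i + 1) = (zexp x i * x)%g.
Proof.
case: i => [n|[|n]].
- by rewrite (_ : Posz n + 1 = Posz n.+1) /= ?expgSr //; lia.
- by rewrite (_ : Negz 0 + 1 = 0) //= expg1 mulVg.
- rewrite (_ : Negz n.+1 + 1 = Negz n); last by lia.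
  by rewrite /= [(x ^+ n.+2)%g]expgS invgM mulgVK.
Qed.

Lemma zexpS (G : groupType) (x : G) (i : int) : zexp x (i + 1) = (x * zexp x i)%g.
Proof.
have -> : (x * zexp x i = zexp x i * x)%g; last exact: zexpSr.
case: i => n /=; first by rewrite -expgS expgSr.
exact/commuteV/commuteX/commute_refl.
Qed.

Definition cyc_reduced (u : F2) := u != 1%g /\ reduced (F2word u ++ F2word u).

(** A word whose outer letters cancel changes length under conjugation by any letter; this is how
    equality of lengths detects cyclic reducedness. *)
Lemma last_letter_conj (l m n : letter) (v : seq letter) (w := F2_of (m :: rcons v n)) :
  reduced (m :: rcons v n) -> m = linv n ->
  (l = m -> (len (w ^ F2_of [:: l])%g < len w)%N) /\
  (l != m -> len (w ^ F2_of [:: l])%g = (len w).+2).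
Proof.
move=> rs mn.
have lw : len w = (size v).+2 by rewrite /len /w F2word_of //= size_rcons.
have E : (w ^ F2_of [:: l])%g = F2_of (linv l :: (m :: rcons v n) ++ [:: l]).
  rewrite conjgE /w (F2_of_cat [:: linv l] ((m :: rcons v n) ++ [:: l])).
  by rewrite (F2_of_cat (m :: rcons v n)) (F2_of_inv [:: l]).
have nm : n = linv m by rewrite mn linvK.
split=> [lm|/negPf lm].
  have -> : (w ^ F2_of [:: l])%g = F2_of v.
    rewrite {}E lm nm -cats1 /=.
    have H k : F2_of [:: k; linv k] = 1%g.
      by rewrite (F2_of_cat [:: k] [:: linv k]) (F2_of_inv [:: k]) mulgV.
    have -> : [:: linv m, m & (v ++ [:: linv m]) ++ [:: m]]
        = [:: linv m; linv (linv m)] ++ v ++ [:: linv m; linv (linv m)].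
      by rewrite linvK -catA.
    by rewrite !F2_of_cat H mul1g mulg1.
  by rewrite lw; apply: leq_trans (leqnSn _); rewrite ltnS; apply: size_reduce.
rewrite E /len F2word_of; last first.
  rewrite /reduced cats1 /= linvK eq_sym lm /= rcons_path.
  by rewrite [path _ _ _]rs last_rcons -mn lm.
by rewrite -/(len w) lw /= size_cat size_rcons addn1.
Qed.

Lemma not_cyc_reduced (w : F2) : w != 1%g -> ~ cyc_reduced w ->
  exists m n v, F2word w = m :: rcons v n /\ m = linv n.
Proof.
move=> w1 nc.
case: w w1 nc => [[|m s] rs] w1 nc; first by case/eqP: w1; apply: val_inj.
case/lastP: s rs w1 nc => [|v n] rs w1 nc.
  by case: nc; split=> //; rewrite /reduced /= linv_neq.
exists m, n, v; split=> //; apply/eqP/negP => /negP mn; apply: nc; split=> //.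
rewrite -[reduced _]/(reduced ((m :: rcons v n) ++ m :: rcons v n)).
rewrite /reduced sorted_cat_cons; apply/andP; split; last exact: rs.
by rewrite /= rcons_path [path _ _ _]rs last_rcons.
Qed.

Lemma cyc_reduced_conj_letter (l : letter) (w : F2) : w != 1%g ->
  len (w ^ F2_of [:: l])%g = len w -> cyc_reduced w.
Proof.
move=> w1 lw; apply: contrapT => /(not_cyc_reduced w1)[m [n [v [wE mn]]]].
have rs := F2word_reduced w; rewrite wE in rs.
have [] := last_letter_conj l rs mn; rewrite -wE F2_of_word lw.
by case: eqP => [lm|_]; [move=> /(_ lm)|move=> _ /(_ isT)]; lia.
Qed.

(* A palindrome [w] has the same length as its reversal, hence as its conjugate
   by a letter. *)
Lemma palindromic_cyc_reduced X w : w != 1%g -> palindromic X w -> cyc_reduced w.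
Proof.
move=> w1 /palindromicP rw; case: X rw => /= rw.
- apply: (@cyc_reduced_conj_letter (false, false)) => //.
  by rewrite (_ : F2_of _ = gen_a) -?rw ?len_rev //; apply: val_inj.
- apply: contrapT => /(not_cyc_reduced w1)[m [n [v [wE mn]]]].
  move/(congr1 F2word): rw; rewrite F2word_rev wE rev_cons rev_rcons /=.
  by case=> nm _; move/eqP: mn; rewrite nm linv_neq.
- apply: (@cyc_reduced_conj_letter (true, true)) => //.
  by rewrite (_ : F2_of _ = gen_b^-1%g) -?rw ?len_rev //; apply: val_inj.
Qed.

Lemma conj_cyc_reduced w : w != 1%g -> exists u h, cyc_reduced u /\ w = (u ^ h)%g.
Proof.
have [n] := ubnP (len w); elim: n w => // n IH w wn w1.
have [cw|nc] := pselect (cyc_reduced w); first by exists w, 1%g; rewrite conjg1.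
have [m [k [v [wE mk]]]] := not_cyc_reduced w1 nc.
have rs := F2word_reduced w; rewrite wE in rs.
have [/(_ erefl)] := last_letter_conj m rs mk; rewrite -wE F2_of_word => lt _.
have [|u [h [cu uE]]] := IH (w ^ F2_of [:: m])%g (leq_trans lt wn).
  by rewrite conjg_eq1.
by exists u, (h * (F2_of [:: m])^-1)%g; rewrite conjgM -uE conjgK.
Qed.

(** The axis reads the periodic biinfinite word obtained by repeating [u]. Cyclic reducedness makes
    all its finite subwords reduced, hence the path geodesic. *)
Lemma cyc_reduced_axis u : cyc_reduced u -> exists p : int -> F2, exists m : nat,
  [/\ (0 < m)%N, cayley_axis u p, (forall i, p (i + m%:Z) = (u * p i)%g) & p 0 = 1%g].
Proof.
move=> [u1 ru]; pose s := F2word u; pose m := size s; pose x0 : letter := (false, false).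
have m0 : (0 < m)%N by rewrite lt0n -/(len u) len_eq0.
(* Position [i] splits into a full period count, giving a power of [u], and the remainder [r i],
   giving a prefix of [u]. *)
pose r (i : int) := `|(i %% m)%Z|%N.
have rlt i : (r i < m)%N by have := ltz_pmod i (m0 : 0 < m%:Z); have := modz_ge0 i (lt0r_neq0 (m0 : 0 < m%:Z)); rewrite /r; lia.
pose p i := (zexp u (i %/ m)%Z * F2_of (take (r i) s))%g.
pose L i := nth x0 s (r i).
have stepr i : (r (i + 1)%R = (r i).+1 /\ ((i + 1) %/ m)%Z = (i %/ m)%Z /\ ((r i).+1 < m)%N) \/
    (r (i + 1)%R = 0%N /\ ((i + 1) %/ m)%Z = (i %/ m)%Z + 1 /\ (r i).+1 = m).
  have dE := divz_eq i m; have rp := modz_ge0 i (lt0r_neq0 (m0 : 0 < m%:Z)).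
  have rE : (i %% m)%Z = r i by rewrite /r gez0_abs.
  have [lt|ge] := ltnP (r i).+1 m.
    left; have E : i + 1 = (i %/ m)%Z * m + (r i).+1 by rewrite {1}dE rE; lia.
    have sm : 0 <= Posz (r i).+1 < m%:Z by lia.
    split; first by rewrite {1}/r E modzMDl modz_small.
    by split=> //; rewrite E divzMDl ?lt0r_neq0 // (@divz_small _ m%:Z sm) addr0.
  have {ge} im : (r i).+1 = m by have := rlt i; lia.
  right; have E : i + 1 = ((i %/ m)%Z + 1) * m by rewrite {1}dE rE mulrDl mul1r -addrA; congr (_ + _); lia.
  split; first by rewrite {1}/r E modzMl.
  by split=> //; rewrite E mulzK ?lt0r_neq0.
have pS i : p (i + 1) = (p i * F2_of [:: L i])%g.
  have -> : (p i * F2_of [:: L i] = zexp u (i %/ m)%Z * F2_of (take (r i).+1 s))%g.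
    by rewrite (take_nth x0) // -cats1 F2_of_cat mulgA.
  case: (stepr i) => [[r1 [d1 _]]|[r1 [d1 im]]]; rewrite /p r1 d1 //.
  rewrite im take0 F2_of_nil mulg1 zexpSr take_oversize // F2_of_word.
  by [].
have pm i : p (i + m%:Z) = (u * p i)%g.
  rewrite /p /r divzDr ?dvdzz // divzz modzDr (lt0r_neq0 (m0 : 0 < m%:Z)) zexpS.
  by rewrite mulgA.
have rL i : L (i + 1) != linv (L i).
  have nthss j : (j < m)%N -> nth x0 (s ++ s) j = nth x0 s j.
    by move=> jm; rewrite nth_cat -/m jm.
  have /(sortedP x0) /(_ (r i)) := ru; rewrite size_cat -/s -/m (nthss (r i)) // => H.
  case: (stepr i) => [[r1 [_ lt]]|[r1 [_ im]]]; rewrite /L r1.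
    by move: H; rewrite nthss //; apply; lia.
  by move: H; rewrite nth_cat -/m im ltnn subnn; apply; lia.
have pn i n : p (i + n%:Z) = (p i * F2_of (mkseq (fun k => L (i + k%:Z)) n))%g.
  elim: n => [|n IH]; first by rewrite addr0 F2_of_nil mulg1.
  rewrite (_ : i + n.+1%:Z = i + n%:Z + 1); last by lia.
  by rewrite pS IH -mulgA mkseqS -cats1 F2_of_cat.
have dn i n : word_dist (p i) (p (i + n%:Z)) = n.
  rewrite /word_dist pn mulKg F2word_of ?size_mkseq //.
  apply/(sortedP x0) => k; rewrite size_mkseq => kn.
  rewrite !nth_mkseq //; last by lia.
  by rewrite (_ : i + k.+1%:Z = i + k%:Z + 1) ?rL //; lia.
have dC v w : word_dist v w = word_dist w v.
  by rewrite /word_dist -/(len _) -lenV invgM invgK.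
exists p, m; split=> //; last by rewrite /p div0z /r mod0z take0 F2_of_nil mulg1.
split=> [i j|].
  have [ij|/ltW ij] := lerP i j.
    by rewrite (_ : j = i + `|i - j|%N) ?dn; lia.
  by rewrite dC (_ : i = j + `|i - j|%N) ?dn; lia.
apply/seteqP; split=> [_ [_ [i _ <-] <-]|_ [i _ <-]].
  by exists (i + m%:Z) => //; rewrite pm.
by exists (p (i - m%:Z)); [exists (i - m%:Z)|rewrite -pm subrK].
Qed.

Lemma cayley_axis_exists w : w != 1%g -> exists p : int -> F2, exists m : nat,
  [/\ (0 < m)%N, cayley_axis w p & forall i, p (i + m%:Z) = (w * p i)%g].
Proof.
move=> /conj_cyc_reduced[u [h [/cyc_reduced_axis[p [m [m0 [dp rp] pm _]]] ->]]].
exists (fun i => h^-1 * p i)%g, m; split=> //; last first.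
  by move=> i; rewrite pm conjgE !mulgA mulgK.
split=> [i j|]; first by rewrite -dp /word_dist invgM invgK !mulgA mulgK.
apply/seteqP; split=> [_ [_ [i _ <-] <-]|_ [i _ <-]].
  by exists (i + m%:Z) => //; rewrite pm conjgE !mulgA mulgK.
exists (h^-1 * p (i - m%:Z))%g; first by exists (i - m%:Z).
by rewrite conjgE -{2}(subrK m%:Z i) pm !mulgA mulgK.
Qed.

Lemma palindromic_axis X w : w != 1%g -> palindromic X w ->
  exists p : int -> F2, exists m : nat,
  [/\ (0 < m)%N, cayley_axis w p, (forall i, p (i + m%:Z) = (w * p i)%g) & p 0 = 1%g].
Proof. by move=> w1 /(palindromic_cyc_reduced w1)/cyc_reduced_axis. Qed.

(** * Hyperbolic space *)

(* [cosh], [sinh], and below [lor] and [dH] (for [lorentz] and [hdist]), [line],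
   [foot] and [dline], are hidden behind opaque proofs: comparing two instances
   of their bodies by conversion is very slow. *)
Fact cosh_subproof (R : realType) :
  {f : R -> R | forall t, f t = (expR t + expR (- t)) / 2}.
Proof. by exists (fun t => (expR t + expR (- t)) / 2). Qed.

Fact sinh_subproof (R : realType) :
  {f : R -> R | forall t, f t = (expR t - expR (- t)) / 2}.
Proof. by exists (fun t => (expR t - expR (- t)) / 2). Qed.

(** * Hyperbolic functions *)

Section HyperbolicFunctions.
Variable R : realType.
Implicit Types s t x : R.

Definition cosh : R -> R := sval (cosh_subproof R).
Definition sinh : R -> R := sval (sinh_subproof R).

Lemma coshE t : cosh t = (expR t + expR (- t)) / 2.
Proof. exact: svalP (cosh_subproof R) t. Qed.

Lemma sinhE t : sinh t = (expR t - expR (- t)) / 2.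
Proof. exact: svalP (sinh_subproof R) t. Qed.

Lemma coshN t : cosh (- t) = cosh t.
Proof. by rewrite !coshE opprK addrC. Qed.

Lemma sinhN t : sinh (- t) = - sinh t.
Proof. by rewrite !sinhE opprK; lra. Qed.

Lemma cosh0 : cosh 0 = 1.
Proof. by rewrite !coshE oppr0 expR0; lra. Qed.

Lemma sinh0 : sinh 0 = 0.
Proof. by rewrite !sinhE oppr0 expR0; lra. Qed.

Lemma expR_cosh t : expR t = cosh t + sinh t.
Proof. by rewrite !coshE !sinhE; lra. Qed.

Lemma expRN_cosh t : expR (- t) = cosh t - sinh t.
Proof. by rewrite !coshE !sinhE; lra. Qed.

Lemma cosh2 t : cosh t ^+ 2 = 1 + sinh t ^+ 2.
Proof.
have := expRxMexpNx_1 t; rewrite !coshE !sinhE => E.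
by rewrite !expr2; nra.
Qed.

Lemma coshD s t : cosh (s + t) = cosh s * cosh t + sinh s * sinh t.
Proof. by rewrite !coshE !sinhE opprD !expRD; field. Qed.

Lemma sinhD s t : sinh (s + t) = sinh s * cosh t + cosh s * sinh t.
Proof. by rewrite !coshE !sinhE opprD !expRD; field. Qed.

Lemma coshB s t : cosh (s - t) = cosh s * cosh t - sinh s * sinh t.
Proof. by rewrite coshD coshN sinhN mulrN. Qed.

Lemma cosh_ge1 t : 1 <= cosh t.
Proof.
have := cosh2 t; have : 0 < cosh t by rewrite coshE divr_gt0 // addr_gt0 // expR_gt0.
by have := sqr_ge0 (sinh t); nra.
Qed.

Lemma cosh_gt0 t : 0 < cosh t.
Proof. exact: lt_le_trans (cosh_ge1 t). Qed.

Lemma sinh_ge0 t : 0 <= t -> 0 <= sinh t.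
Proof. by move=> t0; rewrite sinhE divr_ge0 // subr_ge0 ler_expR; lra. Qed.

Lemma sinh_gt0 t : 0 < t -> 0 < sinh t.
Proof. by move=> t0; rewrite sinhE divr_gt0 // subr_gt0 ltr_expR; lra. Qed.

Lemma sinh_eq0 t : sinh t = 0 -> t = 0.
Proof.
move=> s0; case: (ltgtP t 0) => // t0; last by have := sinh_gt0 t0; rewrite s0 ltxx.
by have := @sinh_gt0 (- t); rewrite sinhN s0 oppr0 ltxx oppr_gt0 t0 => /(_ isT).
Qed.

Lemma cosh_norm t : cosh `|t| = cosh t.
Proof. by case: (ger0P t) => // _; rewrite coshN. Qed.

Lemma ler_cosh s t : 0 <= s -> 0 <= t -> (cosh s <= cosh t) = (s <= t).
Proof.
have H a b : 0 <= a -> a < b -> cosh a < cosh b.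
  move=> a0 ab; have -> : b = a + (b - a) by lra.
  have ba : 0 < b - a by lra.
  have C1 : 1 < cosh (b - a).
    by have := cosh2 (b - a); have := sinh_gt0 ba; have := cosh_ge1 (b - a); nra.
  rewrite coshD; apply: ltr_wpDr; first by rewrite mulr_ge0 // sinh_ge0 // ltW.
  by rewrite ltr_pMr // cosh_gt0.
move=> s0 t0; case: (leP s t) => [|st]; last by apply/negbTE; rewrite -ltNge H.
by rewrite le_eqVlt => /orP[/eqP->|/(H _ _ s0)/ltW->//]; rewrite lexx.
Qed.

Lemma cosh_inj s t : 0 <= s -> 0 <= t -> cosh s = cosh t -> s = t.
Proof.
move=> s0 t0 st; apply/eqP; rewrite eq_le.
by rewrite -(ler_cosh s0 t0) -(ler_cosh t0 s0) st lexx.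
Qed.

Lemma arcoshK x : 1 <= x -> cosh (arcosh x) = x.
Proof.
move=> x1; have x2 : 0 <= x ^+ 2 - 1.
  by rewrite (_ : _ - 1 = (x - 1) * (x + 1)) ?mulr_ge0 //; [lra|lra|ring].
set s := Num.sqrt (x ^+ 2 - 1).
have s0 : 0 <= s by exact: sqrtr_ge0.
have ss : s * s = x ^+ 2 - 1 by rewrite -expr2 sqr_sqrtr.
have xs : 0 < x + s by lra.
rewrite !coshE expRN /arcosh -/s lnK ?posrE //.
have -> : (x + s)^-1 = x - s; last by lra.
apply: (mulfI (lt0r_neq0 xs)); rewrite divff ?lt0r_neq0 //.
by rewrite mulrBr !mulrDl ss expr2; ring.
Qed.

Lemma arcosh_ge0 x : 1 <= x -> 0 <= arcosh x.
Proof. by move=> x1; rewrite ln_ge0 //; have := sqrtr_ge0 (x ^+ 2 - 1); lra. Qed.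

Lemma is_derive0_cosh_sinh (a b : R) :
  is_derive (0 : R) 1 (fun s => cosh s * a + sinh s * b) b.
Proof.
have -> : (fun s => cosh s * a + sinh s * b) =
    (((a + b) / 2) \*: expR + ((a - b) / 2) \*: (expR \o -%R)).
  by apply/funext => s; rewrite !coshE !sinhE fctE /= /GRing.scale /=; field.
apply: is_derive_eq.
by rewrite oppr0 expR0 /GRing.scale /=; field.
Qed.

Lemma expR_half_ln (a b : R) : 0 < a -> 0 < b ->
  expR (ln (a / b) / 2) = a / Num.sqrt (a * b).
Proof.
move=> a0 b0; have ab0 : 0 < a * b by rewrite mulr_gt0.
have s0 : 0 < Num.sqrt (a * b) by rewrite sqrtr_gt0.
apply/eqP; rewrite -(@eqrXn2 _ 2) ?expR_ge0 ?divr_ge0 ?(ltW a0) ?(ltW s0) //.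
rewrite -expRM_natl mulrC divfK // lnK ?posrE ?divr_gt0 //.
rewrite expr_div_n sqr_sqrtr ?ltW //; apply/eqP; field.
by rewrite !lt0r_neq0.
Qed.

(** The parameter [t] is artanh (b / a) written as a logarithm, and the radius is the square root of
    a^2 - b^2. *)
Lemma hyperbolic_polar (a b : R) (t := ln ((a + b) / (a - b)) / 2) :
  1 <= a -> 1 <= a ^+ 2 - b ^+ 2 -> exists C, a = C * cosh t /\ b = C * sinh t.
Proof.
move=> a1 C1; exists (Num.sqrt (a ^+ 2 - b ^+ 2)); set C := Num.sqrt _.
have pp : 0 < a + b by move: a1 C1; clear; rewrite !expr2 => ? ?; nra.
have mm : 0 < a - b by move: a1 C1; clear; rewrite !expr2 => ? ?; nra.
have CE : C = Num.sqrt ((a + b) * (a - b)) by congr Num.sqrt; rewrite !expr2; ring.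
have C0 : 0 < C by rewrite sqrtr_gt0; apply: lt_le_trans C1.
have CC : C * C = (a + b) * (a - b) by rewrite -expr2 CE sqr_sqrtr // mulr_ge0 // ltW.
have et : expR t = (a + b) / C by rewrite CE expR_half_ln.
have eNt : expR (- t) = (a - b) / C.
  by rewrite expRN et invf_div; apply: (mulfI (lt0r_neq0 pp));
    rewrite mulrCA divff ?lt0r_neq0 // mulrA -CC mulfK ?lt0r_neq0 ?mulr1.
by rewrite !coshE !sinhE et eNt; split; field; rewrite lt0r_neq0.
Qed.

Lemma cosh_ge_half (t : R) : 0 <= t -> t / 2 <= cosh t.
Proof.
by move=> t0; have := expR_ge1Dx t; have := expR_ge0 (- t); rewrite !coshE; clear; lra.
Qed.

End HyperbolicFunctions.

Fact lor_subproof (R : realType) (d : nat) :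
  {f : 'rV[R]_d.+1 -> 'rV[R]_d.+1 -> R | forall x y, f x y = lorentz x y}.
Proof. by eexists. Qed.

Definition lor (R : realType) (d : nat) := sval (lor_subproof R d).

(** * The Lorentz form and its positivity on orthogonal complements *)

Section Lorentz.
Variables (R : realType) (d : nat).
Local Notation V := 'rV[R]_d.+1.
Local Notation "<< x , y >>" := (lor x y) (at level 0).
Implicit Types x y z u v : V.

Let dot x y : R := \sum_(i < d) x ord0 (lift ord0 i) * y ord0 (lift ord0 i).

Lemma lorE x y : <<x, y>> = lorentz x y.
Proof. exact: (svalP (lor_subproof R d)). Qed.

Lemma lorC x y : <<x, y>> = <<y, x>>.
Proof.
rewrite !lorE /lorentz mulrC; congr (_ + _); apply: eq_bigr => i _; exact: mulrC.
Qed.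

Lemma lorDl x y z : <<x + y, z>> = <<x, z>> + <<y, z>>.
Proof.
rewrite !lorE /lorentz !mxE mulrDl opprD -!addrA; congr (_ + _).
rewrite addrCA; congr (_ + _); rewrite -big_split /=.
by apply: eq_bigr => i _; rewrite !mxE mulrDl.
Qed.

Lemma lorZl a x z : <<a *: x, z>> = a * <<x, z>>.
Proof.
rewrite !lorE /lorentz !mxE mulrDr mulrN mulrA; congr (_ + _).
by rewrite mulr_sumr; apply: eq_bigr => i _; rewrite !mxE mulrA.
Qed.

Lemma lorDr x y z : <<z, x + y>> = <<z, x>> + <<z, y>>.
Proof. by rewrite lorC lorDl !(lorC z). Qed.

Lemma lorZr a x z : <<z, a *: x>> = a * <<z, x>>.
Proof. by rewrite lorC lorZl (lorC z). Qed.

Lemma lorNl x z : <<- x, z>> = - <<x, z>>.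
Proof. by rewrite -scaleN1r lorZl mulN1r. Qed.

Lemma lorNr x z : <<z, - x>> = - <<z, x>>.
Proof. by rewrite lorC lorNl lorC. Qed.

Lemma lor0l z : <<0, z>> = 0.
Proof. by rewrite -(scale0r 0) lorZl mul0r. Qed.

Definition lor_lin := (lorDl, lorDr, lorZl, lorZr, lorNl, lorNr).

Let dot_sqr_ge0 x : 0 <= dot x x.
Proof. by apply: sumr_ge0 => i _; rewrite -expr2 sqr_ge0. Qed.

Let dot_eq0 x : dot x x = 0 -> forall i : 'I_d, x ord0 (lift ord0 i) = 0.
Proof.
move=> /eqP; rewrite psumr_eq0; last by move=> i _; rewrite -expr2 sqr_ge0.
by move=> /allP H i; have := H i (mem_index_enum i); rewrite mulf_eq0 orbb => /eqP.
Qed.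

Let dot_CS x y : dot x y ^+ 2 <= dot x x * dot y y.
Proof.
have [x0|xn0] := eqVneq (dot x x) 0.
  have -> : dot x y = 0 by rewrite /dot big1 // => i _; rewrite dot_eq0 // mul0r.
  by rewrite expr0n x0 mul0r.
have xx : 0 < dot x x by rewrite lt_neqAle eq_sym xn0 dot_sqr_ge0.
have := dot_sqr_ge0 (dot x x *: y - dot x y *: x).
have E a b : dot (a *: y - b *: x) (a *: y - b *: x) =
    a ^+ 2 * dot y y - 2 * a * b * dot x y + b ^+ 2 * dot x x.
  rewrite /dot !mulr_sumr -sumrB -big_split /=.
  by apply: eq_bigr => i _; rewrite !mxE; ring.
rewrite E (_ : _ + _ = dot x x * (dot x x * dot y y - dot x y ^+ 2)); last by ring.
by rewrite pmulr_rge0 // subr_ge0.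
Qed.

Lemma lor_dot x y : <<x, y>> = - (x ord0 ord0 * y ord0 ord0) + dot x y.
Proof. by rewrite lorE. Qed.

Lemma eq0_coord x : x ord0 ord0 = 0 -> (forall i : 'I_d, x ord0 (lift ord0 i) = 0) -> x = 0.
Proof.
move=> x0 xi; apply/rowP => j; rewrite mxE.
by case: (unliftP ord0 j) => [i|] ->.
Qed.

(** Orthogonality to the timelike [p] bounds the time coordinate of [x] by its spatial part, through
    the Cauchy-Schwarz inequality for spatial parts. *)
Lemma lor_orth_ge0 p x : <<p, p>> = - 1 -> <<p, x>> = 0 -> 0 <= <<x, x>>.
Proof.
rewrite !lor_dot => pp px.
have := dot_CS p x; have := dot_sqr_ge0 p; have := dot_sqr_ge0 x.
set X := dot x x; set P := dot p p in pp *; set D := dot p x in px *.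
move: (x ord0 ord0) (p ord0 ord0) pp px => a b pp px X0 P0 CS.
have E1 : b * b = 1 + P by lra.
have E2 : D = b * a by lra.
by rewrite E2 exprMn !expr2 E1 in CS; nra.
Qed.

Lemma lor_orth_eq0 p x : <<p, p>> = - 1 -> <<p, x>> = 0 -> <<x, x>> = 0 -> x = 0.
Proof.
rewrite !lor_dot => pp px xx.
have := dot_CS p x; have := dot_sqr_ge0 p; have := dot_sqr_ge0 x.
have := @dot_eq0 x; move: pp px xx.
set X := dot x x; set P := dot p p; set D := dot p x.
move=> pp px xx X0 Xge P0 CS.
have E1 : p ord0 ord0 * p ord0 ord0 = 1 + P by lra.
have E2 : D = p ord0 ord0 * x ord0 ord0 by lra.
rewrite E2 exprMn !expr2 E1 in CS.
have Xle : X = 0 by nra.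
apply: eq0_coord; last exact: X0.
by apply/eqP; rewrite -sqrf_eq0 expr2; apply/eqP; lra.
Qed.

Lemma lor_CS p u v : <<p, p>> = - 1 -> <<p, u>> = 0 -> <<p, v>> = 0 ->
  <<u, v>> ^+ 2 <= <<u, u>> * <<v, v>>.
Proof.
move=> pp pu pv; have [v0|vn0] := eqVneq <<v, v>> 0.
  by rewrite (lor_orth_eq0 pp pv v0) lorC !lor0l expr0n mulr0.
have vv : 0 < <<v, v>> by rewrite lt_neqAle eq_sym vn0 (lor_orth_ge0 pp pv).
set w := <<v, v>> *: u - <<u, v>> *: v.
have pw : <<p, w>> = 0 by rewrite /w !lor_lin pu pv; ring.
have := lor_orth_ge0 pp pw.
have -> : <<w, w>> = <<v, v>> * (<<u, u>> * <<v, v>> - <<u, v>> ^+ 2).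
  by rewrite /w !lor_lin (lorC v u); ring.
by rewrite pmulr_rge0 // subr_ge0.
Qed.

End Lorentz.

Ltac lor_atoms :=
  repeat match goal with |- context [@lor ?R ?d ?x ?y] =>
    let a := fresh "a" in move: (@lor R d x y) => a end.

Fact dH_subproof (R : realType) (d : nat) :
  {f : hyp R d -> hyp R d -> R | forall x y, f x y = hdist x y}.
Proof. by eexists. Qed.

Definition dH (R : realType) (d : nat) := sval (dH_subproof R d).

(** * The hyperbolic distance is a metric *)

Section Distance.
Variables (R : realType) (d : nat).
Local Notation "<< x , y >>" := (lor x y) (at level 0).
Implicit Types (x y z p q : hyp R d) (u v w : 'rV[R]_d.+1).

Lemma hyp_norm x : <<val x, val x>> = - 1.
Proof. by rewrite lorE; case: x => x /= /andP[/eqP]. Qed.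

Lemma hyp_coord0_gt0 x : 0 < val x ord0 ord0.
Proof. by case: x => x /= /andP[]. Qed.

(** Reversed Cauchy-Schwarz inequality: the component of [w] orthogonal to [x] has nonnegative
    square. *)
Lemma lor_hyp_sqr_ge1 x w : <<w, w>> = - 1 -> 1 <= <<val x, w>> ^+ 2.
Proof.
move=> ww; have xx := hyp_norm x.
have := @lor_orth_ge0 _ _ (val x) (w + <<val x, w>> *: val x) xx.
rewrite !lor_lin xx (lorC w) ww mulrN1 subrr => /(_ erefl).
by rewrite expr2; lra.
Qed.

(* If [<<x, y>>] were nonnegative, a combination of [x] and [y] with vanishing
   time coordinate would be timelike. *)
Lemma lor_hyp x y : 1 <= - <<val x, val y>>.
Proof.
have H := lor_hyp_sqr_ge1 x (hyp_norm y).
suff : <<val x, val y>> < 0 by rewrite expr2 in H; nra.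
rewrite ltNge; apply/negP => xy0.
have x0 := hyp_coord0_gt0 x; have y0 := hyp_coord0_gt0 y.
set a := val x ord0 ord0 in x0; set b := val y ord0 ord0 in y0.
pose w := b *: val x - a *: val y.
have w0 : w ord0 ord0 = 0 by rewrite /w !mxE -/a -/b; ring.
have : 0 <= <<w, w>>.
  rewrite lorE /lorentz w0 mul0r oppr0 add0r.
  by apply: sumr_ge0 => i _; rewrite -expr2 sqr_ge0.
rewrite /w !lor_lin !hyp_norm (lorC (val y)); move: xy0 => /=.
by set c := <<_, _>> => xy0; have := mulr_gt0 x0 y0; nra.
Qed.

Lemma lor_hyp_eq x y : <<val x, val y>> = - 1 -> x = y.
Proof.
move=> xy; apply: val_inj; apply/eqP; rewrite -subr_eq0; apply/eqP.
apply: (@lor_orth_eq0 _ _ (val x) _ (hyp_norm x)).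
  by rewrite !lor_lin hyp_norm xy; ring.
by rewrite !lor_lin !hyp_norm (lorC (val y)) xy; ring.
Qed.

Definition hyp_of p w : hyp R d := insubd p w.

(** A unit timelike [w] on the past sheet would put [- w] on the future sheet with the wrong sign of
    its product with [p]. The point [p] serves both as default value and as witness of the sheet. *)
Lemma val_hyp_of p w : <<w, w>> = - 1 -> <<val p, w>> < 0 -> val (hyp_of p w) = w.
Proof.
move=> ww pw; apply: insubdK; rewrite unfold_in -lorE ww eqxx /=.
rewrite ltNge; apply/negP => w0.
have w1 : <<- w, - w>> = - 1 by rewrite !lor_lin ww; ring.
have w00 : w ord0 ord0 != 0.
  apply/eqP => E; move: ww; rewrite lorE /lorentz E mul0r oppr0 add0r => S.
  have : 0 <= - 1 :> R.
    by rewrite -S; apply: sumr_ge0 => i _; rewrite -expr2 sqr_ge0.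
  by lra.
have Pw : (lorentz (- w) (- w) == - 1) && (0 < (- w) ord0 ord0).
  by rewrite -lorE w1 eqxx mxE oppr_gt0 lt_neqAle w00 w0.
have := lor_hyp p (exist _ (- w) Pw).
by rewrite /= !lor_lin; lra.
Qed.

Lemma dHE x y : dH x y = hdist x y.
Proof. exact: (svalP (dH_subproof R d)). Qed.

Lemma cosh_dH x y : cosh (dH x y) = - <<val x, val y>>.
Proof. by rewrite dHE /hdist -lorE arcoshK // lor_hyp. Qed.

Lemma dH_ge0 x y : 0 <= dH x y.
Proof. by rewrite dHE /hdist -lorE arcosh_ge0 // lor_hyp. Qed.

Lemma dHC x y : dH x y = dH y x.
Proof. by rewrite !dHE /hdist -!lorE lorC. Qed.

Lemma dHxx x : dH x x = 0.
Proof. by apply: cosh_inj; rewrite ?dH_ge0 // cosh_dH hyp_norm opprK cosh0. Qed.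

Lemma dH_eq0 x y : dH x y = 0 -> x = y.
Proof.
by move=> xy; apply: lor_hyp_eq; have := cosh_dH x y; rewrite xy cosh0; lra.
Qed.

(** The components of [x] and [z] orthogonal to [y] have lengths sinh of the two distances;
    Cauchy-Schwarz for them is the inequality read off from the hyperbolic law of cosines. *)
Lemma dH_triangle y x z : dH x z <= dH x y + dH y z.
Proof.
rewrite -ler_cosh ?addr_ge0 ?dH_ge0 // coshD.
have hxy := cosh_dH x y; have hyz := cosh_dH y z.
have sx := cosh2 (dH x y); have sz := cosh2 (dH y z).
have px := sinh_ge0 (dH_ge0 x y); have pz := sinh_ge0 (dH_ge0 y z).
rewrite hxy in sx; rewrite hyz in sz; rewrite cosh_dH hxy hyz.
have yy := hyp_norm y.
pose u := val x + <<val x, val y>> *: val y.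
pose v := val z + <<val y, val z>> *: val y.
have yu : <<val y, u>> = 0 by rewrite /u !lor_lin yy (lorC (val x)); ring.
have yv : <<val y, v>> = 0 by rewrite /v !lor_lin yy; ring.
have := lor_CS yy yu yv.
have -> : <<u, u>> = sinh (dH x y) ^+ 2.
  rewrite /u !lor_lin yy hyp_norm (lorC (val y) (val x)).
  by move: sx; lor_atoms; rewrite !expr2; clear; lra.
have -> : <<v, v>> = sinh (dH y z) ^+ 2.
  rewrite /v !lor_lin yy hyp_norm (lorC (val z) (val y)).
  by move: sz; lor_atoms; rewrite !expr2; clear; lra.
have -> : <<u, v>> = <<val x, val z>> + <<val x, val y>> * <<val y, val z>>.
  by rewrite /u /v !lor_lin yy; ring.
rewrite -exprMn => H.
have : `|<<val x, val z>> + <<val x, val y>> * <<val y, val z>>| <=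
    `|sinh (dH x y) * sinh (dH y z)| by rewrite -ler_sqr ?nnegrE // !real_normK ?num_real.
rewrite (ger0_norm (mulr_ge0 px pz)) ler_norml => /andP[]; move: (sinh _ * _); lor_atoms; clear; move=> *; lra.
Qed.

End Distance.

(** * Geodesic lines given by a point and a unit tangent *)

Section Lines.
Variables (R : realType) (d : nat).
Local Notation "<< x , y >>" := (lor x y) (at level 0).
Implicit Types (x y z p q : hyp R d) (u v w : 'rV[R]_d.+1).

Definition frame p v : Prop := <<val p, v>> = 0 /\ <<v, v>> = 1.

Fact line_subproof : {f : hyp R d -> 'rV[R]_d.+1 -> R -> hyp R d |
  forall p v t, f p v t = hyp_of p (cosh t *: val p + sinh t *: v)}.
Proof. by eexists. Qed.

Definition line := sval line_subproof.

Lemma lineE p v t : line p v t = hyp_of p (cosh t *: val p + sinh t *: v).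
Proof. exact: (svalP line_subproof). Qed.

Lemma val_line p v t : frame p v -> val (line p v t) = cosh t *: val p + sinh t *: v.
Proof.
move=> [pv vv]; rewrite lineE; apply: val_hyp_of; rewrite !lor_lin pv ?(lorC v) ?pv ?vv !hyp_norm.
  by have := cosh2 t; rewrite expr2; clear; nra.
by have := cosh_gt0 t; clear; lra.
Qed.

Lemma line0 p v : frame p v -> line p v 0 = p.
Proof. by move=> fr; apply: val_inj; rewrite val_line // cosh0 sinh0 scale0r addr0 scale1r. Qed.

Lemma geodesic_dH (g : R -> hyp R d) :
  geodesic g <-> forall s t, dH (g s) (g t) = `|s - t|.
Proof. by split=> geo s t; have := geo s t; rewrite dHE. Qed.

Lemma line_geodesic p v : frame p v -> geodesic (line p v).
Proof.
move=> fr; apply/geodesic_dH => s t; apply: cosh_inj; rewrite ?dH_ge0 // cosh_norm cosh_dH !val_line //.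
have [pv vv] := fr.
rewrite !lor_lin hyp_norm (lorC v) pv vv coshB.
by move: (cosh s) (cosh t) (sinh s) (sinh t) => *; ring.
Qed.

Lemma dH_line p v s t : frame p v -> dH (line p v s) (line p v t) = `|s - t|.
Proof. by move=> /line_geodesic/geodesic_dH. Qed.

Lemma frame_opp p v : frame p v -> frame p (- v).
Proof. by move=> [pv vv]; split; rewrite !lor_lin ?pv ?vv ?oppr0 ?opprK. Qed.

Lemma line_opp p v t : frame p v -> line p (- v) t = line p v (- t).
Proof.
move=> fr; apply: val_inj; rewrite !val_line //; last exact: frame_opp.
by rewrite coshN sinhN scalerN scaleNr.
Qed.

(** The unit tangent at [x] pointing towards [y]; it degenerates to zero when [x = y]. *)
Definition direction x y : 'rV[R]_d.+1 :=
  (sinh (dH x y))^-1 *: (val y - cosh (dH x y) *: val x).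

Lemma frame_direction x y : x <> y -> frame x (direction x y).
Proof.
move=> xy; have s0 : sinh (dH x y) != 0.
  by apply/eqP => /sinh_eq0/dH_eq0.
rewrite /frame /direction; have := cosh2 (dH x y).
have := cosh_dH x y; set c := cosh _; set s := sinh _ in s0 *.
move=> E; have {E} E : <<val x, val y>> = - c by rewrite E opprK.
move=> cs; rewrite !lor_lin !hyp_norm (lorC (val y)) E; split; first by ring.
transitivity (s^-1 * s^-1 * (c ^+ 2 - 1)); first by ring.
by rewrite cs addrC addKr expr2 mulrACA mulVf // mulr1.
Qed.

Lemma line_direction x y : x <> y -> line x (direction x y) (dH x y) = y.
Proof.
move=> xy; have s0 : sinh (dH x y) != 0.
  by apply/eqP => /sinh_eq0/dH_eq0.
apply: val_inj; rewrite val_line; last exact: frame_direction.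
by rewrite /direction scalerA divff // scale1r addrC subrK.
Qed.

(** The distances to [g 0] and [g 1] determine the Lorentz product of [g t] with the expected point
    of the line; it comes out as -1, so the points agree. The domain [D] covers both rays and full
    lines. *)
Lemma geodesic_on_line (D : set R) (g : R -> hyp R d) : D 0 -> D 1 ->
  (forall s t, D s -> D t -> dH (g s) (g t) = `|s - t|) ->
  exists2 v, frame (g 0) v & forall t, D t -> g t = line (g 0) v t.
Proof.
move=> D0 D1 geo; pose p := g 0; pose q := g 1.
have pq1 : dH p q = 1 by rewrite geo // sub0r normrN normr1.
have pq : p <> q by move=> E; have := pq1; rewrite E dHxx => /eqP; rewrite eq_sym oner_eq0.
have fr := frame_direction pq.
exists (direction p q) => // t Dt.
apply: lor_hyp_eq; rewrite val_line //.
rewrite /direction pq1 !lor_lin.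
have s0 : sinh (1 : R) != 0 by apply/eqP => /sinh_eq0/eqP; rewrite oner_eq0.
have tp : <<val (g t), val p>> = - cosh t.
  by rewrite -[LHS]opprK -cosh_dH geo // cosh_norm subr0.
have tq : <<val (g t), val q>> = - (cosh t * cosh 1 - sinh t * sinh 1).
  by rewrite -[LHS]opprK -cosh_dH geo // cosh_norm coshB.
rewrite tp tq; have := cosh2 t.
move: (cosh t) (sinh t) (cosh 1) (sinh 1) s0 => ct st c1 s1 s0 E.
have -> : ct * - ct + st * (s1^-1 * (- (ct * c1 - st * s1) - c1 * - ct)) = - ct ^+ 2 + st ^+ 2 * (s1^-1 * s1) by ring.
by rewrite mulVf // E; ring.
Qed.

Lemma geodesicP (g : R -> hyp R d) : geodesic g ->
  exists2 v, frame (g 0) v & g = line (g 0) v.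
Proof.
move=> /geodesic_dH geo.
have [v fr E] := @geodesic_on_line setT g I I (fun s t _ _ => geo s t).
by exists v => //; apply/funext => t; apply: E.
Qed.

Lemma geodesicS (g : R -> hyp R d) t0 : geodesic g -> geodesic (fun t => g (t + t0)).
Proof. by move=> geo s t; rewrite geo; congr (Num.norm _); ring. Qed.

Lemma geodesic_opp (g : R -> hyp R d) : geodesic g -> geodesic (fun t => g (- t)).
Proof. by move=> geo s t; rewrite geo -normrN; congr (Num.norm _); ring. Qed.

Lemma velocity_line p v : frame p v -> velocity (line p v) 0 = v.
Proof.
move=> fr; rewrite /velocity.
have -> : (fun s => val (line p v s)) = (fun s => cosh s *: val p + sinh s *: v).
  by apply/funext => s; rewrite val_line.
have D i : is_derive (0 : R) 1
    (fun s => (cosh s *: val p + sinh s *: v) ord0 i) (v ord0 i).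
  have -> : (fun s => (cosh s *: val p + sinh s *: v) ord0 i) =
      (fun s => cosh s * val p ord0 i + sinh s * v ord0 i).
    by apply/funext => s; rewrite !mxE.
  exact: is_derive0_cosh_sinh.
rewrite derive1E derive_mx; last first.
  by apply/derivable_mxP => i j; rewrite (ord1 i); have [] := D j.
by apply/matrixP => i j; rewrite !mxE (ord1 i); have [] := D j.
Qed.

Lemma lor_isom (f : Isom R d) x y : <<val (f x), val (f y)>> = <<val x, val y>>.
Proof. by apply: oppr_inj; rewrite -!cosh_dH !dHE isom_dist. Qed.

Lemma dH_isom (f : Isom R d) x y : dH (f x) (f y) = dH x y.
Proof. by rewrite !dHE isom_dist. Qed.

Lemma geodesic_isom (f : Isom R d) (g : R -> hyp R d) : geodesic g -> geodesic (f \o g).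
Proof. by move=> geo s t; rewrite isom_dist geo. Qed.

End Lines.

(** * Projection to a line and its contraction *)

Section DistanceToLine.
Variables (R : realType) (d : nat).
Local Notation "<< x , y >>" := (lor x y) (at level 0).
Implicit Types (x y z p q : hyp R d) (u v w : 'rV[R]_d.+1).

Fact foot_subproof : {f : hyp R d -> 'rV[R]_d.+1 -> hyp R d -> R | forall p v q, f p v q =
  ln ((- <<val q, val p>> + <<val q, v>>) / (- <<val q, val p>> - <<val q, v>>)) / 2}.
Proof. by eexists. Qed.

(* The parameter of the point of [line p v] closest to [q]. *)
Definition foot := sval foot_subproof.

Lemma footE p v q : foot p v q =
  ln ((- <<val q, val p>> + <<val q, v>>) / (- <<val q, val p>> - <<val q, v>>)) / 2.
Proof. exact: (svalP foot_subproof). Qed.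

Fact dline_subproof : {f : hyp R d -> 'rV[R]_d.+1 -> hyp R d -> R | forall p v q, f p v q =
  dH q (line p v (foot p v q))}.
Proof. by eexists. Qed.

Definition dline := sval dline_subproof.

Lemma dlineE p v q : dline p v q = dH q (line p v (foot p v q)).
Proof. exact: (svalP dline_subproof). Qed.

Lemma dline_ge0 p v q : 0 <= dline p v q.
Proof. by rewrite dlineE dH_ge0. Qed.

(** Polar coordinates for the component of [q] in the plane of [p] and [v]; the last item is the
    hyperbolic Pythagorean theorem. *)
Lemma foot_spec p v q : frame p v ->
  [/\ - <<val q, val p>> = cosh (dline p v q) * cosh (foot p v q),
      <<val q, v>> = cosh (dline p v q) * sinh (foot p v q) &
      forall s, cosh (dH q (line p v s)) = cosh (dline p v q) * cosh (foot p v q - s)].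
Proof.
move=> fr; have [pv vv] := fr.
have L s : cosh (dH q (line p v s)) = - <<val q, val p>> * cosh s - <<val q, v>> * sinh s.
  by rewrite cosh_dH val_line // !lor_lin; clear; lor_atoms; ring.
(* The component [n] of [q] normal to the plane of the line is orthogonal to [p], so its square is
   nonnegative. *)
have C1 : 1 <= (- <<val q, val p>>) ^+ 2 - <<val q, v>> ^+ 2.
  pose n := val q + <<val q, val p>> *: val p - <<val q, v>> *: v.
  have pn : <<val p, n>> = 0.
    by rewrite /n !lor_lin hyp_norm pv (lorC (val p)); clear; lor_atoms; ring.
  have := lor_orth_ge0 (hyp_norm p) pn.
  rewrite /n !lor_lin !hyp_norm vv (lorC v) (lorC v) pv (lorC (val p) (val q)).
  by rewrite !expr2; clear; lor_atoms; lra.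
have fE : ln ((- <<val q, val p>> + <<val q, v>>) / (- <<val q, val p>> - <<val q, v>>)) / 2
    = foot p v q by rewrite footE.
have [C [aE bE]] := hyperbolic_polar (lor_hyp q p) C1.
rewrite fE in aE bE.
have CE : cosh (dline p v q) = C.
  rewrite dlineE [LHS](L (foot p v q)) aE bE; have := cosh2 (foot p v q).
  move: (cosh _) (sinh _) => c s; clear => cs.
  transitivity (C * (c ^+ 2 - s ^+ 2)); first by ring.
  by rewrite cs; ring.
subst C; split; [exact: aE|exact: bE|] => s.
by rewrite [LHS]L aE bE coshB; clear; ring.
Qed.

Lemma cosh_hd_line p v q s : frame p v ->
  cosh (dH q (line p v s)) = cosh (dline p v q) * cosh (foot p v q - s).
Proof. by move=> fr; have [_ _ H] := foot_spec q fr; exact: H. Qed.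

Lemma dline_le p v q s : frame p v -> dline p v q <= dH q (line p v s).
Proof.
move=> fr; rewrite -ler_cosh ?dline_ge0 ?dH_ge0 // cosh_hd_line //.
by rewrite ler_peMr ?cosh_ge1 // ltW // cosh_gt0.
Qed.

Lemma dline_lip p v q q' : frame p v -> dline p v q <= dH q q' + dline p v q'.
Proof.
move=> fr; rewrite (dlineE p v q'); apply: le_trans (dH_triangle _ _ _).
exact: dline_le.
Qed.

Lemma cosh_dline_sqr p v q : frame p v ->
  cosh (dline p v q) ^+ 2 = <<val q, val p>> ^+ 2 - <<val q, v>> ^+ 2.
Proof.
move=> fr; have [E1 E2 _] := foot_spec q fr.
rewrite -(sqrrN <<val q, val p>>) E1 E2 !exprMn (cosh2 (foot p v q)).
by clear; ring.
Qed.

(** Cauchy-Schwarz for the components normal to the plane of the line bounds their product by that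
    of the two sinh; the latter is at most the product of the cosh minus one, because the cosh of
    the difference is at least one. *)
Lemma foot_contraction p v q q' : frame p v ->
  (cosh (foot p v q - foot p v q') - 1) * (cosh (dline p v q) * cosh (dline p v q'))
    <= cosh (dH q q') - 1.
Proof.
move=> fr; have [pv vv] := fr.
have [E1 E2 _] := foot_spec q fr; have [E1' E2' _] := foot_spec q' fr.
have q1 := hyp_norm q; have q1' := hyp_norm q'.
pose n x := val x + <<val x, val p>> *: val p - <<val x, v>> *: v.
have pn x : <<val p, n x>> = 0.
  by rewrite /n !lor_lin hyp_norm pv (lorC (val p)); clear; lor_atoms; ring.
have nn x y : <<n x, n y>> = <<val x, val y>> + <<val x, val p>> * <<val y, val p>>
    - <<val x, v>> * <<val y, v>>.
  rewrite /n !lor_lin !hyp_norm vv pv (lorC v (val p)) pv (lorC (val p) (val y)).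
  rewrite (lorC v (val y)).
  by clear; lor_atoms; ring.
have := lor_CS (hyp_norm p) (pn q) (pn q').
have nnE x : <<n x, n x>> = sinh (dline p v x) ^+ 2.
  rewrite nn hyp_norm; have := cosh_dline_sqr x fr; have := cosh2 (dline p v x).
  by rewrite -!expr2; clear; lor_atoms; move: (cosh _) (sinh _) => c s; lra.
rewrite !nnE -exprMn => H.
have {}H : `|<<n q, n q'>>| <= `|sinh (dline p v q) * sinh (dline p v q')|.
  by rewrite -ler_sqr ?nnegrE // !real_normK ?num_real.
have S := mulr_ge0 (sinh_ge0 (dline_ge0 p v q)) (sinh_ge0 (dline_ge0 p v q')).
move: H; rewrite (ger0_norm S) ler_norml => /andP[_].
rewrite nn -mulrNN E1 E1' E2 E2' => H.
have K := cosh_ge1 (dline p v q - dline p v q').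
rewrite (coshB (dline p v q) (dline p v q')) in K.
rewrite (coshB (foot p v q) (foot p v q')) (cosh_dH q q').
move: H K; move: (sinh (dline p v q)) (sinh (dline p v q')) => sr sr'.
move: (cosh (dline p v q)) (cosh (dline p v q')) => cr cr'.
move: (sinh (foot p v q)) (sinh (foot p v q')) => sf sf'.
move: (cosh (foot p v q)) (cosh (foot p v q')) => cf cf'.
by clear; lor_atoms => *; lra.
Qed.

Lemma foot_contraction_uniform (s eta : R) : 0 <= s -> 0 < eta ->
  exists2 r0, 0 <= r0 & forall p v q q', frame p v ->
    r0 <= dline p v q -> r0 <= dline p v q' -> dH q q' <= s ->
    `|foot p v q - foot p v q'| <= eta.
Proof.
move=> s0 eta0.
have e1 : 0 < cosh eta - 1.
  by have := cosh2 eta; have := sinh_gt0 eta0; have := cosh_ge1 eta; clear; nra.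
have s1 : 0 <= cosh s - 1 by have := cosh_ge1 s; clear; lra.
(* The factor 2 compensates [cosh r >= r / 2]: beyond this radius each cosh is at least the
   quotient. *)
exists (2 * ((cosh s - 1) / (cosh eta - 1))).
  by rewrite mulr_ge0 // divr_ge0 // ltW.
set C := _ / (_ - 1) => p v q q' fr r1 r2 qs.
rewrite -ler_cosh ?normr_ge0 ?(ltW eta0) // cosh_norm.
have Cq : C <= cosh (dline p v q).
  have r0 := dline_ge0 p v q; have := cosh_ge_half r0.
  by move: r1; clear; lra.
have := foot_contraction q q' fr.
have : cosh (dH q q') <= cosh s by rewrite ler_cosh ?dH_ge0.
have c1 := cosh_ge1 (dline p v q'); have c0 := cosh_ge1 (foot p v q - foot p v q').
have CE : C * (cosh eta - 1) = cosh s - 1 by rewrite divfK // lt0r_neq0.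
have C0 : 0 <= C by rewrite divr_ge0 // ltW.
have a1 := cosh_ge1 (dline p v q).
move: Cq a1 c1 c0 CE C0 e1; clear.
move: (cosh (dline _ _ _)) (cosh (dline _ _ _)) (cosh (_ - _)) (cosh (dH _ _)) => a b c e.
move: (cosh s) (cosh eta) => f g ca a1 b1 c1 CE C0 e1 ef H.
rewrite leNgt; apply/negP => gc.
have ab1 : 0 < a * b by nra.
have : (g - 1) * (a * b) < (c - 1) * (a * b) by rewrite ltr_pM2r //; lra.
have : C * (g - 1) <= (a * b) * (g - 1) by rewrite ler_pM2r //; nra.
lra.
Qed.

End DistanceToLine.

(** * Stability of quasi-geodesic segments *)

Section Morse.
Variables (R : realType) (d : nat).
Implicit Types (x y z p q : hyp R d) (v : 'rV[R]_d.+1).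

Lemma dH_steps (q : nat -> hyp R d) p v (eta : R) i n : 
  (forall k, (i <= k < i + n)%N -> `|foot p v (q k) - foot p v (q k.+1)| <= eta) ->
  `|foot p v (q i) - foot p v (q (i + n)%N)| <= n%:R * eta.
Proof.
elim: n => [|n IH] H; first by rewrite addn0 subrr normr0 mul0r.
have {}IH := IH (fun k kn => H k ltac:(lia)).
have {}H := H (i + n)%N ltac:(lia); rewrite -addnS in H.
rewrite -natr1 mulrDl mul1r; apply: le_trans (lerD IH H).
by apply: le_trans (ler_normD _ _); rewrite addrA subrK.
Qed.

(* Outside the [r0]-neighbourhood of the line projections contract by more than
   the speed of the quasi-geodesic, so excursions from it have bounded length. *)
Lemma morse_segment (K c : R) : 0 < K -> 0 < c -> exists2 D, 0 <= D &
  forall p v (q : nat -> hyp R d) n, frame p v ->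
    (forall i j, (i <= j <= n)%N ->
      K^-1 * (j - i)%N%:R - c <= dH (q i) (q j) <= K * (j - i)%N%:R + c) ->
    dline p v (q 0%N) = 0 -> dline p v (q n) = 0 ->
    forall i, (i <= n)%N -> dline p v (q i) <= D.
Proof.
move=> K0 c0; set s := K + c.
have s0 : 0 <= s by rewrite addr_ge0 // ltW.
have Ki0 : 0 < K^-1 by rewrite invr_gt0.
(* Far from the line, feet will move at most at half the lower speed [K^-1] of the
   quasi-geodesic. *)
have eta0 : 0 < K^-1 / 2 by rewrite divr_gt0.
have [r0 r00 contr] := @foot_contraction_uniform R d s _ s0 eta0.
(* An excursion of duration T' has endpoints at least T' / K - c apart, and at most 4 s + 2 r0 + T'
   / (2 K) by the route through the feet; solving for T' gives [T]. *)
set T := 2 * K * (c + 4 * s + 2 * r0).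
have T0 : 0 <= T by rewrite !mulr_ge0 ?addr_ge0 ?mulr_ge0 // ltW.
have KT : 0 <= K * T + c by rewrite addr_ge0 ?(ltW c0) // mulr_ge0 // ltW.
exists (r0 + (K * T + c)); first by rewrite addr_ge0.
move=> p v q n fr qg d0 dn i iN.
have step k : (k < n)%N -> dH (q k) (q k.+1) <= s.
  move=> kn; have /andP[_] := qg k k.+1 ltac:(by rewrite leqnSn).
  by rewrite subSnn mulr1.
have [le|gt] := leP (dline p v (q i)) r0.
  by apply: le_trans le _; rewrite lerDl.
have exj : exists j, (j <= i)%N && (dline p v (q j) <= r0) by exists 0%N; rewrite leq0n d0 r00.
have ubj j : (j <= i)%N && (dline p v (q j) <= r0) -> (j <= i)%N by case/andP.
have exl : exists l, [&& (i <= l)%N, (l <= n)%N & dline p v (q l) <= r0].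
  by exists n; rewrite iN leqnn dn r00.
(* The excursion around [i] runs between the last time [j] before it and the first time [l] after it
   at distance at most [r0] from the line. *)
case: (ex_maxnP exj ubj) => j /andP[ji dj] jmax.
case: (ex_minnP exl) => l /and3P[il ln dl] lmin.
have ji' : (j < i)%N.
  by rewrite ltn_neqAle ji andbT; apply/eqP => E; move: gt; rewrite -E ltNge dj.
have il' : (i < l)%N.
  by rewrite ltn_neqAle il andbT; apply/eqP => E; move: gt; rewrite E ltNge dl.
have jn : (j < n)%N by exact: leq_trans ji' iN.
have ln' : (l.-1 < n)%N by clear -il' ln; lia.
have jl : (j.+1 + (l - j - 2))%N = l.-1 by clear -ji' il'; lia.
have far k : (j < k < l)%N -> r0 <= dline p v (q k).
  move=> /andP[jk kl]; rewrite leNgt; apply/negP => /ltW lt.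
  have [ki|ik] := leqP k i.
    by have := jmax k; rewrite ki lt => /(_ isT); rewrite leqNgt jk.
  have := lmin k; rewrite (ltnW ik) (leq_trans (ltnW kl) ln) lt => /(_ isT).
  by rewrite leqNgt kl.
have proj : `|foot p v (q j.+1) - foot p v (q (j.+1 + (l - j - 2))%N)|
    <= (l - j - 2)%N%:R * (K^-1 / 2).
  apply: dH_steps => k kb; apply: contr => //.
  - by apply: far; clear -kb ji' il'; lia.
  - by apply: far; clear -kb ji' il'; lia.
  - by apply: step; clear -kb ji' il' ln; lia.
rewrite jl in proj.
have Sj := step j jn.
have Sl := step l.-1 ln'; rewrite (ltn_predK il') in Sl.
have Dj : dline p v (q j.+1) <= s + r0.
  apply: le_trans (dline_lip (q j.+1) (q j) fr) _; rewrite dHC; exact: lerD.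
have Dl : dline p v (q l.-1) <= s + r0.
  apply: le_trans (dline_lip (q l.-1) (q l) fr) _; exact: lerD.
have mid : dH (q j.+1) (q l.-1) <= 2 * (s + r0) + (l - j - 2)%N%:R * (K^-1 / 2).
  have := dH_triangle (line p v (foot p v (q j.+1))) (q j.+1) (q l.-1).
  have := dH_triangle (line p v (foot p v (q l.-1))) (line p v (foot p v (q j.+1))) (q l.-1).
  rewrite (dH_line _ _ fr) -(dlineE p v (q j.+1)) (dHC (line p v (foot p v (q l.-1))) (q l.-1)) -(dlineE p v (q l.-1)).
  move: proj Dj Dl; clear.
  move: (foot p v (q j.+1)) (foot p v (q l.-1)) (dline p v (q j.+1)) (dline p v (q l.-1)).
  by move=> *; lra.
have tot : dH (q j) (q l) <= 4 * s + 2 * r0 + (l - j)%N%:R * (K^-1 / 2).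
  have := dH_triangle (q j.+1) (q j) (q l).
  have := dH_triangle (q l.-1) (q j.+1) (q l).
  have : (l - j - 2)%N%:R * (K^-1 / 2) <= (l - j)%N%:R * (K^-1 / 2).
    by rewrite ler_pM2r // ler_nat -subnDA leq_sub2l // leq_addr.
  move: mid Sj Sl; clear.
  move: (dH (q j) (q j.+1)) (dH (q l.-1) (q l)) (dH (q j.+1) (q l.-1)).
  move: (dH (q j) (q l)) (dH (q j.+1) (q l)).
  by move=> *; lra.
have len : (l - j)%N%:R <= T.
  have /andP[low _] := qg j l ltac:(by rewrite (ltnW (ltn_trans ji' il'))).
  have {}low : (l - j)%N%:R * (K^-1 / 2) <= c + 4 * s + 2 * r0.
    by move: low tot; clear; move: (dH _ _) => *; lra.
  rewrite /T -ler_pdivrMl ?mulr_gt0 //; apply: le_trans low.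
  by rewrite invfM mulrC [2^-1 * _]mulrC.
have /andP[_ up] := qg j i ltac:(by rewrite ji).
apply: le_trans (dline_lip (q i) (q j) fr) _; rewrite dHC addrC lerD //.
apply: le_trans up _; rewrite lerD2r; apply: ler_wpM2l; first exact: ltW.
by apply: (le_trans _ len); rewrite ler_nat leq_sub2r // ltnW.
Qed.


End Morse.

(** * Compactness of lines meeting a bounded set *)

Section Limit.
Local Open Scope classical_set_scope.
Variables (R : realType) (d : nat).
Local Notation "<< x , y >>" := (lor x y) (at level 0).
Implicit Types (x y z p q : hyp R d) (v : 'rV[R]_d.+1).

Lemma cvg_lor (T : Type) (F : set_system T) (FF : Filter F)
    (f g : T -> 'rV[R]_d.+1) (a b : 'rV[R]_d.+1) :
  (forall j, f x ord0 j @[x --> F] --> a ord0 j) ->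
  (forall j, g x ord0 j @[x --> F] --> b ord0 j) ->
  <<f x, g x>> @[x --> F] --> <<a, b>>.
Proof.
move=> fa gb.
have -> : (fun t => <<f t, g t>>) = (fun t => - (f t ord0 ord0 * g t ord0 ord0) +
    \sum_(i < d) f t ord0 (lift ord0 i) * g t ord0 (lift ord0 i)).
  by apply/funext => t; rewrite lorE.
rewrite lorE /lorentz; apply: cvgD; first by apply: cvgN; apply: cvgM.
apply: cvg_big => [|i _]; last exact: cvgM.
exact: add_continuous.
Qed.

Let pt : 'rV[R]_(d.+1 + d.+1) -> 'rV[R]_d.+1 := lsubmx.
Let vec : 'rV[R]_(d.+1 + d.+1) -> 'rV[R]_d.+1 := rsubmx.

Let lor_continuous (f g : 'rV[R]_(d.+1 + d.+1) -> 'rV[R]_d.+1) :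
  (forall j, continuous (fun X => f X ord0 j)) ->
  (forall j, continuous (fun X => g X ord0 j)) -> continuous (fun X => <<f X, g X>>).
Proof.
move=> fc gc X; have FX : Filter (nbhs X) by exact: nbhs_filter.
exact: (@cvg_lor _ (nbhs X) FX f g _ _ (fun j => fc j X) (fun j => gc j X)).
Qed.

Let pt_continuous j : continuous (fun X => pt X ord0 j).
Proof.
have -> : (fun X => pt X ord0 j) = (fun X => X ord0 (lshift d.+1 j)).
  by apply/funext => X; rewrite mxE.
exact: coord_continuous.
Qed.

Let vec_continuous j : continuous (fun X => vec X ord0 j).
Proof.
have -> : (fun X => vec X ord0 j) = (fun X => X ord0 (rshift d.+1 j)).
  by apply/funext => X; rewrite mxE.
exact: coord_continuous.
Qed.

Let cst_continuous_coord (a : 'rV[R]_d.+1) j :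
  continuous (fun X : 'rV[R]_(d.+1 + d.+1) => a ord0 j).
Proof. by move=> X; exact: cst_continuous. Qed.

Ltac coord_cont :=
  first [exact: pt_continuous|exact: vec_continuous|exact: cst_continuous_coord].

Lemma closed_preimage_real (T : topologicalType) (f : T -> R) (A : set R) :
  continuous f -> closed A -> closed (f @^-1` A).
Proof. by move=> fc; move/continuous_closedP: fc; apply. Qed.

Lemma hyp_origin_proof :
  (lorentz (delta_mx ord0 ord0 : 'rV[R]_d.+1) (delta_mx ord0 ord0) == - 1) &&
  (0 < (delta_mx ord0 ord0 : 'rV[R]_d.+1) ord0 ord0).
Proof.
rewrite /lorentz !mxE !eqxx mulr1 ltr01 andbT big1 ?addr0 // => i _.
by rewrite !mxE !eqxx /= mul0r.
Qed.

Definition hyp_origin : hyp R d := exist _ (delta_mx ord0 ord0 : 'rV[R]_d.+1) hyp_origin_proof.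

Lemma lor_origin (x : 'rV[R]_d.+1) : <<val hyp_origin, x>> = - x ord0 ord0.
Proof.
rewrite lorE /lorentz /= !mxE !eqxx mul1r big1 ?addr0 // => i _.
by rewrite !mxE !eqxx /= mul0r.
Qed.

Lemma coord_le (x : 'rV[R]_d.+1) B j : <<x, x>> <= 1 -> `|x ord0 ord0| <= B ->
  `|x ord0 j| <= 1 + B.
Proof.
move=> xx x0; have B0 : 0 <= B by apply: le_trans x0.
case: (unliftP ord0 j) => [i|] ->; last by apply: le_trans x0 _; lra.
rewrite -ler_sqr ?nnegrE ?addr_ge0 // real_normK ?num_real //.
have H : x ord0 ord0 ^+ 2 <= B ^+ 2 by rewrite -(real_normK (num_real _)) ler_sqr ?nnegrE.
have : x ord0 (lift ord0 i) ^+ 2 <= \sum_(k < d) x ord0 (lift ord0 k) * x ord0 (lift ord0 k).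
  rewrite (bigD1 i) //= -expr2 lerDl; apply: sumr_ge0 => k _.
  by rewrite -expr2 sqr_ge0.
move: xx; rewrite lorE /lorentz -expr2; move: (\sum_(_ < _) _) H; clear -B0.
move: (x ord0 ord0) (x ord0 (lift ord0 i)) => a b s; rewrite !expr2 => *; nra.
Qed.

(** The difference of the squared time coordinates of [p] and [v] is the squared cosh of the
    distance from the origin to the line, so [p] controls [v]. *)
Lemma frame_coord_le p v D j : frame p v -> dH hyp_origin p <= D ->
  `|val p ord0 j| <= 1 + cosh D /\ `|v ord0 j| <= 1 + cosh D.
Proof.
move=> fr oD; have [pv vv] := fr.
have D0 : 0 <= D by apply: le_trans (dH_ge0 _ _) oD.
have p0 : val p ord0 ord0 <= cosh D.
  by rewrite -[leLHS]opprK -lor_origin -cosh_dH ler_cosh ?dH_ge0.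
have p00 := hyp_coord0_gt0 p.
have P0 : `|val p ord0 ord0| <= cosh D by rewrite gtr0_norm.
split; first by apply: coord_le => //; rewrite hyp_norm; lra.
apply: coord_le; first by rewrite vv.
have := cosh_dline_sqr hyp_origin fr; rewrite !lor_origin !sqrrN => E.
rewrite -ler_sqr ?nnegrE ?(ltW (cosh_gt0 D)) ?normr_ge0 // real_normK ?num_real //.
have : val p ord0 ord0 ^+ 2 <= cosh D ^+ 2 by rewrite ler_sqr ?nnegrE ?(ltW (cosh_gt0 D)) ?(ltW p00).
have := sqr_ge0 (cosh (dline p v hyp_origin)); rewrite E.
by move: (val p ord0 ord0 ^+ 2) (v ord0 ord0 ^+ 2) (cosh D ^+ 2) => *; lra.
Qed.

(** The frames lie in a compact box, so they cluster somewhere, and the cluster point inherits every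
    closed condition that eventually holds. The expression bounded by [C] is the squared cosh of the
    distance from [q] to the line. *)
Lemma frames_limit (o : hyp R d) (D : R) (p : nat -> hyp R d) (v : nat -> 'rV[R]_d.+1) :
  (forall n, frame (p n) (v n)) -> (forall n, dH o (p n) <= D) ->
  exists p' v', frame p' v' /\ forall q C,
    (exists N, forall n, (N <= n)%N -> <<val q, val (p n)>> ^+ 2 - <<val q, v n>> ^+ 2 <= C) ->
    <<val q, val p'>> ^+ 2 - <<val q, v'>> ^+ 2 <= C.
Proof.
move=> fr oD; pose D' := dH hyp_origin o + D.
have oD' n : dH hyp_origin (p n) <= D'.
  by apply: le_trans (dH_triangle o _ _) _; rewrite lerD2l.
pose X n : 'rV[R]_(d.+1 + d.+1) := row_mx (val (p n)) (v n).
have ptX n : pt (X n) = val (p n) by rewrite /pt row_mxKl.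
have vecX n : vec (X n) = v n by rewrite /vec row_mxKr.
pose S1 := (fun X => <<pt X, pt X>>) @^-1` [set - 1].
pose S2 := (fun X => <<pt X, vec X>>) @^-1` [set 0].
pose S3 := (fun X => <<vec X, vec X>>) @^-1` [set 1].
pose S4 := (fun X => <<val o, pt X>>) @^-1` [set t | t <= - 1].
pose I := (fun _ : 'I_(d.+1 + d.+1) => `[- (1 + cosh D'), 1 + cosh D']%classic : set R).
have Bc := @rV_compact R (d.+1 + d.+1) I (fun=> @segment_compact _ _ _).
set B := (X in compact X) in Bc.
have XB n : B (X n).
  move=> j; have [Hp Hv] : (forall j, `|val (p n) ord0 j| <= 1 + cosh D') /\
      (forall j, `|v n ord0 j| <= 1 + cosh D').
    by split=> k; have [] := frame_coord_le k (fr n) (oD' n).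
  rewrite /I /= in_itv /= -ler_norml /X.
  by case: (split_ordP j) => k ->; rewrite ?row_mxEl ?row_mxEr.
have FB : (X @ \oo) B by exists 0%N => // n _; apply: XB.
have [Y [_ clY]] := Bc (X @ \oo) _ FB.
have inY (A : set 'rV[R]_(d.+1 + d.+1)) : closed A ->
    (exists N, forall n, (N <= n)%N -> A (X n)) -> A Y.
  move=> Acl [N AN]; move: clY; rewrite clusterE => /(_ A) H.
  rewrite closure_id in Acl; rewrite Acl; apply: H.
  by exists N => // n /= Nn; apply: AN.
have Y1 : <<pt Y, pt Y>> = - 1.
  apply: (inY S1); last by exists 0%N => n _; rewrite /S1 /= ptX hyp_norm.
  by apply: closed_preimage_real; [by apply: lor_continuous => j; coord_cont|exact: closed_eq].
have Y2 : <<pt Y, vec Y>> = 0.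
  apply: (inY S2); last by exists 0%N => n _; rewrite /S2 /= ptX vecX; have [] := fr n.
  by apply: closed_preimage_real; [by apply: lor_continuous => j; coord_cont|exact: closed_eq].
have Y3 : <<vec Y, vec Y>> = 1.
  apply: (inY S3); last by exists 0%N => n _; rewrite /S3 /= vecX; have [] := fr n.
  by apply: closed_preimage_real; [by apply: lor_continuous => j; coord_cont|exact: closed_eq].
have Y4 : <<val o, pt Y>> <= - 1.
  apply: (inY S4).
    by apply: closed_preimage_real; [by apply: lor_continuous => j; coord_cont|exact: closed_le].
  by exists 0%N => n _; rewrite /S4 /= ptX; have := lor_hyp o (p n); lra.
have pY : val (hyp_of o (pt Y)) = pt Y by apply: val_hyp_of => //; lra.
exists (hyp_of o (pt Y)), (vec Y); split; first by rewrite /frame pY.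
move=> q C [N HN]; rewrite pY.
pose S5 := (fun X => <<val q, pt X>> ^+ 2 - <<val q, vec X>> ^+ 2) @^-1` [set t | t <= C].
apply: (inY S5); last by exists N => n Nn; rewrite /S5 /= ptX vecX HN.
apply: closed_preimage_real; last exact: closed_le.
have c1 : continuous (fun X => <<val q, pt X>>) by apply: lor_continuous => j; coord_cont.
have c2 : continuous (fun X => <<val q, vec X>>) by apply: lor_continuous => j; coord_cont.
have sq (f : 'rV[R]_(d.+1 + d.+1) -> R) : continuous f -> continuous (fun X => f X ^+ 2).
  move=> fc Z; have -> : (fun X => f X ^+ 2) = (fun X => f X * f X).
    by apply/funext => W; rewrite expr2.
  exact: (@continuousM _ _ f f Z (fc Z) (fc Z)).
by move=> Z; exact: (continuousB (sq _ c1 Z) (sq _ c2 Z)).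
Qed.

End Limit.

(** * Biinfinite quasi-geodesics follow a line *)

Section MorseLine.
Variables (R : realType) (d : nat).
Local Notation "<< x , y >>" := (lor x y) (at level 0).
Implicit Types (x y z p q : hyp R d) (v w : 'rV[R]_d.+1).

Definition qgeod (K c : R) (q : int -> hyp R d) : Prop := forall (i : int) (n : nat),
  K^-1 * n%:R - c <= dH (q i) (q (i + n%:Z)) <= K * n%:R + c.

Lemma quasi_geodesic_qgeod (K c : R) (q : int -> hyp R d) : quasi_geodesic K c q -> qgeod K c q.
Proof.
move=> qg i n; have := qg i (i + n%:Z).
by rewrite dHE (_ : `|i - (i + n%:Z)|%:~R = n%:R) // opprD addNKr normrN.
Qed.

Lemma dline_end0 x v : frame x v -> dline x v x = 0.
Proof.
move=> fr; apply/eqP; rewrite eq_le dline_ge0 andbT.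
by apply: le_trans (dline_le _ 0 fr) _; rewrite line0 // dHxx.
Qed.

Lemma dline_end1 x y : x <> y -> dline x (direction x y) y = 0.
Proof.
move=> xy; have fr := frame_direction xy; apply/eqP; rewrite eq_le dline_ge0 andbT.
by apply: le_trans (dline_le _ (dH x y) fr) _; rewrite line_direction // dHxx.
Qed.

Lemma line_recenter p v t0 : frame p v -> exists2 v', frame (line p v t0) v' &
  forall s, line (line p v t0) v' s = line p v (s + t0).
Proof.
move=> fr; have geo := geodesicS t0 (line_geodesic fr).
by have [v'] := geodesicP geo; rewrite /= add0r => fr' E; exists v' => // s; rewrite -E.
Qed.

Lemma morse_line (K c : R) : 0 < K -> 0 < c -> exists2 D, 0 <= D &
  forall q : int -> hyp R d, qgeod K c q -> exists p v, frame p v /\ forall i, dline p v (q i) <= D.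
Proof.
move=> K0 c0; have [D D0 HD] := @morse_segment R d K c K0 c0.
exists D => // q qg.
(* Beyond this length the lower bound is positive, so the endpoints [q (- m)] and [q m] below are
   distinct and span a line. *)
pose N0 := (Num.truncn (c * K)).+1.
have N0c : c * K < N0%:R by rewrite truncnS_gt.
have near n : exists pv : hyp R d * 'rV[R]_d.+1, [/\ frame pv.1 pv.2, dH (q 0) pv.1 <= D &
    forall i : int, `|i| <= n%:Z -> dline pv.1 pv.2 (q i) <= D].
  pose m := (n + N0)%N.
  pose x := q (- m%:Z); pose y := q m%:Z.
  have ym : y = q (- m%:Z + (m + m)%N%:Z) by congr q; rewrite PoszD addKr.
  have xy : x <> y.
    move=> xy; have /andP[H _] := qg (- m%:Z) (m + m)%N; move: H.
    rewrite -ym -/x xy dHxx subr_le0 mulrC ler_pdivrMr // leNgt => /negP; apply.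
    apply: lt_le_trans N0c _; rewrite ler_nat /m; lia.
  have fr := frame_direction xy.
  have near i : `|i| <= m%:Z -> dline x (direction x y) (q i) <= D.
    move=> im; pose q' (k : nat) := q (- m%:Z + k%:Z).
    have -> : q i = q' (absz (i + m%:Z)) by congr q; clear -im; lia.
    apply: (HD _ _ q' (m + m)%N fr).
    - move=> a b /andP[ab _]; have := qg (- m%:Z + a%:Z) (b - a)%N.
      by rewrite -addrA -PoszD subnKC.
    - by rewrite /q' addr0 dline_end0.
    - by rewrite /q' -ym dline_end1.
    - by clear -im; lia.
  (* Recentring at the foot of [q 0] keeps the base points within [D] of [q 0], as the compactness
     argument requires. *)
  have [v' fr' E] := line_recenter (foot x (direction x y) (q 0)) fr.
  exists (line x (direction x y) (foot x (direction x y) (q 0)), v'); split=> //=.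
    by rewrite -dlineE near.
  move=> i iN; have im : `|i| <= m%:Z by rewrite /m; lia.
  apply: le_trans (near i im); rewrite [leRHS]dlineE.
  have := dline_le (q i) (foot x (direction x y) (q i) - foot x (direction x y) (q 0)) fr'.
  by rewrite E subrK.
have [pv Hpv] := choice near.
have [||p [v [fr lim]]] := @frames_limit R d (q 0) D (fst \o pv) (snd \o pv).
- by move=> n; have [] := Hpv n.
- by move=> n; have [] := Hpv n.
exists p, v; split=> // i.
rewrite -ler_cosh ?dline_ge0 // -ler_sqr ?nnegrE ?(ltW (cosh_gt0 _)) //.
rewrite cosh_dline_sqr //; apply: lim; exists `|i|%N => n ni.
have [frn _ dn] := Hpv n; rewrite -cosh_dline_sqr //.
by rewrite ler_sqr ?nnegrE ?(ltW (cosh_gt0 _)) // ler_cosh ?dline_ge0 // dn //; lia.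
Qed.

End MorseLine.

(** * Lines that stay close in both directions coincide *)

Section Uniqueness.
Variables (R : realType) (d : nat).
Local Notation "<< x , y >>" := (lor x y) (at level 0).
Implicit Types (x y z p q : hyp R d) (v w N : 'rV[R]_d.+1).

Lemma frame_lor p v : frame p v -> [/\ <<val p, val p>> = - 1, <<val p, v>> = 0,
  <<v, val p>> = 0 & <<v, v>> = 1].
Proof. by move=> [pv vv]; split=> //; [exact: hyp_norm|rewrite lorC]. Qed.

Lemma frame_null p v : frame p v -> <<val p + v, val p + v>> = 0.
Proof.
by move=> fr; have [pp pv vp vv] := frame_lor fr; rewrite !lor_lin pp pv vp vv; ring.
Qed.

(* A future null vector [N] stands for an ideal point; it is orthogonal to the
   end [p + v] of a line only if the line ends there. *)
Lemma null_frame p v N : frame p v -> <<N, N>> = 0 -> <<val p, N>> < 0 ->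
  <<N, val p + v>> <= 0 /\
  (<<N, val p + v>> = 0 -> N = - <<val p, N>> *: (val p + v)).
Proof.
move=> fr NN pN; have [pp pv vp vv] := frame_lor fr.
pose n := N + <<val p, N>> *: val p - <<v, N>> *: v.
have pn : <<val p, n>> = 0 by rewrite /n !lor_lin pp pv; ring.
have nn : <<n, n>> = <<val p, N>> ^+ 2 - <<v, N>> ^+ 2.
  rewrite /n !lor_lin pp pv vp vv NN (lorC N (val p)) (lorC N v).
  by clear; lor_atoms; ring.
have := lor_orth_ge0 pp pn; have := @lor_orth_eq0 _ _ (val p) n pp pn.
rewrite nn lorDr (lorC N (val p)) (lorC N v).
set a := <<val p, N>> in pN nn *; set b := <<v, N>> => Z ge0.
split; first by move: pN ge0; clear; rewrite !expr2 => *; nra.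
move=> ab; have bE : b = - a by lra.
have : n = 0 by apply: Z; rewrite bE sqrrN subrr.
rewrite /n -/a -/b bE => /eqP; rewrite subr_eq0 => /eqP H.
by rewrite scalerDr scaleNr addrC -H addrK.
Qed.

Lemma frame_null_future p v q : frame p v -> <<val q, val p + v>> < 0.
Proof.
move=> fr; have [E1 E2 _] := foot_spec q fr.
rewrite lorDr E2 -[<<val q, val p>>]opprK E1 addrC -mulrBr -opprB mulrN oppr_lt0.
by rewrite -expRN_cosh mulr_gt0 ?cosh_gt0 // expR_gt0.
Qed.

Lemma line_null p v t : frame p v ->
  val (line p v t) = (expR t / 2) *: (val p + v) + (expR (- t) / 2) *: (val p - v).
Proof.
move=> fr; rewrite val_line // (expR_cosh t) (expRN_cosh t); apply/matrixP => i j; rewrite !mxE.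
by move: (cosh t) (sinh t) (val p i j) (v i j) => *; field.
Qed.

(** The squared cosh of the distance to the second line is the product of the pairings with its two
    ends. Its term in exp (2 t) has as coefficient the product of the two pairings below, up to a
    factor, so boundedness for large [t] makes one of them vanish. *)
Lemma line_dline_bounded p v p' v' (C : R) : frame p v -> frame p' v' ->
  (forall T, exists2 t, T <= t & dline p' v' (line p v t) <= C) ->
  <<val p' + v', val p + v>> = 0 \/ <<val p' - v', val p + v>> = 0.
Proof.
move=> fr fr' H; have fr0 := frame_opp fr'.
have neg w : frame p' w -> <<val p' + w, val p + v>> <= 0 /\ <<val p' + w, val p - v>> <= 0.
  move=> frw; split.
    have [] := null_frame fr (frame_null frw) _ => //; exact: frame_null_future.
  have [] := null_frame (frame_opp fr) (frame_null frw) _ => //; exact: frame_null_future.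
have [n1 n2] := neg _ fr'; have [m1 m2] := neg _ fr0.
set a := <<_, _>> in n1 *; set b := <<_, _>> in m1 *.
set a' := <<_, _>> in n2; set b' := <<_, _>> in m2.
suff /eqP : a * b = 0 by rewrite mulf_eq0 => /orP[]/eqP; [left|right].
apply/eqP/negP => /negP ab0.
have ab : 0 < a * b by rewrite lt_neqAle eq_sym ab0 mulr_le0.
pose B := 4 * cosh C ^+ 2 / (a * b).
have [t tB Ct] := H B.
have B0 : 0 <= B by rewrite divr_ge0 ?(ltW ab) // mulr_ge0 // sqr_ge0.
have t0 : 0 <= t by apply: le_trans tB.
have et : B < expR t ^+ 2.
  have := expR_ge1Dx t; rewrite expr2; move: tB B0; clear; move: (expR t) => e *; nra.
have := cosh_dline_sqr (line p v t) fr'.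
have -> : <<val (line p v t), val p'>> ^+ 2 - <<val (line p v t), v'>> ^+ 2 =
    <<val p' + v', val (line p v t)>> * <<val p' - v', val (line p v t)>>.
  by rewrite !lor_lin !(lorC _ (val (line _ _ _))); clear; lor_atoms; ring.
rewrite line_null // !(lorDr (_ *: _)) !(lorZr _ _ (val p' + _)) -/a -/b -/a' -/b'.
have cC : cosh (dline p' v' (line p v t)) ^+ 2 <= cosh C ^+ 2.
  have C0 : 0 <= C by apply: le_trans Ct; apply: dline_ge0.
  by rewrite ler_sqr ?nnegrE ?(ltW (cosh_gt0 _)) // ler_cosh // dline_ge0.
have BE : B * (a * b) = 4 * cosh C ^+ 2 by rewrite /B divfK // lt0r_neq0.
have e1 := expR_gt0 t; have e2 := expR_gt0 (- t).
move=> c'E; clearbody a b a' b' B; clear -cC BE e1 e2 et n1 n2 m1 m2 ab c'E.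
move: (expR t) (expR (- t)) (cosh C ^+ 2) (cosh _ ^+ 2) cC BE e1 e2 et c'E.
move=> e f c c' cC BE e1 e2 et c'E.
have h1 : 0 <= a * b' by rewrite mulr_le0.
have h2 : 0 <= a' * b by rewrite mulr_le0.
have h3 : 0 <= a' * b' by rewrite mulr_le0.
have ef : 0 <= e * f by rewrite mulr_ge0 // ltW.
have k : B * (a * b) < e ^+ 2 * (a * b) by rewrite ltr_pM2r.
have := mulr_ge0 ef h1; have := mulr_ge0 ef h2; have := mulr_ge0 (sqr_ge0 f) h3.
by move: c'E k; rewrite BE !expr2 => *; lra.
Qed.

(** Vanishing pairings make the end vectors of the two lines proportional, with reciprocal factors
    at the two ends; a shift by the logarithm of the factor then matches the parametrizations. *)
Lemma line_unique p v p' v' (C : R) : frame p v -> frame p' v' ->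
  (forall T, exists2 t, T <= t & dline p' v' (line p v t) <= C) ->
  (forall T, exists2 t, t <= T & dline p' v' (line p v t) <= C) ->
  exists t0, (forall t, line p v t = line p' v' (t + t0)) \/
             (forall t, line p v t = line p' v' (- t + t0)).
Proof.
move=> fr fr' Hp Hm.
have Hm' T : exists2 t, T <= t & dline p' v' (line p (- v) t) <= C.
  have [t tT Ct] := Hm (- T); exists (- t); first by lra.
  by rewrite line_opp // opprK.
have same w : frame p' w -> <<val p' + w, val p + v>> = 0 ->
    <<val p' - w, val p - v>> = 0 ->
    exists t0, forall t, line p v t = line p' w (t + t0).
  move=> frw E1 E2.
  have F u w' : frame p u -> frame p' w' -> <<val p' + w', val p + u>> = 0 ->
      val p' + w' = - <<val p, val p' + w'>> *: (val p + u) /\ 0 < - <<val p, val p' + w'>>.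
    move=> fru frw' E; have lt := frame_null_future p frw'.
    have [_ H] := null_frame fru (frame_null frw') lt.
    by split; [exact: H|rewrite oppr_gt0].
  have [F1 mu0] := F _ _ fr frw E1.
  have [F2 nu0] := F _ _ (frame_opp fr) (frame_opp frw) E2.
  set mu := - <<val p, val p' + w>> in F1 mu0.
  set nu := - <<val p, val p' - w>> in F2 nu0.
  have munu : nu = mu^-1.
    have [pp pv vp vv] := frame_lor fr; have [pp' pv' vp' vv'] := frame_lor frw.
    have : <<val p' + w, val p' - w>> = <<mu *: (val p + v), nu *: (val p - v)>>.
      by rewrite -[in RHS]F1 -[in RHS]F2.
    rewrite !lor_lin pp pv vp vv pp' pv' vp' vv' => H.
    apply: (mulfI (lt0r_neq0 mu0)); rewrite divff ?lt0r_neq0 //.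
    by move: H; clear; move: mu nu => a b *; lra.
  exists (- ln mu) => t; apply: val_inj; rewrite !line_null // F1 F2 munu.
  have e1 : expR (t + - ln mu) = expR t / mu by rewrite expRD expRN lnK.
  have e2 : expR (- (t + - ln mu)) = mu * expR (- t).
    by rewrite opprB expRD lnK.
  rewrite e1 e2 !scalerA; move: (expR t) (expR (- t)) => e f.
  by congr (_ *: _ + _ *: _); field; rewrite lt0r_neq0.
have v'0 := frame_opp fr'.
(* Both ends of one line cannot be the same end of the other: [p] would be orthogonal to a future
   null vector. *)
have alt w : frame p' w -> <<val p' + w, val p + v>> = 0 -> <<val p' + w, val p - v>> = 0 -> False.
  move=> frw E1 E2; have := frame_null_future p frw; rewrite lorC.
  have -> : val p = 2^-1 *: ((val p + v) + (val p - v)).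
    by apply/matrixP => i j; rewrite !mxE; field.
  by rewrite lorZr lorDr E1 E2 addr0 mulr0 ltxx.
have H1 := line_dline_bounded fr fr' Hp.
have H2 := line_dline_bounded (frame_opp fr) fr' Hm'.
case: H1 H2 => E1 [] E2.
- by case: (alt _ fr' E1 E2).
- by have [t0 E] := same _ fr' E1 E2; exists t0; left.
- have [t0 E] := same _ v'0 E1 ltac:(by rewrite opprK).
  by exists (- t0); right => t; rewrite E line_opp // opprD.
- by case: (alt _ v'0 E1 E2).
Qed.

(** For suitable [n] the displacement over [n] steps has absolute value at least [S + 1], yet it
    changes by at most [2 S] from one index to the next. Its sign is therefore constant, and [t]
    drifts steadily one way. *)
Lemma coarse_monotone (t : int -> R) (K c S : R) : 0 < K -> 0 <= S ->
  (forall i, `|t (i + 1) - t i| <= S) ->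
  (forall (i : int) (n : nat), K^-1 * n%:R - c <= `|t (i + n%:Z) - t i|) ->
  (forall T, exists i, T <= t i) /\ (forall T, exists i, t i <= T).
Proof.
move=> K0 S0 step far.
pose n := (Num.truncn (K * (S + 1 + c))).+1.
have nS i : S + 1 <= `|t (i + n%:Z) - t i|.
  apply: le_trans (far i n); rewrite lerBrDr mulrC ler_pdivlMr // mulrC.
  exact/ltW/truncnS_gt.
pose s i := t (i + n%:Z) - t i.
have sE i : s (i + 1) = s i + (t (i + n%:Z + 1) - t (i + n%:Z)) - (t (i + 1) - t i).
  by rewrite /s (_ : i + 1 + n%:Z = i + n%:Z + 1); [ring|lia].
have pos i : (0 < s i) = (0 < s (i + 1)).
  have := nS i; have := nS (i + 1); have := step i; have := step (i + n%:Z).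
  rewrite -/(s i) -/(s (i + 1)) sE !ler_norml.
  move: (s i) (t (i + n%:Z + 1) - t (i + n%:Z)) (t (i + 1) - t i); clear -S0 => a b e.
  move=> /andP[? ?] /andP[? ?]; rewrite !ler_normr => /orP[] ? /orP[] ?; apply/idP/idP; lra.
have pos0 i : (0 < s i) = (0 < s 0).
  elim/int_rec: i => // m IH; first by rewrite -IH -addn1 PoszD -pos.
  by rewrite -IH pos; congr (_ < s _); lia.
have wlog0 (u : int -> R) : (forall i, u i + (S + 1) <= u (i + n%:Z)) ->
    (forall T, exists i, T <= u i) /\ (forall T, exists i, u i <= T).
  move=> H.
  have up (k : nat) : u 0 + k%:R <= u (k * n)%N%:Z.
    elim: k => [|k IH]; first by rewrite mul0n addr0.
    have := H (k * n)%N%:Z; rewrite -PoszD -mulSnr -natr1; clear -S0 IH; lra.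
  have dn (k : nat) : u (- (k * n)%N%:Z) <= u 0 - k%:R.
    elim: k => [|k IH]; first by rewrite mul0n oppr0 subr0.
    have := H (- (k.+1 * n)%N%:Z).
    rewrite (_ : - _ + n%:Z = - (k * n)%N%:Z); last by rewrite mulSnr PoszD; lia.
    by rewrite -natr1; clear -S0 IH; lra.
  split=> T.
    exists ((Num.truncn (T - u 0)).+1 * n)%N%:Z; apply: le_trans (up _).
    by have := truncnS_gt (T - u 0); lra.
  exists (- ((Num.truncn (u 0 - T)).+1 * n)%N%:Z); apply: le_trans (dn _) _.
  by have := truncnS_gt (u 0 - T); lra.
have [s0|s0] := ltP 0 (s 0).
  apply: wlog0 => i; have := nS i; rewrite -/(s i) gtr0_norm ?pos0 // /s; clear; lra.
have [i|H1 H2] := wlog0 (fun i => - t i).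
  have := nS i; rewrite -/(s i) ler0_norm; last by rewrite leNgt pos0 -leNgt.
  by rewrite /s; clear; lra.
split=> T; first by have [i Hi] := H2 (- T); exists i; lra.
by have [i Hi] := H1 (- T); exists i; lra.
Qed.

End Uniqueness.

(** * Axes of isometries and of shifted quasi-geodesics *)

Section Axes.
Local Open Scope classical_set_scope.
Variables (R : realType) (d : nat).
Local Notation "<< x , y >>" := (lor x y) (at level 0).
Implicit Types (x y z p q : hyp R d) (v w : 'rV[R]_d.+1) (f : Isom R d).

Definition translates f (g : R -> hyp R d) (tau : R) : Prop :=
  [/\ geodesic g, 0 < tau & forall t, f (g t) = g (t + tau)].

Lemma ler_archimedean (a b e : R) : (forall k : nat, k%:R * a <= b + k%:R * e) -> a <= e.
Proof.
move=> H; rewrite leNgt; apply/negP => ea; have ae : 0 < a - e by lra.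
have := H (Num.truncn (b / (a - e))).+1; have := truncnS_gt (b / (a - e)).
by rewrite ltr_pdivrMr //; move: (_.+1%:R) => k; clear; lra.
Qed.

Lemma iter_translates f g tau t k : translates f g tau ->
  iter k f (g t) = g (t + k%:R * tau).
Proof.
move=> [_ _ fg]; elim: k => [|k IH]; first by rewrite mul0r addr0.
by rewrite iterS IH fg -natr1 mulrDl mul1r addrA.
Qed.

Lemma dH_iter f x k : dH x (iter k f x) <= k%:R * dH x (f x).
Proof.
elim: k => [|k IH]; first by rewrite dHxx mul0r.
apply: le_trans (dH_triangle (f x) _ _) _.
by rewrite iterS dH_isom -natr1 mulrDl mul1r addrC lerD2r.
Qed.

Lemma dH_iter_isom f x y k : dH (iter k f x) (iter k f y) = dH x y.
Proof. by elim: k => //= k IH; rewrite dH_isom. Qed.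

(** The k-th power moves [x] by at most k times its displacement and moves [g 0] by k tau; these
    differ by at most twice the distance from [x] to [g 0], which is negligible for large k. *)
Lemma translates_le f g tau x : translates f g tau -> tau <= dH x (f x).
Proof.
move=> tr; have [/geodesic_dH geo tau0 _] := tr.
apply: (@ler_archimedean _ (2 * dH x (g 0))) => k.
have : dH (g 0) (iter k f (g 0)) = k%:R * tau.
  by rewrite (iter_translates _ _ tr) geo !add0r normrN ger0_norm // mulr_ge0 // ltW.
move=> <-; have := dH_triangle x (g 0) (iter k f (g 0)).
have := dH_triangle (iter k f x) x (iter k f (g 0)); rewrite dH_iter_isom (dHC (g 0) x).
have := dH_iter f x k.
move: (dH x (iter k f x)) (dH (g 0) (iter k f (g 0))) (dH x (iter k f (g 0))).
by move: (dH x (g 0)) (_ * dH x (f x)); clear => *; lra.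
Qed.

Lemma translation_lengthE f g tau : translates f g tau -> translation_length f = tau.
Proof.
move=> tr; have [/geodesic_dH geo tau0 fg] := tr; rewrite /translation_length.
have lb : lbound (range (fun o => hdist o (f o))) tau.
  by move=> _ [x _ <-]; rewrite -dHE; apply: translates_le tr.
apply/eqP; rewrite eq_le; apply/andP; split.
  apply: ge_inf; first by exists tau.
  exists (g 0) => //; rewrite -dHE fg geo !add0r normrN gtr0_norm //.
by apply: lb_le_inf => //; exists (hdist (g 0) (f (g 0))), (g 0).
Qed.

Lemma translates_hyperbolic f g tau : translates f g tau -> hyperbolic f.
Proof. by move=> tr; rewrite /hyperbolic (translation_lengthE tr); case: tr. Qed.

Lemma iter_isom_inv f g tau t k : translates f g tau ->
  iter k f (g (t - k%:R * tau)) = g t.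
Proof. by move=> tr; rewrite (iter_translates _ _ tr) subrK. Qed.

(** Powers of [f] carry the pair [g 0], [g' 0] along both lines at constant distance, arbitrarily
    far in both directions. *)
Lemma translates_unique f g tau g' tau' :
  translates f g tau -> translates f g' tau' -> range g = range g'.
Proof.
move=> tr tr'; have [geo tau0 _] := tr; have [geo' tau0' _] := tr'.
have [v fr gE] := geodesicP geo; have [v' fr' gE'] := geodesicP geo'.
have close t : (exists (k : nat), t = k%:R \/ t = - k%:R) ->
    dH (g (t * tau)) (g' (t * tau')) = dH (g 0) (g' 0).
  move=> [k [] ->].
    by rewrite -[g (_ * _)]/(g (k%:R * tau)) -(dH_iter_isom f (g 0) (g' 0) k)
      (iter_translates _ _ tr) (iter_translates _ _ tr') !add0r.
  rewrite -(dH_iter_isom f _ _ k) -[X in dH (iter k f (g X))]add0r.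
  by rewrite -[X in dH _ (iter k f (g' X))]add0r !mulNr (iter_isom_inv _ _ tr) (iter_isom_inv _ _ tr').
have dl t : (exists (k : nat), t = k%:R \/ t = - k%:R) ->
    dline (g' 0) v' (line (g 0) v (t * tau)) <= dH (g 0) (g' 0).
  move=> tk; rewrite -(close t tk) [in leRHS]gE [in X in _ <= dH _ X]gE'.
  exact: dline_le.
have [||t0 H] := @line_unique R d (g 0) v (g' 0) v' (dH (g 0) (g' 0)) fr fr'.
- move=> T; pose k := (Num.truncn (T / tau)).+1; exists (k%:R * tau).
    by rewrite -ler_pdivrMr // ltW // truncnS_gt.
  by apply: dl; exists k; left.
- move=> T; pose k := (Num.truncn (- T / tau)).+1; exists (- k%:R * tau).
    by rewrite mulNr -[leRHS]opprK lerN2 -ler_pdivrMr // ltW // truncnS_gt.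
  by apply: dl; exists k; right.
rewrite gE gE'; apply/seteqP; split=> _ [t _ <-]; case: H => H.
- by exists (t + t0) => //; rewrite H.
- by exists (- t + t0) => //; rewrite H.
- by exists (t - t0) => //; rewrite H subrK.
- by exists (t0 - t) => //; rewrite H; congr line; ring.
Qed.

Lemma AxisE f g tau : translates f g tau -> Axis f = range g.
Proof.
move=> tr; rewrite /Axis; apply: xget_unique.
  by have [geo tau0 fg] := tr; exists g => //; exists tau.
move=> L [g' [geo' ->] [tau' tau0' fg']].
by apply/esym/(translates_unique tr (_ : translates f g' tau')).
Qed.

(** The line followed by [q] and its image under [f] both follow [q], so they coincide, and [f] acts
    on the line by a shift or a reflection. Comparing iterates gives the lower bound on [tau]. *)
Lemma axis_of_shift (K c : R) : 0 < K -> 0 < c -> exists2 D, 0 <= D &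
  forall f (q : int -> hyp R d) (m : nat), (0 < m)%N -> qgeod K c q ->
    (forall i, f (q i) = q (i + m%:Z)) ->
    exists g tau, [/\ translates f g tau, m%:R / K <= tau &
      forall i, exists t, dH (q i) (g t) <= D].
Proof.
move=> K0 c0; have [D D0 HD] := @morse_line R d K c K0 c0.
exists D => // f q m m0 qg fq.
have [p [v [fr near]]] := HD q qg.
have iterq k : iter k f (q 0) = q (k * m)%N%:Z.
  elim: k => [|k IH]; first by rewrite mul0n.
  by rewrite iterS IH fq -PoszD mulSn addnC.
(* A fixed point of the square would keep the even iterates of [q 0] bounded. This excludes both a
   reflection of the line and a zero shift. *)
have noper x : iter 2 f x <> x.
  move=> f2x; have f2k k : iter (k * 2) f x = x.
    by elim: k => // k IH; rewrite mulSn iterD IH.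
  suff : K^-1 <= 0 by rewrite leNgt invr_gt0 K0.
  apply: (@ler_archimedean _ (2 * dH (q 0) x + c)) => k; rewrite mulr0 addr0.
  have /andP[low _] := qg 0 (k * 2 * m)%N; rewrite add0r -iterq in low.
  have := dH_triangle x (q 0) (iter (k * 2) f (q 0)).
  rewrite -{2}(f2k k) dH_iter_isom (dHC x) => tri.
  have : k%:R * K^-1 <= K^-1 * (k * 2 * m)%N%:R.
    by rewrite mulrC ler_pM2l ?invr_gt0 // ler_nat -mulnA leq_pmulr // muln_gt0.
  by move: low tri; clear; move: (dH _ _) (dH _ _) (_ * _) => *; lra.
have geof := geodesic_isom f (line_geodesic fr).
have [v' fr' E] := geodesicP geof; rewrite /= in fr' E.
rewrite line0 // in fr' E.
have near' i : dline (f p) v' (q i) <= D.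
  rewrite -(subrK m%:Z i) -fq; apply: le_trans (near (i - m%:Z)).
  rewrite [leRHS]dlineE -(dH_isom f).
  have -> : f (line p v (foot p v (q (i - m%:Z)))) = line (f p) v' (foot p v (q (i - m%:Z))).
    by rewrite -E.
  exact: dline_le.
pose t i := foot p v (q i).
have ft i j : `|dH (q i) (q j) - `|t i - t j| | <= 2 * D.
  have := near i; have := near j; rewrite !dlineE -/(t i) -/(t j).
  rewrite -(dH_line (t i) (t j) fr).
  have := dH_triangle (line p v (t i)) (q i) (q j).
  have := dH_triangle (line p v (t j)) (line p v (t i)) (q j).
  have := dH_triangle (q i) (line p v (t i)) (line p v (t j)).
  have := dH_triangle (q j) (q i) (line p v (t j)).
  rewrite (dHC (line p v (t i)) (q i)) (dHC (line p v (t j)) (q j)).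
  rewrite ler_norml; move: (dH _ _) (dH _ _) (dH _ _) (dH _ _) (dH _ _) (dH _ _); clear.
  by move=> *; apply/andP; split; lra.
(* The feet of the [q i] form a quasi-geodesic in the reals, hence run off to both ends of the
   line. *)
have [up dn] : (forall T, exists i, T <= t i) /\ (forall T, exists i, t i <= T).
  apply: (@coarse_monotone _ t K (c + 2 * D) (K + c + 2 * D)) => //.
  - by clear -K0 c0 D0; lra.
  - move=> i; have /andP[_] := qg i 1%N; rewrite mulr1 distrC.
    have := ft i (i + 1%N%:Z); rewrite ler_norml => /andP[].
    by move: (dH _ _) `|t _ - t _|; clear=> *; lra.
  - move=> i n; have /andP[+ _] := qg i n; rewrite distrC.
    have := ft i (i + n%:Z); rewrite ler_norml => /andP[].
    by move: (dH _ _) `|t _ - t _| (K^-1 * _); clear=> *; lra.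
have cl i : dline (f p) v' (line p v (t i)) <= D + D.
  apply: le_trans (dline_lip _ (q i) fr') _; rewrite dHC -dlineE.
  by rewrite lerD.
have [||t0 H] := @line_unique R d p v (f p) v' (D + D) fr fr'.
- by move=> T; have [i ti] := up T; exists (t i).
- by move=> T; have [i ti] := dn T; exists (t i).
have fl s : f (line p v s) = line (f p) v' s by rewrite -E.
have {H} H : exists t0, t0 != 0 /\ forall s, f (line p v s) = line p v (s + t0).
  have nofix s : f (line p v s) <> line p v s.
    by move=> E0; apply: (noper (line p v s)); rewrite /= !E0.
  case: H => H.
    exists (- t0); split=> [|s]; last by rewrite fl H subrK.
    by rewrite oppr_eq0; apply/eqP => z; apply: (nofix 0); rewrite fl H z addr0.
  have a : f (line p v 0) = line p v t0 by rewrite fl H addNr.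
  have b : f (line p v t0) = line p v 0 by rewrite fl H oppr0 add0r.
  by case: (noper (line p v 0)); rewrite /= a b.
move: t0 H => _ [t0 [t00 H]].
have [g [tau [tr sub]]] : exists g tau, translates f g tau /\ forall s, exists s', line p v s = g s'.
  have geo := line_geodesic fr; have [t0p|t0n] := ltP 0 t0.
    by exists (line p v), t0; split=> [|s]; [split|exists s].
  exists (fun s => line p v (- s)), (- t0); split=> [|s]; last by exists (- s); rewrite opprK.
  split; first exact: geodesic_opp.
    by rewrite oppr_gt0 lt_neqAle t00.
  by move=> s; rewrite H; congr line; ring.
exists g, tau; split=> //.
  have [/geodesic_dH geo tau0 _] := tr.
  apply: (@ler_archimedean _ (2 * dH (q 0) (g 0) + c)) => k.
  have /andP[low _] := qg 0 (k * m)%N; rewrite add0r -iterq in low.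
  have := dH_triangle (g 0) (q 0) (iter k f (q 0)).
  have := dH_triangle (iter k f (g 0)) (g 0) (iter k f (q 0)).
  rewrite dH_iter_isom (iter_translates _ _ tr) geo !add0r normrN.
  rewrite ger0_norm ?mulr_ge0 ?(ltW tau0) // (dHC (g 0) (q 0)).
  have -> : k%:R * (m%:R / K) = K^-1 * (k * m)%N%:R by rewrite natrM mulrA mulrC.
  move: low; move: (dH (q 0) (iter k f (q 0))) (dH (g 0) (iter k f (q 0))) (dH (q 0) (g 0)).
  by move: (_ * tau) (_ * _%:R); clear => *; lra.
by move=> i; have [s' E'] := sub (t i); exists s'; rewrite -E' -dlineE.
Qed.

End Axes.

(** * Isometries of positive translation length have axes *)

Section Hyperbolic.
Local Open Scope classical_set_scope.
Variables (R : realType) (d : nat).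
Local Notation "<< x , y >>" := (lor x y) (at level 0).
Implicit Types (x y z p q : hyp R d) (f : Isom R d).

(* In the triangle [x, f x, f (f x)] the midpoint of the first side is mapped to
   the midpoint of the second one, and these midpoints are at most half as far
   apart as [x] and [f (f x)]. *)
Lemma displacement_double f (l : R) : (forall y, l <= dH y (f y)) ->
  forall x, 2 * l <= dH x (f (f x)).
Proof.
move=> H x; set y := f x; set z := f y.
have xy := cosh_dH x y; have yz : dH y z = dH x y by rewrite dH_isom.
have xx := hyp_norm x; have yy := hyp_norm y.
pose C := cosh (dH x y); have C1 : 1 <= C by exact: cosh_ge1.
have Lxy : <<val x, val y>> = - C by rewrite /C xy opprK.
have Lyz : <<val y, val z>> = - C by rewrite lor_isom.
pose s := (Num.sqrt (2 + 2 * C))^-1.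
have C2 : 0 < 2 + 2 * C by clear -C1; lra.
have s0 : 0 < s by rewrite invr_gt0 sqrtr_gt0.
have ss : s * s * (2 + 2 * C) = 1.
  by rewrite -invfM -expr2 sqr_sqrtr ?ltW // mulVf // lt0r_neq0.
have CE : C = cosh (dH x y) by [].
clearbody s C.
have m1 : lor (s *: (val x + val y)) (s *: (val x + val y)) = - 1.
  rewrite !lor_lin (lorC (val y) (val x)) xx yy Lxy.
  by move: ss; clear=> *; lra.
pose m := hyp_of x (s *: (val x + val y)).
have mE : val m = s *: (val x + val y).
  by apply: val_hyp_of => //; rewrite !lor_lin xx Lxy; clear -s0 C1; nra.
have zz := hyp_norm z.
have m2 : lor (s *: (val y + val z)) (s *: (val y + val z)) = - 1.
  rewrite !lor_lin (lorC (val z) (val y)) zz yy Lyz.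
  by move: ss; clear=> *; lra.
pose m' := hyp_of y (s *: (val y + val z)).
have mE' : val m' = s *: (val y + val z).
  by apply: val_hyp_of => //; rewrite !lor_lin yy Lyz; clear -s0 C1; nra.
have fm : f m = m'.
  apply: lor_hyp_eq; rewrite mE' !lor_lin /y /z !lor_isom mE !lor_lin -/y.
  rewrite xx yy (lorC (val y) (val x)) Lxy.
  by move: ss; clear=> *; lra.
have E1 : dH m (f m) <= dH x z / 2.
  have xz0 := dH_ge0 x z.
  rewrite -ler_cosh ?dH_ge0 ?divr_ge0 // cosh_dH fm mE mE' !lor_lin yy Lxy Lyz.
  have xz : <<val x, val z>> = - cosh (dH x z / 2 + dH x z / 2).
    by rewrite -splitr cosh_dH opprK.
  rewrite xz coshD -!expr2.
  have D1 : cosh (dH x z / 2) <= C.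
    rewrite CE ler_cosh ?divr_ge0 ?dH_ge0 // ler_pdivrMr // mulrC.
    by have := dH_triangle y x z; rewrite yz; clear; move: (dH _ _) (dH _ _) => *; lra.
  have := cosh2 (dH x z / 2); have := cosh_ge1 (dH x z / 2); move: D1 ss C1 s0.
  clear; move: (cosh _) (sinh _) => c S cC ss C1 s0 c1 cS.
  have {}cS : S ^+ 2 = c ^+ 2 - 1 by rewrite cS; ring.
  rewrite cS; have : s * s * (2 + 2 * c) <= 1 by rewrite -[leRHS]ss ler_pM2l ?mulr_gt0 //; lra.
  move=> H'; have : s * s * (2 + 2 * c) * (c - 1) <= 1 * (c - 1).
    by apply: ler_wpM2r => //; lra.
  by move: ss; rewrite !expr2 => *; lra.
by have := H m; move: E1; clear; move: (dH _ _) (dH _ _) => *; lra.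
Qed.

Lemma displacement_pow2 k f (l : R) : (forall y, l <= dH y (f y)) ->
  forall x, (2 ^ k)%N%:R * l <= dH x (iter (2 ^ k) f x).
Proof.
elim: k f l => [|k IH] f l H x; first by rewrite expn0 mul1r /=.
have := IH (f * f)%g (2 * l) (displacement_double H) x.
have -> : iter (2 ^ k) (f * f)%g x = iter (2 ^ k.+1) f x.
  rewrite expnS mulnC; elim: (2 ^ k)%N => // n IHn.
  by rewrite iterS IHn mulSn.
by rewrite expnS natrM mulrA [2 * _]mulrC.
Qed.

(** Doubling settles the powers of two. A deficit at another exponent would accumulate when a large
    power of two is divided by that exponent with remainder. *)
Lemma displacement_iter f (l : R) : 0 <= l -> (forall y, l <= dH y (f y)) ->
  forall n x, n%:R * l <= dH x (iter n f x).
Proof.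
move=> l0 H [|n] x; first by rewrite mul0r dH_ge0.
set a := dH _ _; rewrite leNgt; apply/negP => lt.
suff : n.+1%:R * l <= a by rewrite leNgt lt.
apply: (@ler_archimedean _ _ (n.+1%:R * dH x (f x))) => j.
(* This power of two is large enough for the quotient by [n.+1] to be at least [j]. *)
pose N := (2 ^ (j * n.+1))%N; pose q := (N %/ n.+1)%N; pose r := (N %% n.+1)%N.
have jq : (j <= q)%N by rewrite leq_divRL // ltnW // ltn_expl.
have up k r' : dH x (iter (k * n.+1 + r') f x) <= k%:R * a + r'%:R * dH x (f x).
  elim: k => [|k IH]; first by rewrite mul0n add0n mul0r add0r dH_iter.
  rewrite mulSn -addnA iterD; apply: le_trans (dH_triangle (iter n.+1 f x) _ _) _.
  by rewrite dH_iter_isom -natr1 mulrDl mul1r [_ + a]addrC -addrA lerD2l.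
have := displacement_pow2 (j * n.+1) H x; rewrite -/N.
have := up q r; rewrite -divn_eq => U L.
have rn : r%:R * dH x (f x) <= n.+1%:R * dH x (f x).
  by rewrite ler_wpM2r ?dH_ge0 // ler_nat ltnW // ltn_mod.
have qN : q%:R * (n.+1%:R * l) <= N%:R * l.
  by rewrite mulrA -natrM ler_wpM2r // ler_nat leq_divM.
have jq' : j%:R * (n.+1%:R * l - a) <= q%:R * (n.+1%:R * l - a).
  by rewrite ler_wpM2r ?ler_nat // subr_ge0 ltW.
have T := le_trans L U.
move: rn qN jq' T; move: (r%:R * _) (n.+1%:R * dH _ _) (N%:R * l) (n.+1%:R * l).
clearbody a; clear; move: (j%:R) (q%:R) => *; lra.
Qed.

Lemma hyperbolic_translates f : hyperbolic f -> exists g tau, translates f g tau.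
Proof.
rewrite /hyperbolic; set l := translation_length f => l0.
have H y : l <= dH y (f y).
  rewrite dHE; apply: ge_inf; last by exists y.
  by exists 0 => _ [x _ <-]; rewrite -dHE dH_ge0.
pose x := hyp_origin R d; pose D := dH x (f x).
have D0 : 0 <= D by exact: dH_ge0.
(* One constant serves both sides: [K] exceeds the displacement of [x], and [K^-1] is at most
   [l]. *)
pose K := D + l^-1.
have li0 : 0 < l^-1 by rewrite invr_gt0.
have K0 : 0 < K by rewrite /K; clear -D0 li0; lra.
have [B B0 HB] := @axis_of_shift R d K 1 K0 ltr01.
pose q i := zexp f i x.
have fq i : f (q i) = q (i + 1) by rewrite /q zexpS.
have qn i n : q (i + n%:Z) = zexp f i (iter n f x).
  elim: n => [|n IH]; first by rewrite addr0.
  rewrite (_ : i + n.+1%:Z = i + n%:Z + 1); last by lia.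
  have E : (f * zexp f i)%g = (zexp f i * f)%g by rewrite -zexpS zexpSr.
  by rewrite -fq IH; exact: (congr1 (fun h : Isom R d => h (iter n f x)) E).
have [||g [tau [tr _ _]]] := HB f q 1%N isT.
- move=> i n; rewrite qn dH_isom.
  have low := displacement_iter (ltW l0) H n x; have up := dH_iter f x n.
  have n0 : 0 <= n%:R :> R by [].
  have Kl : K^-1 <= l by rewrite -[l]invrK lef_pV2 ?posrE // /K; clear -D0; lra.
  have DK : D <= K by rewrite /K; clear -li0; lra.
  apply/andP; split.
    have : K^-1 * n%:R <= n%:R * l by rewrite mulrC ler_wpM2l.
    by move: low; clear; move: (dH _ _) (_ * _) (_ * _) => *; lra.
  have : n%:R * dH x (f x) <= K * n%:R by rewrite mulrC ler_wpM2r.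
  by move: up; clear; move: (dH x (iter _ _ _)) (_ * _) (_ * _) => *; lra.
- exact: fq.
by exists g, tau.
Qed.

End Hyperbolic.

(** * Common perpendiculars of lines without common ends *)

Section Perpendiculars.
Local Open Scope classical_set_scope.
Variables (R : realType) (d : nat).
Local Notation "<< x , y >>" := (lor x y) (at level 0).
Implicit Types (x y z p q : hyp R d) (u v w N : 'rV[R]_d.+1).

(** The velocity of [line p v] at time [t]. *)
Definition slide p v (t : R) : 'rV[R]_d.+1 := sinh t *: val p + cosh t *: v.

Lemma slideP p v t : frame p v ->
  [/\ frame (line p v t) (slide p v t),
      forall s, line (line p v t) (slide p v t) s = line p v (s + t),
      val (line p v t) + slide p v t = expR t *: (val p + v) &
      val (line p v t) - slide p v t = expR (- t) *: (val p - v)].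
Proof.
move=> fr; have [pp pv vp vv] := frame_lor fr; have c2 := cosh2 t.
have fr' : frame (line p v t) (slide p v t).
  rewrite /frame val_line // /slide !lor_lin pp pv vp vv.
  by move: c2; move: (cosh t) (sinh t) => c s; clear=> *; split; lra.
split=> // [s||].
- apply: val_inj; rewrite val_line // /slide !val_line // coshD sinhD.
  by apply/matrixP => i j; rewrite !mxE; ring.
- by rewrite val_line // /slide expR_cosh; apply/matrixP => i j; rewrite !mxE; ring.
- by rewrite val_line // /slide expRN_cosh; apply/matrixP => i j; rewrite !mxE; ring.
Qed.

Lemma range_slide p v t : frame p v ->
  range (line (line p v t) (slide p v t)) = range (line p v).
Proof.
move=> fr; have [_ E _ _] := slideP t fr.
apply/seteqP; split=> _ [s _ <-]; first by exists (s + t).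
by exists (s - t) => //; rewrite E subrK.
Qed.

Lemma orthogonal_lines p u v : frame p u -> frame p v -> <<u, v>> = 0 ->
  perpendicular (range (line p u)) (range (line p v)) /\
  range (line p u) `&` range (line p v) = [set p].
Proof.
move=> fu fv uv; split.
  exists (line p u), (line p v); split; first by split=> //; exact: line_geodesic.
  by rewrite !line0 // !velocity_line // -lorE.
apply/seteqP; split=> [z [[s _ <-] [t _ E]]|_ ->]; last first.
  by split; exists 0; rewrite ?line0.
have [pp pv vp vv] := frame_lor fv.
have /(congr1 (fun z => <<val z, v>>)) := E.
rewrite !val_line // !lor_lin pv uv vv !mulr0 !add0r mulr1 => /sinh_eq0 t0.
by rewrite -E t0 line0.
Qed.

Lemma frame_null_le0 p v q w : frame p v -> frame q w -> <<val p + v, val q + w>> <= 0.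
Proof.
move=> fr fr'; have [] := null_frame fr' (frame_null fr) _ => //.
exact: frame_null_future.
Qed.

(** Pairings of future null vectors are nonpositive and vanish only for proportional ones, so this
    says that the lines share no end at infinity. *)
Definition apart p v q w : Prop :=
  [/\ <<val p + v, val q + w>> < 0, <<val p + v, val q - w>> < 0,
      <<val p - v, val q + w>> < 0 & <<val p - v, val q - w>> < 0].

(** Sliding the base points multiplies the four pairings of ends by exponentials of s + t, s - t and
    their opposites. Balancing the two opposite pairs gives the critical point of the distance; [X]
    and [Y] are s + t and s - t there. *)
Lemma closest_points p v q w : frame p v -> frame q w -> apart p v q w ->
  exists s t, [/\ apart (line p v s) (slide p v s) (line q w t) (slide q w t),
    <<val (line p v s), slide q w t>> = 0 & <<val (line q w t), slide p v s>> = 0].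
Proof.
move=> fp fq [a0 b0 c0 e0].
set a := <<_, _>> in a0; set b := <<_, _>> in b0.
set c := <<_, _>> in c0; set e := <<_, _>> in e0.
pose X := ln (e / a) / 2; pose Y := ln (c / b) / 2.
have ea : 0 < e / a by rewrite ltr_ndivlMr // mul0r.
have cb : 0 < c / b by rewrite ltr_ndivlMr // mul0r.
have XE : expR X * expR X = e / a by rewrite -expRD -splitr lnK.
have YE : expR Y * expR Y = c / b by rewrite -expRD -splitr lnK.
pose s := (X + Y) / 2; pose t := (X - Y) / 2.
exists s, t.
have [fs _ s1 s2] := slideP s fp; have [ft _ t1 t2] := slideP t fq.
have A1 : <<val (line p v s) + slide p v s, val (line q w t) + slide q w t>> = expR X * a.
  by rewrite s1 t1 lorZl lorZr mulrA -expRD -/a; congr (expR _ * _); rewrite /s /t; field.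
have B1 : <<val (line p v s) + slide p v s, val (line q w t) - slide q w t>> = expR Y * b.
  by rewrite s1 t2 lorZl lorZr mulrA -expRD -/b; congr (expR _ * _); rewrite /s /t; field.
have C1 : <<val (line p v s) - slide p v s, val (line q w t) + slide q w t>> = expR (- Y) * c.
  by rewrite s2 t1 lorZl lorZr mulrA -expRD -/c; congr (expR _ * _); rewrite /s /t; field.
have E1 : <<val (line p v s) - slide p v s, val (line q w t) - slide q w t>> = expR (- X) * e.
  by rewrite s2 t2 lorZl lorZr mulrA -expRD -/e; congr (expR _ * _); rewrite /s /t; field.
have AE : expR X * a = expR (- X) * e.
  apply: (mulfI (lt0r_neq0 (expR_gt0 X))); rewrite !mulrA XE expRxMexpNx_1 mul1r divfK //.
  by rewrite lt_eqF.
have BC : expR Y * b = expR (- Y) * c.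
  apply: (mulfI (lt0r_neq0 (expR_gt0 Y))); rewrite !mulrA YE expRxMexpNx_1 mul1r divfK //.
  by rewrite lt_eqF.
split.
- by rewrite /apart A1 B1 C1 E1 !pmulr_rlt0 ?expR_gt0.
- rewrite AE in A1; rewrite BC in B1; move: A1 B1 C1 E1; clear.
  move: (slide p v s) (slide q w t) (val (line p v s)) (val (line q w t)) => u z x y.
  rewrite !lor_lin; lor_atoms.
  by move: (expR (- X) * _) (expR (- Y) * _) => *; lra.
- rewrite AE in A1; rewrite BC in B1; move: A1 B1 C1 E1; clear.
  move: (slide p v s) (slide q w t) (val (line p v s)) (val (line q w t)) => u z x y.
  rewrite !lor_lin (lorC u y); lor_atoms.
  by move: (expR (- X) * _) (expR (- Y) * _) => *; lra.
Qed.

(** Three linear conditions on a space of dimension at least four; the column [J x] represents the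
    pairing with [x]. *)
Lemma orthogonal_vector (x1 x2 x3 : 'rV[R]_d.+1) : (3 <= d)%N ->
  exists n : 'rV[R]_d.+1, [/\ n != 0, <<x1, n>> = 0, <<x2, n>> = 0 & <<x3, n>> = 0].
Proof.
move=> d3.
pose J (x : 'rV[R]_d.+1) : 'cV[R]_d.+1 :=
  \col_j (if j == ord0 then - x ord0 ord0 else x ord0 j).
have JE (x n : 'rV[R]_d.+1) : <<x, n>> = (n *m J x) ord0 ord0.
  rewrite lorE /lorentz !mxE big_ord_recl !mxE eqxx mulrN mulrC; congr (_ + _).
  by apply: eq_bigr => i _; rewrite !mxE mulrC.
pose M := row_mx (row_mx (J x1) (J x2)) (J x3).
have : kermx M != 0.
  rewrite -mxrank_eq0 mxrank_ker -lt0n subn_gt0.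
  by apply: leq_ltn_trans (rank_leq_col M) _.
rewrite -nz_row_eq0 => n0; exists (nz_row (kermx M)).
have : nz_row (kermx M) *m M = 0 by apply/sub_kermxP/nz_row_sub.
set n := nz_row _ in n0 *; rewrite /M !mul_mx_row => E.
have E3 : n *m J x3 = 0 by rewrite -(row_mxKr (row_mx (n *m J x1) (n *m J x2)) (n *m J x3)) E linear0.
have E12 : row_mx (n *m J x1) (n *m J x2) = 0.
  by rewrite -(row_mxKl (row_mx (n *m J x1) (n *m J x2)) (n *m J x3)) E linear0.
have E1 : n *m J x1 = 0 by rewrite -(row_mxKl (n *m J x1) (n *m J x2)) E12 linear0.
have E2 : n *m J x2 = 0 by rewrite -(row_mxKr (n *m J x1) (n *m J x2)) E12 linear0.
by split=> //; rewrite JE ?E1 ?E2 ?E3 mxE.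
Qed.

(** Between balanced lines the cosh of the distance combines cosh (s + t) and cosh (s - t) with
    positive coefficients of sum at least one, so it equals one only at s = t = 0. *)
Lemma apart_meet p v q w s t : frame p v -> frame q w -> apart p v q w ->
  <<val p, w>> = 0 -> <<val q, v>> = 0 -> line p v s = line q w t ->
  p = q /\ s = 0.
Proof.
move=> fp fq [a0 b0 c0 e0] pw qv E.
have G : cosh (dH (line p v s) (line q w t)) = (- <<val p + v, val q + w>> * cosh (s + t)
    + - <<val p + v, val q - w>> * cosh (s - t)) / 2.
  rewrite cosh_dH !val_line // coshD coshB !lor_lin pw (lorC v (val q)) qv.
  by clear; lor_atoms; move: (cosh s) (cosh t) (sinh s) (sinh t) => *; field.
rewrite -E dHxx cosh0 in G.
have c1 := cosh_ge1 (s + t); have c2 := cosh_ge1 (s - t); have pq := lor_hyp p q.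
rewrite !lor_lin pw (lorC v (val q)) qv in a0 b0 G.
have [st st'] : cosh (s + t) = 1 /\ cosh (s - t) = 1.
  move: a0 b0 G c1 c2 pq; move: (cosh (s + t)) (cosh (s - t)); clear; lor_atoms => *.
  by split; nra.
have pq' : <<val p, val q>> = - 1.
  by move: G; rewrite st st'; clear; lor_atoms => *; lra.
split; first exact: lor_hyp_eq.
have z (x : R) : cosh x = 1 -> x = 0.
  move=> cx; apply: sinh_eq0; apply/eqP; rewrite -sqrf_eq0; apply/eqP.
  by have := cosh2 x; rewrite cx expr1n; clear; lra.
by have := z _ st; have := z _ st'; clear; lra.
Qed.

Lemma common_perpendicular_exists p v q w : (3 <= d)%N ->
  frame p v -> frame q w -> apart p v q w ->
  exists H o1 o2, [/\ common_perpendicular (range (line p v)) (range (line q w)) H,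
    H `&` range (line p v) = [set o1] & H `&` range (line q w) = [set o2]].
Proof.
move=> d3 fp0 fq0 ap0.
have [s [t [ap pw qv]]] := closest_points fp0 fq0 ap0.
have [fp _ _ _] := slideP s fp0; have [fq _ _ _] := slideP t fq0.
rewrite -(range_slide s fp0) -(range_slide t fq0).
move: (line p v s) (slide p v s) (line q w t) (slide q w t) fp fq ap pw qv.
move=> {fp0 fq0 ap0 s t} {}p {}v {}q {}w fp fq ap pw qv.
have [qq qw wq ww] := frame_lor fq; have [pp pv vp vv] := frame_lor fp.
(* Distinct critical points are joined by a line orthogonal to both given lines, which do not meet
   by [apart_meet]. *)
have [pq|pq] := pselect (p = q); last first.
  have fh := frame_direction pq.
  have [fh' _ _ _] := slideP (dH p q) fh.
  rewrite line_direction // in fh'.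
  have dv : <<direction p q, v>> = 0 by rewrite /direction !lor_lin qv pv; ring.
  have dw : <<slide p (direction p q) (dH p q), w>> = 0.
    by rewrite /slide /direction !lor_lin qw pw; ring.
  have [P1 I1] := orthogonal_lines fh fp dv; have [P2 I2] := orthogonal_lines fh' fq dw.
  have := range_slide (dH p q) fh; rewrite line_direction // => RE.
  rewrite RE in P2 I2.
  exists (range (line p (direction p q))), p, q; split=> //; split=> // z [[s _ <-] [t _ E]].
  by case: pq; have [] := apart_meet fp fq ap pw qv (esym E).
(* For crossing lines, dimension at least three leaves a direction at [p] normal to both. *)
subst q; have [n [n0 pn vn wn]] := orthogonal_vector (val p) v w d3.
have nn : 0 < <<n, n>>.
  rewrite lt_neqAle (lor_orth_ge0 pp pn) andbT eq_sym; apply/eqP => nn.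
  by case/eqP: n0; apply: lor_orth_eq0 pp pn nn.
pose k := (Num.sqrt <<n, n>>)^-1.
have kk : k * (k * <<n, n>>) = 1.
  by rewrite mulrA /k -invfM -expr2 sqr_sqrtr ?(ltW nn) // mulVf // lt0r_neq0.
have fn : frame p (k *: n) by split; rewrite !lor_lin ?pn ?mulr0.
have [P1 I1] : perpendicular (range (line p (k *: n))) (range (line p v)) /\
    range (line p (k *: n)) `&` range (line p v) = [set p].
  by apply: orthogonal_lines => //; rewrite lorZl lorC vn mulr0.
have [P2 I2] : perpendicular (range (line p (k *: n))) (range (line p w)) /\
    range (line p (k *: n)) `&` range (line p w) = [set p].
  by apply: orthogonal_lines => //; rewrite lorZl lorC wn mulr0.
exists (range (line p (k *: n))), p, p; split=> //; split=> // z [[s _ <-] [t _ E]].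
have [_ ->] := apart_meet fp fq ap pw qv (esym E).
by rewrite line0 //; exists 0 => //; rewrite line0.
Qed.

End Perpendiculars.

(** * Irreducibility, fixed ends and base points *)

Section Representations.
Local Open Scope classical_set_scope.
Variables (R : realType) (d : nat).
Local Notation "<< x , y >>" := (lor x y) (at level 0).
Implicit Types (x y z : hyp R d) (v w : 'rV[R]_d.+1) (rho : representation R d).

Lemma rep1 rho x : rho 1%g x = x.
Proof.
by have -> : rho 1%g = 1%g by apply: (mulgI (rho 1%g)); rewrite -gmulfM !mulg1.
Qed.

Lemma repM rho (u v : F2) x : rho (u * v)%g x = rho u (rho v x).
Proof. by rewrite gmulfM. Qed.

Lemma repVK rho (u : F2) x : rho u (rho u^-1%g x) = x.
Proof. by rewrite -repM mulgV rep1. Qed.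

Lemma asymptotic_dH (r r' : R -> hyp R d) : asymptotic r r' <->
  exists C, forall t, 0 <= t -> dH (r t) (r' t) <= C.
Proof. by split=> [][C H]; exists C => t t0; have := H t t0; rewrite dHE. Qed.

Lemma generated_asymptotic rho (x y : F2) (r : R -> hyp R d) : generating_pair x y ->
  asymptotic (fun t => rho x (r t)) r -> asymptotic (fun t => rho y (r t)) r ->
  forall u, asymptotic (fun t => rho u (r t)) r.
Proof.
move=> /generating_pairP gxy rx ry u; move: u; apply: gxy => //.
- by apply/asymptotic_dH; exists 0 => t _; rewrite rep1 dHxx.
- move=> u v /asymptotic_dH[C HC] /asymptotic_dH[C' HC'].
  apply/asymptotic_dH; exists (C' + C) => t t0; rewrite repM.
  by apply: le_trans (dH_triangle (rho u (r t)) _ _) _; rewrite dH_isom lerD ?HC ?HC'.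
- move=> u /asymptotic_dH[C HC]; apply/asymptotic_dH; exists C => t t0.
  by rewrite -(dH_isom (rho u)) repVK dHC HC.
Qed.

Lemma dH_le_cosh x y (B : R) : - <<val x, val y>> <= B -> dH x y <= 2 * B.
Proof.
move=> H; have := cosh_ge_half (dH_ge0 x y); rewrite cosh_dH.
by move: H; clear; lor_atoms; move: (dH _ _) => *; lra.
Qed.

(** In the expansion of the cosh of the distance the pairing that vanishes is the coefficient of exp
    (2 t); the other terms are bounded for positive t. *)
Lemma common_end_asymptotic x v y w : frame x v -> frame y w ->
  <<val x + v, val y + w>> = 0 -> asymptotic (line x v) (line y w).
Proof.
move=> fx fy E0; apply/asymptotic_dH.
have a0 := frame_null_le0 fx (frame_opp fy).
have b0 := frame_null_le0 (frame_opp fx) fy.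
have c0 := frame_null_le0 (frame_opp fx) (frame_opp fy).
set a := <<_, _>> in a0; set b := <<_, _>> in b0; set c := <<_, _>> in c0.
exists (2 * ((- a - b - c) / 4)) => t t0; apply: dH_le_cosh.
rewrite !line_null // lorDl !lorDr !lorZl !lorZr E0 -/a -/b -/c.
have e0 := expR_gt0 (- t); have e1 : expR (- t) <= 1 by rewrite -expR0 ler_expR oppr_le0.
have ee := expRxMexpNx_1 t.
move: a0 b0 c0 e0 e1 ee; move: (expR t) (expR (- t)) a b c; clear => e f a b c a0 b0 c0 f0 f1 ef.
have ff : f * f <= 1 by clear -f0 f1; nra.
have -> : - (e / 2 * (e / 2 * 0) + e / 2 * (f / 2 * a) + (f / 2 * (e / 2 * b) + f / 2 * (f / 2 * c)))
  = (e * f) * (- a - b) / 4 + (f * f) * (- c) / 4 by field.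
by rewrite ef; nra.
Qed.

(** A common end would be fixed by [u1] and [u2], hence by the group they generate. *)
Lemma irreducible_ends rho (u1 u2 : F2) x1 v1 x2 v2 (t1 t2 : R) :
  irreducible rho -> generating_pair u1 u2 ->
  frame x1 v1 -> frame x2 v2 ->
  (forall t, rho u1 (line x1 v1 t) = line x1 v1 (t + t1)) ->
  (forall t, rho u2 (line x2 v2 t) = line x2 v2 (t + t2)) ->
  <<val x1 + v1, val x2 + v2>> < 0.
Proof.
move=> irr gen f1 f2 tr1 tr2; rewrite lt_neqAle frame_null_le0 // andbT.
apply/eqP => E0; apply: irr; exists (line x1 v1).
  by move=> s t _ _; apply: line_geodesic.
have tau x v (f : Isom R d) t' : frame x v -> (forall t, f (line x v t) = line x v (t + t')) ->
    forall t, dH (f (line x v t)) (line x v t) = `|t'|.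
  by move=> fr H t; rewrite H dH_line // [t + t']addrC addrK.
apply: (generated_asymptotic gen); apply/asymptotic_dH.
  by exists `|t1| => t _; rewrite (tau _ _ _ _ f1 tr1).
have /asymptotic_dH[C HC] := common_end_asymptotic f1 f2 E0.
exists (C + (`|t2| + C)) => t t0.
apply: le_trans (dH_triangle (rho u2 (line x2 v2 t)) _ _) _.
rewrite dH_isom lerD ?HC //.
apply: le_trans (dH_triangle (line x2 v2 t) _ _) _.
by rewrite (tau _ _ _ _ f2 tr2) lerD2l dHC HC.
Qed.

Lemma irreducible_apart rho (u1 u2 : F2) x1 v1 x2 v2 (t1 t2 : R) :
  irreducible rho -> generating_pair u1 u2 ->
  frame x1 v1 -> frame x2 v2 ->
  (forall t, rho u1 (line x1 v1 t) = line x1 v1 (t + t1)) ->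
  (forall t, rho u2 (line x2 v2 t) = line x2 v2 (t + t2)) ->
  apart x1 v1 x2 v2.
Proof.
move=> irr gen f1 f2 tr1 tr2.
have opp x v (f : Isom R d) t' : frame x v -> (forall t, f (line x v t) = line x v (t + t')) ->
    forall t, f (line x (- v) t) = line x (- v) (t - t').
  by move=> fr H t; rewrite !line_opp // H; congr line; ring.
have tr1' := opp _ _ _ _ f1 tr1; have tr2' := opp _ _ _ _ f2 tr2.
have f1' := frame_opp f1; have f2' := frame_opp f2.
by split; [exact: (irreducible_ends irr gen f1 f2 tr1 tr2)
  |exact: (irreducible_ends irr gen f1 f2' tr1 tr2')
  |exact: (irreducible_ends irr gen f1' f2 tr1' tr2)
  |exact: (irreducible_ends irr gen f1' f2' tr1' tr2')].
Qed.

Lemma feet_exist rho (u1 u2 : F2) : (3 <= d)%N -> irreducible rho ->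
  primitive_hyperbolic rho -> generating_pair u1 u2 ->
  (exists o, foot_of_perpendicular (Axis (rho u1)) (Axis (rho u2)) (Axis (rho u1)) o) /\
  (exists o, foot_of_perpendicular (Axis (rho u1)) (Axis (rho u2)) (Axis (rho u2)) o).
Proof.
move=> d3 irr prim gen.
have [g1 [t1 tr1]] : exists g tau, translates (rho u1) g tau.
  by apply/hyperbolic_translates/prim; exists u2.
have [g2 [t2 tr2]] : exists g tau, translates (rho u2) g tau.
  by apply/hyperbolic_translates/prim; exists u1; apply: generating_swap.
rewrite (AxisE tr1) (AxisE tr2).
have [geo1 _ fg1] := tr1; have [geo2 _ fg2] := tr2.
have [v1 fr1 g1E] := geodesicP geo1; have [v2 fr2 g2E] := geodesicP geo2.
rewrite g1E in fg1; rewrite g2E in fg2.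
rewrite g1E g2E.
have ap := irreducible_apart irr gen fr1 fr2 fg1 fg2.
have [H [c1 [c2 [HP H1 H2]]]] := common_perpendicular_exists d3 fr1 fr2 ap.
by split; [exists c1; exists H|exists c2; exists H].
Qed.

Lemma generating_a_ab : generating_pair gen_a (gen_a * gen_b)%g.
Proof.
have := generating_mul (generating_inv (generating_swap (generating_inv generating_ab))).
move=> /generating_inv/generating_swap/generating_inv.
by rewrite invgM !invgK.
Qed.

Lemma generating_b_ab : generating_pair gen_b (gen_a * gen_b)%g.
Proof. exact: generating_swap (generating_mul generating_ab). Qed.

Lemma base_point_exists rho (X : pal_type) : (3 <= d)%N -> irreducible rho ->
  primitive_hyperbolic rho -> exists o, base_point rho X o.
Proof.
move=> d3 irr prim; rewrite /base_point -gmulfM; case: X.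
- by have [] := feet_exist d3 irr prim generating_a_ab.
- by have [] := feet_exist d3 irr prim generating_ab.
- by have [] := feet_exist d3 irr prim generating_b_ab.
Qed.

(* Euclid's algorithm: replacing [x] by [x y] or [x y^-1] decreases
   [|b x| + |b y|] by at least [eps]. *)
Lemma no_bounded_below_hom (b : F2 -> R) (eps : R) : 0 < eps ->
  (forall u u' : F2, b (u * u')%g = b u + b u') ->
  (forall u : F2, primitive u -> eps <= `|b u|) -> False.
Proof.
move=> e0 bM be.
have b1 : b 1%g = 0 by have := bM 1%g 1%g; rewrite mulg1; lra.
have bV u : b u^-1%g = - b u by have := bM u u^-1%g; rewrite mulgV b1; lra.
have key n : forall x y : F2, generating_pair x y -> n%:R * eps <= `|b x| + `|b y|.
  elim: n => [|n IH] x y gxy; first by rewrite mul0r addr_ge0.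
  wlog xy : x y gxy / `|b y| <= `|b x|.
    move=> W; have [|/ltW] := leP `|b y| `|b x|; first exact: W.
    by rewrite addrC; apply: W; apply: generating_swap.
  have py : eps <= `|b y| by apply: be; exists x; apply: generating_swap.
  have := IH _ _ (generating_mul gxy).
  have := IH _ _ (generating_mul (generating_swap (generating_inv (generating_swap gxy)))).
  rewrite !bM bV normrN -natr1 mulrDl mul1r.
  move: xy py; case: (ger0P (b x)) => bx; case: (ger0P (b y)) => by_ xy py;
    case: (ger0P (b x + - b y)) => h1; case: (ger0P (b x + b y)) => h2; 
    move: (_ * eps) => k; lra.
suff : eps <= 0 by rewrite leNgt e0.
apply: (@ler_archimedean _ _ (`|b gen_a| + `|b gen_b|)) => k.
by rewrite mulr0 addr0; apply: key generating_ab.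
Qed.

(** A nonzero coefficient of exp (2 t) in the cosh of the distance would make the distance
    unbounded. *)
Lemma lor_line_cosh x v y w (C : R) : frame x v -> frame y w ->
  (forall t, 0 <= t -> dH (line x v t) (line y w t) <= C) ->
  <<val x + v, val y + w>> = 0.
Proof.
move=> fx fy H.
have n0 := frame_null_le0 fx fy.
have a0 := frame_null_le0 fx (frame_opp fy).
have b0 := frame_null_le0 (frame_opp fx) fy.
have c0 := frame_null_le0 (frame_opp fx) (frame_opp fy).
set n := <<_, _>> in n0 *; set a := <<_, _>> in a0; set b := <<_, _>> in b0.
set c := <<_, _>> in c0.
apply/eqP; apply: contraT => nn0.
have {nn0} n1 : n < 0 by rewrite lt_neqAle nn0.
pose B := 4 * cosh C / (- n).
have B0 : 0 <= B by rewrite divr_ge0 ?oppr_ge0 // mulr_ge0 // ltW // cosh_gt0.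
have := H B B0; rewrite -ler_cosh ?dH_ge0 //; last by apply: le_trans (H 0 _); rewrite ?dH_ge0.
rewrite cosh_dH !line_null // lorDl !lorDr !lorZl !lorZr -/n -/a -/b -/c.
have BE : B * (- n) = 4 * cosh C by rewrite /B divfK // lt0r_neq0 // oppr_gt0.
have eB := expR_ge1Dx B; have e0 := expR_gt0 (- B); have e1 := expR_gt0 B.
clearbody n a b c B.
move: (expR B) (expR (- B)) (cosh C) eB e0 e1 BE => e f k eB f0 e0 BE.
clear -n1 a0 b0 c0 B0 eB f0 e0 BE => le; exfalso.
have h1 : 0 <= e * f * (- a) by rewrite mulr_ge0 ?oppr_ge0 // mulr_ge0 // ltW.
have h2 : 0 <= e * f * (- b) by rewrite mulr_ge0 ?oppr_ge0 // mulr_ge0 // ltW.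
have h3 : 0 <= f * f * (- c) by rewrite mulr_ge0 ?oppr_ge0 // mulr_ge0 // ltW.
have h4 : B * (- n) < e * e * (- n) by rewrite ltr_pM2r ?oppr_gt0 //; nra.
by lra.
Qed.

(* A fixed point at infinity, represented by the null vector [N], scales [N]:
   this gives a homomorphism to the reals whose absolute value at [w] is the
   translation length of [rho w]. *)
Lemma irreducible_of_translates rho (eps : R) : 0 < eps ->
  (forall u : F2, primitive u -> exists g tau, translates (rho u) g tau /\ eps <= tau) ->
  irreducible rho.
Proof.
move=> e0 tr [r ray fixr].
have [|v fr rE] := @geodesic_on_line R d [set t | 0 <= t] r (lexx 0) ler01.
  by move=> s t s0 t0; rewrite dHE; apply: ray.
pose p := r 0; pose N := val p + v.
have N0 x : <<val x, N>> < 0 by exact: frame_null_future.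
(* The fixed end makes the image of [N] a multiple of [N], and invariance of the form turns this
   into a scaling of all pairings with [N]. *)
have scale (u : F2) : exists2 k, 0 < k & forall x, <<val (rho u x), N>> = k * <<val x, N>>.
  have geo := geodesic_isom (rho u) (line_geodesic fr).
  have [v' fr' E] := geodesicP geo; rewrite /= line0 // in fr' E.
  have ev t : rho u (line p v t) = line (rho u p) v' t by rewrite -E.
  have /asymptotic_dH[C HC] := fixr u.
  have z : <<val (rho u p) + v', N>> = 0.
    apply: (@lor_line_cosh _ _ _ _ C fr' fr) => t t0.
    by rewrite -ev -rE //; apply: HC.
  have [_ NE] := null_frame fr (frame_null fr') (frame_null_future p fr').
  have {z} NE := NE z; set mu := - <<val p, val (rho u p) + v'>> in NE.
  have mu0 : 0 < mu by rewrite oppr_gt0; apply: frame_null_future.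
  have inv x : <<val (rho u x), val (rho u p) + v'>> = <<val x, N>>.
    have := lor_isom (rho u) x (line p v 1); rewrite ev !val_line // !lor_lin lor_isom.
    have s1 : sinh (1 : R) != 0 by apply/eqP => /sinh_eq0/eqP; rewrite oner_eq0.
    by move=> /addrI/(mulfI s1) ->.
  exists mu^-1; first by rewrite invr_gt0.
  by move=> x; rewrite -(inv x) NE lorZr mulrA mulVf ?mul1r ?lt0r_neq0.
pose k (u : F2) := <<val (rho u p), N>> / <<val p, N>>.
have kE : forall (u : F2) x, <<val (rho u x), N>> = k u * <<val x, N>>.
  move=> u x; by have [k' k0 H] := scale u; rewrite H /k H mulfK // lt_eqF.
have k0 (u : F2) : 0 < k u.
  by have [k' k0' H] := scale u; rewrite /k H mulfK // lt_eqF.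
apply: (@no_bounded_below_hom (fun u => ln (k u)) eps) => //.
  move=> u u'; rewrite -lnM ?posrE //; congr ln.
  by rewrite {1}/k repM kE kE mulrA mulfK // lt_eqF.
move=> w pw; have [g [tau [[geo tau0 fg] et]]] := tr w pw.
apply: le_trans et _.
have [v' fr' gE] := geodesicP geo; rewrite gE in fg.
set q := g 0 in fr' gE fg.
set a := <<val q + v', N>>; set b := <<val q - v', N>>.
have L s : <<val (line q v' s), N>> = (expR s * a + expR (- s) * b) / 2.
  by rewrite line_null // lorDl !lorZl -/a -/b; field.
have H0 := kE w (line q v' 0); rewrite fg !L add0r oppr0 expR0 in H0.
have H1 := kE w (line q v' tau); rewrite fg !L in H1.
have ab : a + b < 0.
  by have := N0 (line q v' 0); rewrite L oppr0 expR0; clear; lra.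
have ee := expRxMexpNx_1 tau; have e1 : 1 < expR tau by rewrite expR_gt1.
rewrite opprD !expRD in H1.
(* Scaling at times 0 and [tau] along the axis forces a b (exp tau - exp (- tau))^2 = 0, so [N] is
   one of the ends of the axis. *)
have [kt|kt] : k w = expR tau \/ k w = expR (- tau).
  move: H0 H1 ab ee e1; clearbody a b; move: (expR tau) (expR (- tau)) (k w).
  clear=> X Y c H0 H1 ab XY X1.
  have H0' : X * a + Y * b = c * (a + b) by lra.
  have H1' : X * X * a + Y * Y * b = c * (X * a + Y * b) by lra.
  have : a * b * ((X - Y) * (X - Y)) = 0.
    have : (X * X * a + Y * Y * b) * (a + b) = (X * a + Y * b) * (X * a + Y * b).
      by rewrite H1' H0'; ring.
    by move=> *; lra.
  have XY0 : (X - Y) * (X - Y) != 0.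
    by rewrite mulf_neq0 // subr_eq0; apply/eqP => E; move: XY X1; rewrite -E; clear; nra.
  move/eqP; rewrite mulf_eq0 (negPf XY0) orbF mulf_eq0 => /orP[]/eqP z.
    right; move: H0' ab; rewrite z mulr0 !add0r => H b0; apply/esym/(mulIf _ H).
    by rewrite lt_eqF.
  left; move: H0' ab; rewrite z mulr0 !addr0 => H a0; apply/esym/(mulIf _ H).
  by rewrite lt_eqF.
- by rewrite kt expRK ler_norm.
- by rewrite kt expRK normrN ler_norm.
Qed.

End Representations.

(** * Finiteness from discreteness, and the two implications *)

Section Finiteness.
Local Open Scope classical_set_scope.
Variables (R : realType) (d : nat).
Local Notation "<< x , y >>" := (lor x y) (at level 0).
Implicit Types (x y z : hyp R d) (rho : representation R d).

(** The square of [x - y] is 2 (cosh of the distance) - 2, and at most the sum of the squared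
    differences of the [d] spatial coordinates. *)
Lemma dH_le_coord x y (eta delta : R) : 0 <= eta ->
  (forall j, `|val x ord0 j - val y ord0 j| <= delta) ->
  1 + d%:R * delta ^+ 2 / 2 <= cosh eta -> dH x y <= eta.
Proof.
move=> eta0 H le; rewrite -ler_cosh ?dH_ge0 //; apply: le_trans le.
have E : <<val x - val y, val x - val y>> = - 2 - 2 * <<val x, val y>>.
  rewrite !lor_lin !hyp_norm (lorC (val y)); clear; lor_atoms => *; ring.
have : <<val x - val y, val x - val y>> <= d%:R * delta ^+ 2.
  rewrite lorE /lorentz; apply: le_trans (_ : \sum_(i < d) delta ^+ 2 <= _); last first.
    by rewrite sumr_const card_ord mulr_natl.
  rewrite -[leRHS]add0r lerD //; first by rewrite oppr_le0 -expr2 sqr_ge0.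
  apply: ler_sum => i _; rewrite !mxE -expr2 -real_normK ?num_real //.
  by rewrite lerXn2r ?nnegrE //; apply: le_trans (H ord0).
rewrite E cosh_dH; clear; lor_atoms; move: (_ * delta ^+ 2) => *; lra.
Qed.

(* Cut the coordinates into intervals of length [delta]. *)
Lemma cells (o : hyp R d) (r eta : R) : 0 < eta ->
  exists (T : finType) (cell : hyp R d -> T), forall x y,
    dH o x <= r -> dH o y <= r -> cell x = cell y -> dH x y <= eta.
Proof.
move=> eta0.
have [delta delta0 Hdelta] : exists2 delta : R, 0 < delta &
    1 + d%:R * delta ^+ 2 / 2 <= cosh eta.
  have c1 : 0 < cosh eta - 1.
    by have := cosh2 eta; have := sinh_gt0 eta0; have := cosh_ge1 eta; clear; nra.
  have p0 : 0 < 2 * (cosh eta - 1) / d.+1%:R by rewrite divr_gt0 // mulr_gt0.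
  exists (Num.sqrt (2 * (cosh eta - 1) / d.+1%:R)); first by rewrite sqrtr_gt0.
  rewrite sqr_sqrtr; last exact: ltW.
  rewrite -lerBrDl.
  have -> : d%:R * (2 * (cosh eta - 1) / d.+1%:R) / 2 = (cosh eta - 1) * (d%:R / d.+1%:R).
    have : d.+1%:R != 0 :> R by rewrite pnatr_eq0.
    by move: (d.+1%:R) => k k0; field.
  by rewrite ler_piMr ?(ltW c1) // ler_pdivrMr // mul1r ler_nat.
pose B := 1 + cosh (dH (hyp_origin R d) o + r).
have bd x j : dH o x <= r -> `|val x ord0 j| <= B.
  move=> ox; have ox' : dH (hyp_origin R d) x <= dH (hyp_origin R d) o + r.
    by apply: le_trans (dH_triangle o _ _) _; rewrite lerD2l.
  apply: coord_le; first by rewrite hyp_norm; lra.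
  rewrite gtr0_norm ?hyp_coord0_gt0 // -[leLHS]opprK -lor_origin -cosh_dH.
  by rewrite ler_cosh ?dH_ge0 //; apply: le_trans ox'; apply: dH_ge0.
pose n := Num.truncn ((B + B) / delta).
pose idx x j : 'I_n.+1 := inord (Num.truncn ((val x ord0 j + B) / delta)).
exists {ffun 'I_d.+1 -> 'I_n.+1}, (fun x => [ffun j => idx x j]) => x y ox oy /ffunP E.
apply: (dH_le_coord (ltW eta0) _ Hdelta) => j.
have := E j; rewrite !ffunE => /(congr1 (@nat_of_ord n.+1)); rewrite /idx.
have pos z : dH o z <= r -> 0 <= (val z ord0 j + B) / delta.
  move=> oz; rewrite divr_ge0 ?(ltW delta0) //.
  by have := bd z j oz; rewrite ler_norml; clear; lra.
have small z : dH o z <= r -> (Num.truncn ((val z ord0 j + B) / delta) < n.+1)%N.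
  move=> oz; rewrite ltnS; apply: le_truncn.
  rewrite ler_pM2r ?invr_gt0 // lerD2r.
  by have := bd z j oz; rewrite ler_norml => /andP[].
rewrite !inordK ?small // => tE.
have := truncn_itv (pos x ox); have := truncn_itv (pos y oy); rewrite tE.
rewrite -natr1; set m := (_%:R); move=> /andP[y1 y2] /andP[x1 x2].
rewrite ler_norml; rewrite ltr_pdivrMr // in y2; rewrite ltr_pdivrMr // in x2.
rewrite ler_pdivlMr // in y1; rewrite ler_pdivlMr // in x1.
move: y1 y2 x1 x2; clear; move: (val x ord0 j) (val y ord0 j) m => a b m *.
by apply/andP; split; lra.
Qed.

(* Discreteness at the identity separates the elements moving [o] a bounded
   distance by their action on a finite net of a ball. *)
Lemma discrete_faithful_finite rho (o : hyp R d) (B : R) :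
  discrete_rep rho -> faithful_rep rho -> finite_set [set u | dH o (rho u o) <= B].
Proof.
move=> disc faith; have [q [r [eps [eps0 sep]]]] := disc 1%g.
pose B' := B + 2 * dH q o.
have near u : dH o (rho u o) <= B -> dH q (rho u q) <= B'.
  move=> ou; apply: le_trans (dH_triangle o _ _) _.
  have := dH_triangle (rho u o) o (rho u q); rewrite dH_isom (dHC o q).
  by rewrite /B'; move: ou; clear; move: (dH _ _) (dH _ _) (dH _ _) => *; lra.
have e4 : 0 < eps / 4 by rewrite divr_gt0.
have [T1 [c1 H1]] := @cells q r (eps / 4) e4.
have [T2 [c2 H2]] := @cells q (B' + r) (eps / 4) e4.
(* One representative for each cell of the ball, with [q] as dummy value for cells that miss it.
   Equal records [F u = F v] then leave three errors of at most [eps / 4] at each point of the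
   ball. *)
pose rep (c : T1) := xget q [set x | dH q x <= r /\ c1 x = c].
pose F u : {ffun T1 -> T2} := [ffun c => c2 (rho u (rep c))].
have inj u v : dH o (rho u o) <= B -> dH o (rho v o) <= B -> F u = F v -> u = v.
  move=> ou ov /ffunP Fuv.
  have close x : dH q x <= r -> dH (rho u x) (rho v x) < eps.
    move=> xr; set y := rep (c1 x).
    have [yr yc] : dH q y <= r /\ c1 y = c1 x.
      by apply: (@xgetPex _ q [set z | dH q z <= r /\ c1 z = c1 x]); exists x.
    have xy := H1 _ _ xr yr (esym yc).
    have ball w : dH o (rho w o) <= B -> dH q (rho w y) <= B' + r.
      move=> ow; apply: le_trans (dH_triangle (rho w q) _ _) _.
      by rewrite dH_isom lerD // near.
    have uv := H2 _ _ (ball u ou) (ball v ov).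
    have {}uv : dH (rho u y) (rho v y) <= eps / 4.
      by apply: uv; have := Fuv (c1 x); rewrite !ffunE.
    have := dH_triangle (rho u y) (rho u x) (rho v x).
    have := dH_triangle (rho v y) (rho u y) (rho v x).
    rewrite !dH_isom (dHC y x); move: xy uv eps0; clear.
    by move: (dH _ _) (dH _ _) (dH _ _) (dH _ _) => *; lra.
  have : rho (u^-1 * v)%g = rho 1%g.
    apply: sep => x ox; rewrite -dHE rep1 repM.
    by rewrite -(dH_isom (rho u)) repVK; apply: close; rewrite dHE.
  by move=> /faith/eqP; rewrite mulg_eq1 (inj_eq invg_inj) => /eqP.
pose S := [set u | dH o (rho u o) <= B].
pose g c := xget 1%g [set u | S u /\ F u = c].
apply: (@sub_finite_set _ _ (g @` setT)); last exact/finite_image/finite_finset.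
move=> u Su; exists (F u) => //.
have [Sg Fg] : S (g (F u)) /\ F (g (F u)) = F u.
  by apply: (@xgetPex _ 1%g [set w | S w /\ F w = F u]); exists u.
exact: inj Fg.
Qed.

Lemma conjugacy_class_conj (u h : F2) : conjugacy_class (u ^ h)%g = conjugacy_class u.
Proof.
apply/seteqP; split=> _ [g _ <-]; first by exists (h * g)%g => //; rewrite conjgM.
by exists (h^-1 * g)%g => //; rewrite conjgM conjgK.
Qed.

Lemma translates_conj rho (u h : F2) g tau : translates (rho u) g tau ->
  translates (rho (u ^ h)%g) (fun t => rho h^-1%g (g t)) tau.
Proof.
move=> [geo tau0 fg]; split=> // [|t]; first exact: (geodesic_isom (rho h^-1%g)).
by rewrite conjgE !repM repVK fg.
Qed.

Lemma bounded_intersection_Q rho (lambda : R) :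
  discrete_rep rho -> faithful_rep rho -> bounded_intersection rho ->
  Q_conditions lambda rho.
Proof.
move=> disc faith [_ prim [b _ [M HM]]]; split=> //.
(* Go from the base point to the axis, along it by the translation length, and back; the extra 1
   allows for a point of the axis that only nearly attains the infimum. *)
pose B := 2 * (M + 1) + lambda.
pose S := [set u | dH (b PalA) (rho u (b PalA)) <= B] `|`
  ([set u | dH (b PalL) (rho u (b PalL)) <= B] `|` [set u | dH (b PalB) (rho u (b PalB)) <= B]).
have finS : finite_set S by rewrite !finite_setU; split; [|split]; exact: discrete_faithful_finite.
apply: (@sub_finite_set _ _ (conjugacy_class @` S)); last exact: finite_image.
move=> _ [u [pu lu] <-].
have [X [h pal]] := primitive_conj_palindromic pu.
exists (u ^ h)%g; last exact: conjugacy_class_conj.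
have [g [tau tr]] := hyperbolic_translates (prim u pu).
rewrite (translation_lengthE tr) in lu.
have {}tr := translates_conj h tr.
have := HM X _ (primitive_conj h pu) pal; rewrite (AxisE tr).
set g' := (fun t => _) in tr *; have [/geodesic_dH geo tau0 fg] := tr => dM.
suff : dH (b X) (rho (u ^ h)%g (b X)) <= B.
  by case: X {pal dM} => H; [left|right; left|right; right].
have hi : has_inf [set hdist (b X) y | y in range g'].
  split; first by exists (hdist (b X) (g' 0)), (g' 0) => //; exists 0.
  by exists 0 => _ [y _ <-]; rewrite -dHE dH_ge0.
have [_ [_ [t _ <-] <-] lt] := inf_adherent ltr01 hi.
rewrite -dHE in lt; have {}lt : dH (b X) (g' t) <= M + 1.
  by apply: le_trans (ltW lt) _; rewrite lerD2r.
have := dH_triangle (g' t) (b X) (rho (u ^ h)%g (b X)).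
have := dH_triangle (rho (u ^ h)%g (g' t)) (g' t) (rho (u ^ h)%g (b X)).
rewrite dH_isom fg geo (dHC (g' t) (b X)) (_ : t - (t + tau) = - tau); last by ring.
rewrite normrN gtr0_norm // /B; move: lt lu; clear.
by move: (dH _ _) (dH _ _) (dH _ _) => *; lra.
Qed.

Lemma primitive_stable_bounded_intersection rho : (3 <= d)%N ->
  primitive_stable rho -> bounded_intersection rho.
Proof.
move=> d3 [q [K [c [K0 c0 stab]]]].
have [D D0 HD] := @axis_of_shift R d K c K0 c0.
have axis u p (m : nat) : primitive u -> (0 < m)%N -> cayley_axis u p ->
    (forall i, p (i + m%:Z) = (u * p i)%g) ->
    exists g tau, [/\ translates (rho u) g tau, m%:R / K <= tau &
      forall i, exists t, dH (rho (p i) q) (g t) <= D].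
  move=> pu m0 cp pS; have /quasi_geodesic_qgeod qg := stab u p pu cp.
  by apply: (HD (rho u) (fun i => rho (p i) q) m m0 qg) => i; rewrite -repM pS.
(* A Cayley axis has period at least one, so [K^-1] bounds all these translation lengths below; this
   uniform bound is what irreducibility needs. *)
have tr u : primitive u -> exists g tau, translates (rho u) g tau /\ K^-1 <= tau.
  move=> pu; have [p [m [m0 cp pS]]] := cayley_axis_exists (primitive_neq1 pu).
  have [g [tau [tr mt _]]] := axis u p m pu m0 cp pS.
  exists g, tau; split=> //; apply: le_trans mt.
  by rewrite ler_peMl ?invr_ge0 ?(ltW K0) // ler1n.
have prim : primitive_hyperbolic rho.
  by move=> u /tr[g [tau [tr' _]]]; apply: translates_hyperbolic tr'.
have Ki0 : 0 < K^-1 by rewrite invr_gt0.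
have irr : irreducible rho := irreducible_of_translates Ki0 tr.
split=> //.
have [b bP] := choice (fun X => base_point_exists X d3 irr prim).
exists b => //.
(* The Cayley axis of a palindrome passes through 1, so the axis of its image passes within [D] of
   [q]; the sum covers all three base points at once. *)
exists (dH (b PalA) q + dH (b PalL) q + dH (b PalB) q + D) => X u pu pal.
have [p [m [m0 cp pS p0]]] := palindromic_axis (primitive_neq1 pu) pal.
have [g [tau [tr' _ near]]] := axis u p m pu m0 cp pS.
rewrite (AxisE tr'); have [t] := near 0; rewrite p0 rep1 => ot.
apply: le_trans (_ : dH (b X) (g t) <= _).
  apply: ge_inf; first by exists 0 => _ [y _ <-]; rewrite -dHE dH_ge0.
  by exists (g t); [exists t|rewrite dHE].
apply: le_trans (dH_triangle q _ _) _; apply: lerD => //.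
have A0 := dH_ge0 (b PalA) q; have L0 := dH_ge0 (b PalL) q; have B0 := dH_ge0 (b PalB) q.
by case: X {pal}; move: A0 L0 B0; clear; move: (dH _ _) (dH _ _) (dH _ _) => *; lra.
Qed.

End Finiteness.

Theorem theorem1p11 (R : realType) (d : nat) (hd : (3 <= d)%N) :
  (forall rho : representation R d,
     primitive_stable rho -> bounded_intersection rho) /\
  (forall rho : representation R d,
     discrete_rep rho -> faithful_rep rho -> bounded_intersection rho ->
     forall lambda : R, 0 < lambda -> Q_conditions lambda rho).
Proof.
split=> rho; first exact: primitive_stable_bounded_intersection.
by move=> disc faith bip lambda _; apply: bounded_intersection_Q.
Qed.
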